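(* Let $k\in(0,1)$ and let $\gamma_\phi:\mathbb{C}/(\mathbb{Z}\omega_1+\mathbb{Z}\omega_2)\to S^2\subset\mathbb{R}^3$ be the Euclidean Gauss map of the minimal surface $\phi=\mathrm{Re}(\Phi)$ determined by $k$. (i) As $u$ passes from $\omega_1/4$ to $\omega_1/4+\omega_2$ along $V_{1/4}$, $\gamma_\phi(u)$ winds once around the great circle on $S^2$ that projects to the $\underline e_1$-axis under stereographic projection from $-\underline e_3$. The analogue holds on $V_{3/4}$: as $u$ passes from $3\omega_1/4$ to $3\omega_1/4+\omega_2$ along $V_{3/4}$, $\gamma_\phi(u)$ winds once around the same great circle. (ii) As $u$ passes from $\omega_2/4$ to $\omega_2/4+\omega_1$ along $H_{1/4}$, $\gamma_\phi(u)$ winds once around the great circle on $S^2$ that projects to the $\underline e_2$-axis under stereographic projection from $-\underline e_3$.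
   Context: For $k\in(0,1)$: $k'=\sqrt{1-k^2}$, $K(k)=\int_0^{\pi/2}\frac{d\psi}{\sqrt{1-k^2\sin^2\psi}}$, $\omega_1=2\sqrt{kk'}K(k)$, $\omega_2=2i\sqrt{kk'}K(k')$, $\omega_3=\omega_1+\omega_2$; $\wp$ is the Weierstrass function of $\mathbb{Z}\omega_1+\mathbb{Z}\omega_2$, $e_j=\wp(\omega_j/2)$; $\mathrm{f}_j$ is the meromorphic square root of $\wp-e_j$ with residue $1$ at $0$. In coordinates with respect to the orthonormal axes $(\underline e_1,\underline e_2,\underline e_3)$ (monopole coordinates) the null curve is $\Phi(u)=\frac{\omega_1}{4}\big(-k\,\mathrm{f}_1(2u)^3,\ k'\,\mathrm{f}_2(2u)^3,\ -i\,\mathrm{f}_3(2u)^3\big)$. The Gauss map $\gamma_\phi$ is normalized so that its composition with stereographic projection $x\mapsto(x_1+ix_2)/(1+x_3)$ from $-\underline e_3$ to the $(\underline e_1,\underline e_2)$-plane is $g_\Phi(u)=\frac{-i\,\mathrm{f}_3(2u)}{k\,\mathrm{f}_1(2u)+ik'\,\mathrm{f}_2(2u)}$; it is defined on the whole torus. $V_a=\{a\omega_1+iy:0\le y<|\omega_2|\}$ and $H_a=\{x+a\omega_2:0\le x<|\omega_1|\}$. *)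

(* Defs.v *)
From Stdlib Require Export Reals ZArith.
From Coquelicot Require Export Coquelicot.
Open Scope R_scope.

Notation R3 := (R * R * R)%type.

(* The complementary modulus k'. *)
Definition kc (k : R) : R := sqrt (1 - k ^ 2).

Definition ellK (k : R) : R :=
  RInt (fun psi => / sqrt (1 - k ^ 2 * sin psi ^ 2)) 0 (PI / 2).

Definition omega1 (k : R) : C := RtoC (2 * sqrt (k * kc k) * ellK k).
Definition omega2 (k : R) : C := (Ci * RtoC (2 * sqrt (k * kc k) * ellK (kc k)))%C.
Definition omega3 (k : R) : C := (omega1 k + omega2 k)%C.

Definition lattice_pt (w1 w2 : C) (m n : Z) : C :=
  (RtoC (IZR m) * w1 + RtoC (IZR n) * w2)%C.

Definition in_lattice (w1 w2 z : C) : Prop :=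
  exists m n : Z, z = lattice_pt w1 w2 m n.

Definition wp_term (w1 w2 z : C) (m n : Z) : C :=
  if (Z.eqb m 0 && Z.eqb n 0)%bool then RtoC 0
  else (/ (z - lattice_pt w1 w2 m n) ^ 2 - / (lattice_pt w1 w2 m n) ^ 2)%C.

(* The sum over the square |m| <= N, |n| <= N. *)
Definition wp_square_sum (w1 w2 z : C) (N : nat) : C :=
  sum_n (fun i : nat =>
    sum_n (fun j : nat =>
      wp_term w1 w2 z (Z.of_nat i - Z.of_nat N) (Z.of_nat j - Z.of_nat N))
      (2 * N)) (2 * N).

(* The series converges absolutely off the lattice, so exhausting Z^2 by squares
   gives its value.  The value at lattice points is meaningless. *)
Definition wp (w1 w2 z : C) : C :=
  (/ z ^ 2 +
   (real (Lim_seq (fun N => Re (wp_square_sum w1 w2 z N))),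
    real (Lim_seq (fun N => Im (wp_square_sum w1 w2 z N)))))%C.

Definition holomorphic_at (f : C -> C) (z : C) : Prop :=
  ex_derive (K := C_AbsRing) (V := C_NormedModule) f z.

Definition meromorphic_at (f : C -> C) (z0 : C) : Prop :=
  exists (n : nat) (r : R) (h : C -> C),
    0 < r /\
    (forall z : C, Cmod (z - z0) < r -> holomorphic_at h z) /\
    (forall z : C, 0 < Cmod (z - z0) < r -> ((z - z0) ^ n * f z)%C = h z).

Definition simple_pole_with_residue (f : C -> C) (z0 c : C) : Prop :=
  exists (r : R) (h : C -> C),
    0 < r /\
    (forall z : C, Cmod (z - z0) < r -> holomorphic_at h z) /\
    (forall z : C, 0 < Cmod (z - z0) < r -> f z = (c / (z - z0) + h z)%C).

(* [f] is the meromorphic square root of wp - wp (w / 2) with residue 1 at 0.  It is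
   represented by a total function, whose values at its poles, the lattice points,
   are unconstrained. *)
Definition is_wp_root (k : R) (w : C) (f : C -> C) : Prop :=
  (forall z : C, in_lattice (omega1 k) (omega2 k) z -> meromorphic_at f z) /\
  (forall z : C, ~ in_lattice (omega1 k) (omega2 k) z ->
     holomorphic_at f z /\
     (f z ^ 2)%C =
       (wp (omega1 k) (omega2 k) z - wp (omega1 k) (omega2 k) (w / 2))%C) /\
  simple_pole_with_residue f 0 1.

Definition null_curve (k : R) (f1 f2 f3 : C -> C) (u : C) : C * C * C :=
  ((omega1 k / 4 * (- RtoC k * f1 (2 * u) ^ 3))%C,
   (omega1 k / 4 * (RtoC (kc k) * f2 (2 * u) ^ 3))%C,
   (omega1 k / 4 * (- Ci * f3 (2 * u) ^ 3))%C).

Definition minimal_surface (k : R) (f1 f2 f3 : C -> C) (u : C) : R3 :=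
  let '(P1, P2, P3) := null_curve k f1 f2 f3 u in (Re P1, Re P2, Re P3).

Definition g_Phi (k : R) (f1 f2 f3 : C -> C) (u : C) : C :=
  (- Ci * f3 (2 * u) / (RtoC k * f1 (2 * u) + Ci * RtoC (kc k) * f2 (2 * u)))%C.

Definition dot (x y : R3) : R :=
  let '(x1, x2, x3) := x in let '(y1, y2, y3) := y in x1 * y1 + x2 * y2 + x3 * y3.

Definition sphere (x : R3) : Prop := dot x x = 1.
Definition south_pole : R3 := (0, 0, -1).

(* Stereographic projection from the south pole, meaningful away from it. *)
Definition stereo (x : R3) : C :=
  let '(x1, x2, x3) := x in (x1 / (1 + x3), x2 / (1 + x3)).

(* The derivative at u of phi in the direction v. *)
Definition dir_derive (phi : C -> R3) (u v : C) : R3 :=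
  (Derive (fun t : R => fst (fst (phi (u + RtoC t * v)%C))) 0,
   Derive (fun t : R => snd (fst (phi (u + RtoC t * v)%C))) 0,
   Derive (fun t : R => snd (phi (u + RtoC t * v)%C)) 0).

(* phi_x and phi_y are linearly independent at u (their Gram determinant is nonzero). *)
Definition immersed_at (phi : C -> R3) (u : C) : Prop :=
  let px := dir_derive phi u 1 in
  let py := dir_derive phi u Ci in
  dot px px * dot py py - dot px py ^ 2 <> 0.

(* [gamma] is the Gauss map of phi = Re Phi.  A map from the torus is a doubly periodic
   map on C.  Off the discrete set of ends (2u in the lattice) and branch points of phi
   it is a unit normal.  The side is fixed by requiring that its stereographic
   projection be g_Phi; this is stated where the formula for g_Phi involves neither a
   pole of the f_j nor a zero denominator, i.e. off a discrete set, across which gamma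
   extends by continuity. *)
Definition is_gauss_map (k : R) (f1 f2 f3 : C -> C) (gamma : C -> R3) : Prop :=
  (forall u : C, gamma (u + omega1 k)%C = gamma u) /\
  (forall u : C, gamma (u + omega2 k)%C = gamma u) /\
  (forall u : C, continuous gamma u) /\
  (forall u : C, sphere (gamma u)) /\
  (forall u : C, ~ in_lattice (omega1 k) (omega2 k) (2 * u)%C ->
     immersed_at (minimal_surface k f1 f2 f3) u ->
     dot (gamma u) (dir_derive (minimal_surface k f1 f2 f3) u 1) = 0 /\
     dot (gamma u) (dir_derive (minimal_surface k f1 f2 f3) u Ci) = 0) /\
  (forall u : C, ~ in_lattice (omega1 k) (omega2 k) (2 * u)%C ->
     (RtoC k * f1 (2 * u) + Ci * RtoC (kc k) * f2 (2 * u))%C <> RtoC 0 ->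
     gamma u <> south_pole /\ stereo (gamma u) = g_Phi k f1 f2 f3 u).

(* The coordinate axes of the plane of projection, identified with C. *)
Definition e1_axis (w : C) : Prop := Im w = 0.
Definition e2_axis (w : C) : Prop := Re w = 0.

(* The circle on the sphere that projects to the line L; it contains the centre of
   projection, which corresponds to the point at infinity of L. *)
Definition circle_over (L : C -> Prop) (x : R3) : Prop :=
  sphere x /\ (x = south_pole \/ L (stereo x)).

Definition circle_point (a b : R3) (t : R) : R3 :=
  let '(a1, a2, a3) := a in
  let '(b1, b2, b3) := b in
  (cos t * a1 + sin t * b1, cos t * a2 + sin t * b2, cos t * a3 + sin t * b3).

(* G is the great circle spanned by an orthonormal pair (a, b), and the path p on
   [0, T] lies on G with winding number 1 or -1 (no orientation of G is fixed): its
   continuous angle theta changes by a total of 2 pi or -2 pi. *)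
Definition winds_once_around (G : R3 -> Prop) (p : R -> R3) (T : R) : Prop :=
  exists (a b : R3) (theta : R -> R),
    dot a a = 1 /\ dot b b = 1 /\ dot a b = 0 /\
    (forall x : R3, G x <-> exists t : R, x = circle_point a b t) /\
    (forall t : R, 0 <= t <= T -> continuous theta t) /\
    (forall t : R, 0 <= t <= T -> p t = circle_point a b (theta t)) /\
    Rabs (theta T - theta 0) = 2 * PI.

(* The parametrizations of V_a and H_a; the full turns are 0 <= y <= |omega2| and
   0 <= x <= |omega1|. *)
Definition V_line (k a y : R) : C := (RtoC a * omega1 k + Ci * RtoC y)%C.
Definition H_line (k a x : R) : C := (RtoC x + RtoC a * omega2 k)%C.

(* Main.v *)
(* With k' the complementary modulus, s = sqrt (k k') and Jacobi's function ns of modulus k,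
   wp(z) = c + ns(z/s)^2 / s^2: both sides are elliptic for the same lattice, and their
   difference is bounded, hence constant by Liouville's theorem.  This gives the squares of
   f1, f2, f3 in closed form.  On the lines in question 2u has real or imaginary part half a
   period, so these squares are elementary in the real functions sn, cn, dn; since the f_j are
   differentiable and sn, cn have simple zeros, each f_j is a fixed branch of the square root.
   The Gauss map is then, up to signs, (cd, k' sd) in the relevant coordinate plane, a point of
   the unit circle that makes one turn over [0, 4K].  On V_a the moduli k and k' are exchanged. *)

Require Import Defs.
From Stdlib Require Import Reals Lra Lia List ZArith.
From Stdlib Require Import Classical ClassicalEpsilon IndefiniteDescription.
From Coquelicot Require Import Coquelicot.
Open Scope R_scope.

(** Holomorphy of [wp] is not extracted from its series: off the lattice [wp] equals [f ^ 2 + e] for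
    a given root [f] and inherits differentiability from it. The value of [wp] is a [Lim_seq],
    defined for every sequence; bounded square sums and vanishing differences of such sums then
    suffice for periodicity and evenness. The delicate point of boundedness is the pole: residue 1
    alone would allow [f ^ 2] a term in [1 / z], and evenness of [wp] excludes it. Differentiability
    is pointwise, with no continuity of the derivative, so Liouville's theorem rests on Goursat's
    bisection. It is applied to a function that is uncontrolled at the lattice points; these
    singularities are removed at the level of integrals, using boundedness alone. The signs of the
    roots are never determined: they are absorbed into the orthonormal pair that spans the great
    circle. *)

(** * Complex differentiability *)

(* Partial derivatives [L], [M] of a complex function: f is complex differentiable
   iff it is Frechet differentiable with [M = i L] (Cauchy-Riemann). *)
Definition frechet (f : C -> C) (z L M : C) : Prop :=
  forall eps : R, 0 < eps -> exists d : R, 0 < d /\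
    forall w : C, Cmod (w - z) < d ->
      Cmod (f w - f z - (L * RtoC (Re (w - z)) + M * RtoC (Im (w - z)))) <=
        eps * Cmod (w - z).

Definition cderiv (f : C -> C) (z l : C) : Prop := frechet f z l (Ci * l).

Ltac Rmin_le := lazymatch goal with
  | |- Rmin ?a ?b <= _ => first [apply Rmin_l | apply Rmin_r
      | apply Rle_trans with (1 := Rmin_l a b); Rmin_le | apply Rle_trans with (1 := Rmin_r a b);
        Rmin_le]
  | |- ?x <= _ => is_var x; unfold x; Rmin_le end.

Lemma Ci_sq : (Ci * Ci = - (1))%C.
Proof. unfold Ci, Cmult, Copp, RtoC; simpl; f_equal; ring. Qed.

(** When [M = Ci * L] the two partials act as one complex multiplication; this converts between
    [frechet] and the usual difference quotient. *)
Lemma Cre_im (h l : C) : (l * RtoC (Re h) + Ci * l * RtoC (Im h) = l * h)%C.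
Proof.
destruct h as [a b]; destruct l as [x y]; unfold Cmult, Cplus, Ci, RtoC, Re, Im; simpl.
f_equal; ring.
Qed.

Lemma Cmod_im_le (z : C) : Rabs (Im z) <= Cmod z.
Proof.
destruct z as [x y]; unfold Im; simpl; apply Rle_trans with (2 := Rmax_Cmod (x, y)), Rmax_r.
Qed.

Lemma Cmod_le_re_im (z : C) : Cmod z <= Rabs (Re z) + Rabs (Im z).
Proof.
destruct z as [x y]; unfold Re, Im; simpl.
replace (x, y) with (RtoC x + Ci * RtoC y)%C
  by (unfold Cmult, Cplus, Ci, RtoC; simpl; f_equal; ring).
apply Rle_trans with (1 := Cmod_triangle _ _).
rewrite Cmod_mult, Cmod_Ci, !Cmod_R; lra.
Qed.

Lemma Cmod_minus_sym (z w : C) : Cmod (z - w) = Cmod (w - z).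
Proof. rewrite <- Cmod_opp; f_equal; ring. Qed.

Lemma Cmod_triangle_minus (z w : C) : Cmod (z - w) <= Cmod z + Cmod w.
Proof. apply Rle_trans with (1 := Cmod_triangle _ _); rewrite Cmod_opp; lra. Qed.

Lemma Cmod_triangle_inv (z w : C) : Cmod z - Cmod w <= Cmod (z - w).
Proof.
assert (H := Cmod_triangle (z - w) w); replace (z - w + w)%C with z in H by ring; lra.
Qed.

Lemma Cmod_neq_0 (z : C) : 0 < Cmod z -> z <> 0.
Proof. intros H; apply Cmod_gt_0, H. Qed.

Lemma Cmod_lin_le (L M h : C) :
  Cmod (L * RtoC (Re h) + M * RtoC (Im h)) <= (Cmod L + Cmod M) * Cmod h.
Proof.
apply Rle_trans with (1 := Cmod_triangle _ _).
rewrite !Cmod_mult, !Cmod_R.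
assert (H1 := re_le_Cmod h); assert (H2 := Cmod_im_le h).
assert (H3 := Cmod_ge_0 L); assert (H4 := Cmod_ge_0 M); nra.
Qed.

Lemma frechet_lipschitz (f : C -> C) (z L M : C) :
  frechet f z L M -> exists d : R, 0 < d /\
    forall w : C, Cmod (w - z) < d ->
      Cmod (f w - f z) <= (Cmod L + Cmod M + 1) * Cmod (w - z).
Proof.
intros H; destruct (H 1 Rlt_0_1) as [d [Hd H1]]; exists d; split; [exact Hd | intros w Hw].
specialize (H1 w Hw); assert (H2 := Cmod_lin_le L M (w - z)).
set (lin := (L * _ + M * _)%C) in *.
replace (f w - f z)%C with ((f w - f z - lin) + lin)%C by ring.
apply Rle_trans with (1 := Cmod_triangle _ _); lra.
Qed.

Lemma frechet_cont (f : C -> C) (z L M : C) :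
  frechet f z L M -> forall eps : R, 0 < eps -> exists d : R, 0 < d /\
    forall w : C, Cmod (w - z) < d -> Cmod (f w - f z) < eps.
Proof.
intros H eps Heps; destruct (frechet_lipschitz f z L M H) as [d [Hd H1]].
set (K := Cmod L + Cmod M + 1) in *.
assert (HK : 0 < K) by (assert (H3 := Cmod_ge_0 L); assert (H4 := Cmod_ge_0 M); unfold K; lra).
exists (Rmin d (eps / K)); split.
- apply Rmin_pos; [exact Hd | apply Rdiv_lt_0_compat; lra].
- intros w Hw; apply Rle_lt_trans with (1 := H1 w (Rlt_le_trans _ _ _ Hw (Rmin_l _ _))).
  apply Rlt_le_trans with (K * (eps / K)).
  + apply Rmult_lt_compat_l; [exact HK | exact (Rlt_le_trans _ _ _ Hw (Rmin_r _ _))].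
  + right; field; lra.
Qed.

Lemma frechet_ext_loc (f g : C -> C) (z L M : C) (r : R) :
  0 < r -> (forall w : C, Cmod (w - z) < r -> f w = g w) ->
  frechet f z L M -> frechet g z L M.
Proof.
intros Hr E H eps Heps; destruct (H eps Heps) as [d [Hd H1]].
exists (Rmin d r); split; [now apply Rmin_pos | intros w Hw].
rewrite <- !E; [apply H1 | |].
- exact (Rlt_le_trans _ _ _ Hw (Rmin_l _ _)).
- replace (z - z)%C with (RtoC 0) by ring; rewrite Cmod_0; exact Hr.
- exact (Rlt_le_trans _ _ _ Hw (Rmin_r _ _)).
Qed.

Lemma frechet_const (c z : C) : frechet (fun _ => c) z 0 0.
Proof.
intros eps Heps; exists 1; split; [lra | intros w _].
match goal with |- Cmod ?x <= _ => replace x with (RtoC 0) by ring end.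
rewrite Cmod_0; apply Rmult_le_pos; [lra | apply Cmod_ge_0].
Qed.

Lemma frechet_id (z : C) : frechet (fun w => w) z 1 Ci.
Proof.
intros eps Heps; exists 1; split; [lra | intros w _].
replace (Ci * _)%C with (Ci * 1 * RtoC (Im (w - z)))%C by ring; rewrite Cre_im.
match goal with |- Cmod ?x <= _ => replace x with (RtoC 0) by ring end.
rewrite Cmod_0; apply Rmult_le_pos; [lra | apply Cmod_ge_0].
Qed.

Lemma frechet_plus (f g : C -> C) (z L M L' M' : C) :
  frechet f z L M -> frechet g z L' M' ->
  frechet (fun w => f w + g w)%C z (L + L') (M + M').
Proof.
intros Hf Hg eps Heps.
destruct (Hf (eps / 2)) as [d [Hd H1]]; [lra |].
destruct (Hg (eps / 2)) as [d' [Hd' H2]]; [lra |].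
exists (Rmin d d'); split; [now apply Rmin_pos | intros w Hw].
specialize (H1 w (Rlt_le_trans _ _ _ Hw (Rmin_l _ _))).
specialize (H2 w (Rlt_le_trans _ _ _ Hw (Rmin_r _ _))).
match type of H1 with Cmod ?x <= _ => match type of H2 with Cmod ?y <= _ =>
  match goal with |- Cmod ?t <= _ => replace t with (x + y)%C by ring end end end.
apply Rle_trans with (1 := Cmod_triangle _ _); lra.
Qed.

Lemma frechet_mult (f g : C -> C) (z L M L' M' : C) :
  frechet f z L M -> frechet g z L' M' ->
  frechet (fun w => f w * g w)%C z (f z * L' + g z * L) (f z * M' + g z * M).
Proof.
intros Hf Hg eps Heps.
destruct (frechet_lipschitz f z L M Hf) as [d1 [Hd1 H1]].
destruct (frechet_lipschitz g z L' M' Hg) as [d2 [Hd2 H2]].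
set (A := Cmod L + Cmod M + 1) in *; set (B := Cmod L' + Cmod M' + 1) in *.
assert (HA : 0 < A) by (assert (H3 := Cmod_ge_0 L); assert (H4 := Cmod_ge_0 M); unfold A; lra).
assert (HB : 0 < B) by (assert (H3 := Cmod_ge_0 L'); assert (H4 := Cmod_ge_0 M'); unfold B; lra).
assert (Hfz := Cmod_ge_0 (f z)); assert (Hgz := Cmod_ge_0 (g z)).
(* The error of the product is [f z] times the error of [g], plus [g z] times that of [f], plus the
   product of the increments. With both errors at most [e * h] and [h < e], the three sum to at most
   [(D - 1) * (e * h)]. *)
set (D := Cmod (f z) + Cmod (g z) + A * B + 1).
assert (HAB := Rmult_lt_0_compat _ _ HA HB).
assert (HD : 0 < D) by (unfold D; lra).
set (e := eps / D); assert (He : 0 < e) by (apply Rdiv_lt_0_compat; lra).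
destruct (Hf e He) as [d3 [Hd3 H3]]; destruct (Hg e He) as [d4 [Hd4 H4]].
exists (Rmin e (Rmin (Rmin d1 d2) (Rmin d3 d4))); split.
{ repeat apply Rmin_pos; assumption. }
intros w Hw.
assert (W0 := Rlt_le_trans _ _ _ Hw (Rmin_l _ _)).
specialize (H1 w ltac:(apply Rlt_le_trans with (1 := Hw); Rmin_le)).
specialize (H2 w ltac:(apply Rlt_le_trans with (1 := Hw); Rmin_le)).
specialize (H3 w ltac:(apply Rlt_le_trans with (1 := Hw); Rmin_le)).
specialize (H4 w ltac:(apply Rlt_le_trans with (1 := Hw); Rmin_le)).
assert (Hh := Cmod_ge_0 (w - z)); set (h := Cmod (w - z)) in *.
match type of H3 with Cmod ?x <= _ => match type of H4 with Cmod ?y <= _ =>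
  match goal with |- Cmod ?t <= _ =>
   replace t with (f z * y + g z * x + (f w - f z) * (g w - g z))%C by ring end end end.
apply Rle_trans with (1 := Cmod_triangle _ _).
apply Rle_trans with (1 := Rplus_le_compat_r _ _ _ (Cmod_triangle _ _)).
rewrite !Cmod_mult.
assert (P1 := Rmult_le_compat_l _ _ _ Hfz H4).
assert (P2 := Rmult_le_compat_l _ _ _ Hgz H3).
assert (P3 := Rmult_le_compat _ _ _ _ (Cmod_ge_0 _) (Cmod_ge_0 _) H1 H2).
assert (P4 : A * h * (B * h) <= A * B * (e * h)).
{ replace (A * h * (B * h)) with (A * B * (h * h)) by ring.
  apply Rmult_le_compat_l; [lra | apply Rmult_le_compat_r; lra]. }
apply Rle_trans with ((D - 1) * (e * h)); [unfold D; lra |].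
apply Rle_trans with (D * (e * h)); [| unfold e; right; field; lra].
apply Rmult_le_compat_r; [apply Rmult_le_pos; lra | lra].
Qed.

Lemma frechet_inv (f : C -> C) (z L M : C) :
  f z <> 0 -> frechet f z L M ->
  frechet (fun w => / f w)%C z (- L / (f z * f z)) (- M / (f z * f z)).
Proof.
intros Hz Hf eps Heps.
destruct (frechet_lipschitz f z L M Hf) as [d1 [Hd1 H1]].
set (A := Cmod L + Cmod M + 1) in *.
assert (HL := Cmod_ge_0 L); assert (HM := Cmod_ge_0 M).
assert (HA : 0 < A) by (unfold A; lra).
assert (Hm := proj1 (Cmod_gt_0 _) Hz); set (m := Cmod (f z)) in *.
set (D := m + A * A).
assert (HD : 0 < D) by (unfold D; nra).
assert (Hm3 : 0 < m * m * m) by (repeat apply Rmult_lt_0_compat; exact Hm).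
(* [m ^ 3 / 2] bounds the denominator [f w * f z ^ 2] from below once [|f w| >= m / 2]; [D] collects
   the two numerator terms, [lin * (f w - f z)] and [er * f z]. *)
set (e := eps * (m * m * m / 2) / D).
assert (He : 0 < e).
{ apply Rdiv_lt_0_compat; [apply Rmult_lt_0_compat; lra | exact HD]. }
destruct (Hf e He) as [d2 [Hd2 H2]].
destruct (frechet_cont f z L M Hf (m / 2)) as [d3 [Hd3 H3]]; [lra |].
exists (Rmin e (Rmin d1 (Rmin d2 d3))); split; [repeat apply Rmin_pos; assumption |].
intros w Hw.
assert (W0 := Rlt_le_trans _ _ _ Hw (Rmin_l _ _)).
specialize (H1 w ltac:(apply Rlt_le_trans with (1 := Hw); Rmin_le)).
specialize (H2 w ltac:(apply Rlt_le_trans with (1 := Hw); Rmin_le)).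
specialize (H3 w ltac:(apply Rlt_le_trans with (1 := Hw); Rmin_le)).
assert (Hfw : m / 2 <= Cmod (f w)).
{ assert (T := Cmod_triangle_inv (f z) (f w)); rewrite Cmod_minus_sym in T; fold m in T; lra. }
assert (Hw0 : f w <> 0) by (apply Cmod_neq_0; lra).
assert (Hlin := Cmod_lin_le L M (w - z)).
assert (Hh := Cmod_ge_0 (w - z)); set (h := Cmod (w - z)) in *.
set (lin := (L * RtoC (Re (w - z)) + M * RtoC (Im (w - z)))%C) in *.
set (er := (f w - f z - lin)%C) in *.
replace (/ f w - / f z - (- L / (f z * f z) * RtoC (Re (w - z)) + - M / (f z * f z) * RtoC (Im (w - z))))%C
  with ((lin * (f w - f z) - er * f z) / (f w * (f z * f z)))%C
  by (unfold er, lin; field; split; assumption).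
rewrite Cmod_div by (repeat apply Cmult_neq_0; assumption).
rewrite !Cmod_mult; fold m.
apply Rle_div_l; [apply Rlt_gt; repeat apply Rmult_lt_0_compat; lra |].
apply Rle_trans with (1 := Cmod_triangle_minus _ _); rewrite !Cmod_mult; fold m.
assert (Q1 : Cmod lin * Cmod (f w - f z) <= (A * h) * (A * h)).
{ apply Rmult_le_compat; try apply Cmod_ge_0; [unfold A; nra | exact H1]. }
assert (Q2 : Cmod er * m <= (e * h) * m) by (apply Rmult_le_compat_r; lra).
assert (Q3 : (A * h) * (A * h) <= A * A * (e * h)).
{ replace (A * h * (A * h)) with (A * A * (h * h)) by ring.
  apply Rmult_le_compat_l; [nra | apply Rmult_le_compat_r; lra]. }
apply Rle_trans with (D * (e * h)); [unfold D; lra |].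
replace (D * (e * h)) with (eps * h * (m * m * m / 2)) by (unfold e; field; lra).
apply Rmult_le_compat_l; [apply Rmult_le_pos; lra | nra].
Qed.

Lemma derive_coordinate (pr : C -> R) (p : R -> R) (z : C) (l : R) :
  (forall w, pr (w - z)%C = pr w - pr z) -> (forall w, Rabs (pr w) <= Cmod w) ->
  is_derive p (pr z) l -> forall eps : R, 0 < eps -> exists d : R, 0 < d /\
    forall w : C, Cmod (w - z) < d ->
      Cmod (RtoC (p (pr w)) - RtoC (p (pr z)) - RtoC l * RtoC (pr (w - z)%C)) <= eps * Cmod (w - z).
Proof.
intros Hpr Hle H eps Heps.
apply is_derive_Reals in H; destruct (H eps Heps) as [d Hd].
exists d; split; [apply cond_pos | intros w Hw].
specialize (Hle (w - z)%C).
rewrite <- RtoC_mult, <- !RtoC_minus, Cmod_R.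
destruct (Req_dec (pr (w - z)%C) 0) as [E | E].
- rewrite E; replace (pr w) with (pr z) by (rewrite Hpr in E; lra).
  replace (p (pr z) - p (pr z) - l * 0) with 0 by ring; rewrite Rabs_R0.
  apply Rmult_le_pos; [lra | apply Cmod_ge_0].
- specialize (Hd (pr (w - z)%C) E (Rle_lt_trans _ _ _ Hle Hw)).
  replace (pr z + pr (w - z)%C) with (pr w) in Hd by (rewrite Hpr; ring).
  replace (p (pr w) - p (pr z) - l * pr (w - z)%C)
    with (((p (pr w) - p (pr z)) / pr (w - z)%C - l) * pr (w - z)%C) by (field; exact E).
  rewrite Rabs_mult; apply Rmult_le_compat; try apply Rabs_pos; lra.
Qed.

(** A function of one coordinate is rarely holomorphic. Carrying both partials lets [nsC] be
    differentiated factor by factor, with Cauchy-Riemann checked only for the result. *)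
Lemma frechet_re (p : R -> R) (z : C) (l : R) :
  is_derive p (Re z) l -> frechet (fun w => RtoC (p (Re w))) z (RtoC l) 0.
Proof.
intros H eps Heps.
destruct (derive_coordinate Re p z l ltac:(now intros [];
  destruct z) re_le_Cmod H eps Heps) as [d [Hd H1]].
exists d; split; [exact Hd | intros w Hw]; rewrite Cmult_0_l, Cplus_0_r; now apply H1.
Qed.

Lemma frechet_im (p : R -> R) (z : C) (l : R) :
  is_derive p (Im z) l -> frechet (fun w => RtoC (p (Im w))) z 0 (RtoC l).
Proof.
intros H eps Heps.
destruct (derive_coordinate Im p z l ltac:(now intros [];
  destruct z) Cmod_im_le H eps Heps) as [d [Hd H1]].
exists d; split; [exact Hd | intros w Hw]; rewrite Cmult_0_l, Cplus_0_l; now apply H1.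
Qed.

Lemma cderiv_error (f : C -> C) (z l : C) :
  cderiv f z l -> forall eps : R, 0 < eps -> exists d : R, 0 < d /\
    forall w : C, Cmod (w - z) < d ->
      Cmod (f w - f z - l * (w - z)) <= eps * Cmod (w - z).
Proof.
intros H eps Heps; destruct (H eps Heps) as [d [Hd H1]]; exists d; split; [exact Hd |].
intros w Hw; rewrite <- (Cre_im (w - z) l); exact (H1 w Hw).
Qed.

Lemma holomorphic_at_cderiv (f : C -> C) (z : C) :
  holomorphic_at f z -> exists l : C, cderiv f z l.
Proof.
intros [l [_ H]]; exists l; intros eps Heps.
destruct (H z (fun P HP => HP) (mkposreal eps Heps)) as [d Hd].
exists d; split; [apply cond_pos | intros w Hw].
rewrite Cre_im.
replace (l * (w - z))%C with ((w - z) * l)%C by ring.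
exact (Hd w Hw).
Qed.

Lemma cderiv_const (c z : C) : cderiv (fun _ => c) z 0.
Proof.
unfold cderiv; replace (Ci * 0)%C with (RtoC 0) by ring; apply frechet_const.
Qed.

Lemma cderiv_id (z : C) : cderiv (fun w => w) z 1.
Proof. unfold cderiv; replace (Ci * 1)%C with Ci by ring; apply frechet_id. Qed.

Lemma cderiv_plus (f g : C -> C) (z l l' : C) :
  cderiv f z l -> cderiv g z l' -> cderiv (fun w => f w + g w)%C z (l + l').
Proof.
intros Hf Hg; unfold cderiv.
replace (Ci * (l + l'))%C with (Ci * l + Ci * l')%C by ring; now apply frechet_plus.
Qed.

Lemma cderiv_mult (f g : C -> C) (z l l' : C) :
  cderiv f z l -> cderiv g z l' ->
  cderiv (fun w => f w * g w)%C z (f z * l' + g z * l).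
Proof.
intros Hf Hg; unfold cderiv.
replace (Ci * _)%C with (f z * (Ci * l') + g z * (Ci * l))%C by ring; now apply frechet_mult.
Qed.

Lemma cderiv_minus (f g : C -> C) (z l l' : C) :
  cderiv f z l -> cderiv g z l' -> cderiv (fun w => f w - g w)%C z (l - l').
Proof.
intros Hf Hg; unfold Cminus; apply cderiv_plus; [exact Hf |].
replace (- l')%C with ((fun _ : C => (- (1))%C) z * l' + g z * 0)%C by ring.
refine (frechet_ext_loc _ _ _ _ _ 1 Rlt_0_1 _
  (cderiv_mult (fun _ => (- (1))%C) g z 0 l' (cderiv_const _ _) Hg)).
intros w _; ring.
Qed.

Lemma cderiv_div (f g : C -> C) (z l l' : C) :
  g z <> 0 -> cderiv f z l -> cderiv g z l' ->
  exists m : C, cderiv (fun w => f w / g w)%C z m.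
Proof.
intros Hz Hf Hg; eexists; unfold Cdiv; apply cderiv_mult; [exact Hf |].
unfold cderiv; instantiate (1 := (- l' / (g z * g z))%C).
replace (Ci * _)%C with (- (Ci * l') / (g z * g z))%C by (field; exact Hz).
now apply frechet_inv.
Qed.

(** * Integrals over rectangles *)

Lemma RtoC_neq_0 (x : R) : x <> 0 -> RtoC x <> 0.
Proof. intros H E; apply H; now injection E. Qed.

Notation CRmod := C_R_CompleteNormedModule.
Notation CInt := (RInt (V := CRmod)).
Notation ex_CInt := (ex_RInt (V := CRmod)).
Notation is_CInt := (is_RInt (V := CRmod)).

Lemma ex_CInt_continuous (g : R -> C) (a b : R) :
  a <= b ->
  (forall t : R, a <= t <= b -> forall eps : R, 0 < eps -> exists d : R, 0 < d /\
     forall s : R, Rabs (s - t) < d -> Cmod (g s - g t) < eps) ->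
  ex_CInt g a b.
Proof.
intros Hab H; apply (ex_RInt_continuous (V := CRmod)).
rewrite Rmin_left, Rmax_right by exact Hab; intros t Ht P [eps HP].
destruct (H t Ht eps (cond_pos eps)) as [d [Hd H1]].
exists (mkposreal d Hd); intros s Hs; apply HP.
apply C_NormedModule_mixin_compat1, H1, Hs.
Qed.

Lemma Cmod_CInt_le (g : R -> C) (a b M : R) :
  a <= b -> ex_CInt g a b -> (forall t : R, a <= t <= b -> Cmod (g t) <= M) ->
  Cmod (CInt g a b) <= M * (b - a).
Proof.
intros Hab Hex HM; rewrite Cmod_norm.
apply (norm_RInt_le (V := C_R_NormedModule) g (fun _ => M) a b); [exact Hab | | |].
- intros t Ht; rewrite <- Cmod_norm; now apply HM.
- exact (RInt_correct (V := CRmod) g a b Hex).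
- replace (M * (b - a)) with (scal (b - a) M) by (unfold scal; simpl; unfold mult; simpl; ring).
  apply (is_RInt_const (V := R_NormedModule)).
Qed.

(** The integral lives in C as a real normed module, whose scalars are real, so a complex constant
    has to go through the two components. *)
Lemma is_CInt_Cmult (c : C) (g : R -> C) (a b : R) (l : C) :
  is_CInt g a b l -> is_CInt (fun t => c * g t)%C a b (c * l)%C.
Proof.
intros H.
assert (H1 := is_RInt_fct_extend_fst (U := R_NormedModule) (V := R_NormedModule) g a b l H).
assert (H2 := is_RInt_fct_extend_snd (U := R_NormedModule) (V := R_NormedModule) g a b l H).
apply (is_RInt_fct_extend_pair (U := R_NormedModule) (V := R_NormedModule)).
- apply (is_RInt_minus (V := R_NormedModule) (fun t => fst c * fst (g t)) (fun t => snd c * snd (g t)));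
    [exact (is_RInt_scal (V := R_NormedModule) _ _ _ (fst c) _ H1)
    | exact (is_RInt_scal (V := R_NormedModule) _ _ _ (snd c) _ H2)].
- apply (is_RInt_plus (V := R_NormedModule) (fun t => fst c * snd (g t)) (fun t => snd c * fst (g t)));
    [exact (is_RInt_scal (V := R_NormedModule) _ _ _ (fst c) _ H2)
    | exact (is_RInt_scal (V := R_NormedModule) _ _ _ (snd c) _ H1)].
Qed.

Definition hint (g : C -> C) (y a b : R) : C := CInt (fun x => g (x, y)) a b.
Definition vint (g : C -> C) (x a b : R) : C := CInt (fun y => g (x, y)) a b.

(** The counterclockwise boundary integral; the factor [Ci] is [dz = i dy] on the vertical sides. *)
Definition rectint (g : C -> C) (x0 x1 y0 y1 : R) : C :=
  (hint g y0 x0 x1 - hint g y1 x0 x1 + Ci * (vint g x1 y0 y1 - vint g x0 y0 y1))%C.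

Definition ccont (g : C -> C) (z : C) : Prop :=
  forall eps : R, 0 < eps -> exists d : R, 0 < d /\
    forall w : C, Cmod (w - z) < d -> Cmod (g w - g z) < eps.

Definition cdiffable (g : C -> C) (z : C) : Prop := exists l : C, cderiv g z l.

Lemma cdiffable_ccont (g : C -> C) (z : C) : cdiffable g z -> ccont g z.
Proof. intros [l H]; exact (frechet_cont g z _ _ H). Qed.

Lemma Cmod_horizontal (x x' y : R) : Cmod ((x, y) - (x', y)) = Rabs (x - x').
Proof.
replace ((x, y) - (x', y))%C with (RtoC (x - x')); [apply Cmod_R |].
unfold RtoC, Cminus, Cplus, Copp; simpl; f_equal; ring.
Qed.

Lemma Cmod_vertical (x y y' : R) : Cmod ((x, y) - (x, y')) = Rabs (y - y').
Proof.
replace ((x, y) - (x, y'))%C with (Ci * RtoC (y - y'))%C.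
- rewrite Cmod_mult, Cmod_Ci, Cmod_R; ring.
- unfold RtoC, Ci, Cmult, Cminus, Cplus, Copp; simpl; f_equal; ring.
Qed.

Lemma ex_hint (g : C -> C) (y a b : R) :
  a <= b -> (forall x : R, a <= x <= b -> ccont g (x, y)) -> ex_CInt (fun x => g (x, y)) a b.
Proof.
intros Hab H; apply ex_CInt_continuous; [exact Hab |].
intros x Hx eps Heps; destruct (H x Hx eps Heps) as [d [Hd H1]]; exists d; split; [exact Hd |].
intros s Hs; apply H1; now rewrite Cmod_horizontal.
Qed.

Lemma ex_vint (g : C -> C) (x a b : R) :
  a <= b -> (forall y : R, a <= y <= b -> ccont g (x, y)) -> ex_CInt (fun y => g (x, y)) a b.
Proof.
intros Hab H; apply ex_CInt_continuous; [exact Hab |].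
intros y Hy eps Heps; destruct (H y Hy eps Heps) as [d [Hd H1]]; exists d; split; [exact Hd |].
intros s Hs; apply H1; now rewrite Cmod_vertical.
Qed.

Definition on_sides (P : C -> Prop) (x0 x1 y0 y1 : R) : Prop :=
  (forall x : R, x0 <= x <= x1 -> P (x, y0) /\ P (x, y1)) /\
  (forall y : R, y0 <= y <= y1 -> P (x0, y) /\ P (x1, y)).

(** Carried along explicitly because [RInt] is total: linearity and additivity of [rectint] are
    available only when the four integrals exist. *)
Definition ex_sides (g : C -> C) (x0 x1 y0 y1 : R) : Prop :=
  (ex_CInt (fun x => g (x, y0)) x0 x1 /\ ex_CInt (fun x => g (x, y1)) x0 x1) /\
  (ex_CInt (fun y => g (x0, y)) y0 y1 /\ ex_CInt (fun y => g (x1, y)) y0 y1).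

Lemma ex_sides_ccont (g : C -> C) (x0 x1 y0 y1 : R) :
  x0 <= x1 -> y0 <= y1 -> on_sides (ccont g) x0 x1 y0 y1 -> ex_sides g x0 x1 y0 y1.
Proof.
intros Hx Hy [H1 H2]; split; split.
- apply ex_hint; [exact Hx | intros t Ht; now apply H1].
- apply ex_hint; [exact Hx | intros t Ht; now apply H1].
- apply ex_vint; [exact Hy | intros t Ht; now apply H2].
- apply ex_vint; [exact Hy | intros t Ht; now apply H2].
Qed.

Lemma rectint_bound (g : C -> C) (x0 x1 y0 y1 M : R) :
  x0 <= x1 -> y0 <= y1 -> ex_sides g x0 x1 y0 y1 ->
  on_sides (fun z => Cmod (g z) <= M) x0 x1 y0 y1 ->
  Cmod (rectint g x0 x1 y0 y1) <= 2 * M * ((x1 - x0) + (y1 - y0)).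
Proof.
intros Hx Hy [[E1 E2] [E3 E4]] [H1 H2]; unfold rectint.
assert (B1 := Cmod_CInt_le _ _ _ M Hx E1 (fun x h => proj1 (H1 x h))).
assert (B2 := Cmod_CInt_le _ _ _ M Hx E2 (fun x h => proj2 (H1 x h))).
assert (B3 := Cmod_CInt_le _ _ _ M Hy E3 (fun x h => proj1 (H2 x h))).
assert (B4 := Cmod_CInt_le _ _ _ M Hy E4 (fun x h => proj2 (H2 x h))).
fold (hint g y0 x0 x1) in B1; fold (hint g y1 x0 x1) in B2.
fold (vint g x0 y0 y1) in B3; fold (vint g x1 y0 y1) in B4.
apply Rle_trans with (1 := Cmod_triangle _ _); rewrite Cmod_mult, Cmod_Ci.
assert (T1 := Cmod_triangle_minus (hint g y0 x0 x1) (hint g y1 x0 x1)).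
assert (T2 := Cmod_triangle_minus (vint g x1 y0 y1) (vint g x0 y0 y1)).
lra.
Qed.

Lemma rectint_minus (f g : C -> C) (x0 x1 y0 y1 : R) :
  ex_sides f x0 x1 y0 y1 -> ex_sides g x0 x1 y0 y1 ->
  rectint (fun z => f z - g z)%C x0 x1 y0 y1 =
    (rectint f x0 x1 y0 y1 - rectint g x0 x1 y0 y1)%C.
Proof.
intros [[E1 E2] [E3 E4]] [[F1 F2] [F3 F4]].
assert (P1 := RInt_minus (V := CRmod) _ _ _ _ E1 F1).
assert (P2 := RInt_minus (V := CRmod) _ _ _ _ E2 F2).
assert (P3 := RInt_minus (V := CRmod) _ _ _ _ E3 F3).
assert (P4 := RInt_minus (V := CRmod) _ _ _ _ E4 F4).
unfold rectint, hint, vint.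
etransitivity.
- apply (f_equal2 (fun a b => a + Ci * b)%C); apply (f_equal2 Cminus);
    [exact P1 | exact P2 | exact P4 | exact P3].
- change (@minus CRmod) with Cminus; ring.
Qed.

Lemma rectint_Cmult (c : C) (g : C -> C) (x0 x1 y0 y1 : R) :
  ex_sides g x0 x1 y0 y1 ->
  rectint (fun z => c * g z)%C x0 x1 y0 y1 = (c * rectint g x0 x1 y0 y1)%C.
Proof.
intros [[E1 E2] [E3 E4]].
assert (E : forall (h : R -> C) a b,
  ex_CInt h a b -> CInt (fun t => c * h t)%C a b = (c * CInt h a b)%C).
{ intros h a b Hh; apply (is_RInt_unique (V := CRmod)), is_CInt_Cmult.
  exact (RInt_correct (V := CRmod) h a b Hh). }
unfold rectint, hint, vint; rewrite !E by assumption; ring.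
Qed.

Lemma rectint_ext (f g : C -> C) (x0 x1 y0 y1 : R) :
  x0 <= x1 -> y0 <= y1 -> on_sides (fun z => f z = g z) x0 x1 y0 y1 ->
  rectint f x0 x1 y0 y1 = rectint g x0 x1 y0 y1.
Proof.
intros Hx Hy [H1 H2]; unfold rectint, hint, vint.
apply (f_equal2 (fun a b => a + Ci * b)%C); apply (f_equal2 Cminus);
  apply (RInt_ext (V := CRmod));
  (rewrite Rmin_left, Rmax_right by assumption); intros t Ht;
  (apply H1 || apply H2); lra.
Qed.

Lemma rectint_split_x (g : C -> C) (x0 x x1 y0 y1 : R) :
  ex_sides g x0 x y0 y1 -> ex_sides g x x1 y0 y1 ->
  rectint g x0 x1 y0 y1 = (rectint g x0 x y0 y1 + rectint g x x1 y0 y1)%C.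
Proof.
intros [[E1 E2] _] [[F1 F2] _]; unfold rectint, hint.
rewrite <- (RInt_Chasles (V := CRmod) _ _ _ _ E1 F1).
rewrite <- (RInt_Chasles (V := CRmod) _ _ _ _ E2 F2).
change (@plus CRmod) with Cplus; ring.
Qed.

Lemma rectint_split_y (g : C -> C) (x0 x1 y0 y y1 : R) :
  ex_sides g x0 x1 y0 y -> ex_sides g x0 x1 y y1 ->
  rectint g x0 x1 y0 y1 = (rectint g x0 x1 y0 y + rectint g x0 x1 y y1)%C.
Proof.
intros [_ [E1 E2]] [_ [F1 F2]]; unfold rectint, vint.
rewrite <- (RInt_Chasles (V := CRmod) _ _ _ _ E1 F1).
rewrite <- (RInt_Chasles (V := CRmod) _ _ _ _ E2 F2).
change (@plus CRmod) with Cplus; ring.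
Qed.

Lemma is_derive_complex (F : R -> C) (t : R) (l : C) :
  (forall eps : R, 0 < eps -> exists d : R, 0 < d /\ forall s : R, Rabs (s - t) < d ->
     Cmod (F s - F t - RtoC (s - t) * l) <= eps * Rabs (s - t)) ->
  is_derive (K := R_AbsRing) (V := C_R_NormedModule) F t l.
Proof.
intros H; split; [apply (is_linear_scal_l (V := C_R_NormedModule)) |].
intros u Hu.
assert (E := is_filter_lim_locally_unique (V := AbsRing_NormedModule R_AbsRing) t u Hu); subst u.
intros eps; destruct (H eps (cond_pos eps)) as [d [Hd H1]].
exists (mkposreal d Hd); intros s Hs.
rewrite <- Cmod_norm, scal_R_Cmult; exact (H1 s Hs).
Qed.

Lemma rectint_derive (F f : C -> C) (x0 x1 y0 y1 : R) :
  (forall z : C, cderiv F z (f z)) -> (forall z : C, ccont f z) ->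
  rectint f x0 x1 y0 y1 = 0.
Proof.
intros HF Hf.
assert (Hh : forall y a b, hint f y a b = (F (b, y) - F (a, y))%C).
{ intros y a b; apply (is_RInt_unique (V := CRmod)).
  apply (is_RInt_derive (V := CRmod) (fun x => F (x, y))).
  - intros x _; apply is_derive_complex; intros eps Heps.
    destruct (cderiv_error _ _ _ (HF (x, y)) eps Heps) as [d [Hd H]]; exists d; split; [exact Hd |].
    intros s Hs; rewrite <- (Cmod_horizontal s x y) in *.
    replace (RtoC (s - x) * f (x, y))%C with (f (x, y) * ((s, y) - (x, y)))%C; [now apply H |].
    rewrite Cmult_comm; f_equal.
    unfold RtoC, Cminus, Cplus, Copp; simpl; f_equal; ring.
  - intros x _ P [eps HP]; destruct (Hf (x, y) eps (cond_pos eps)) as [d [Hd H]].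
    exists (mkposreal d Hd); intros s Hs; apply HP, C_NormedModule_mixin_compat1, H.
    rewrite Cmod_horizontal; exact Hs. }
assert (Hv : forall x a b, (Ci * vint f x a b)%C = (F (x, b) - F (x, a))%C).
{ intros x a b.
  assert (H1 : is_CInt (fun y => Ci * f (x, y))%C a b (F (x, b) - F (x, a))%C).
  { apply (is_RInt_derive (V := CRmod) (fun y => F (x, y))).
  - intros y _; apply is_derive_complex; intros eps Heps.
    destruct (cderiv_error _ _ _ (HF (x, y)) eps Heps) as [d [Hd H]]; exists d; split; [exact Hd |].
    intros s Hs; rewrite <- (Cmod_vertical x s y) in *.
    replace (RtoC (s - y) * (Ci * f (x, y)))%C with (f (x, y) * ((x, s) - (x, y)))%C; [now apply H |].
    replace ((x, s) - (x, y))%C with (Ci * RtoC (s - y))%C; [ring |].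
    unfold RtoC, Ci, Cmult, Cminus, Cplus, Copp; simpl; f_equal; ring.
  - intros y _ P [eps HP]; destruct (Hf (x, y) eps (cond_pos eps)) as [d [Hd H]].
    exists (mkposreal d Hd); intros s Hs; apply HP, C_NormedModule_mixin_compat1.
    change (Cmod (Ci * f (x, s) - Ci * f (x, y)) < eps).
    replace (Ci * f (x, s) - Ci * f (x, y))%C with (Ci * (f (x, s) - f (x, y)))%C by ring.
    rewrite Cmod_mult, Cmod_Ci, Rmult_1_l; apply H; rewrite Cmod_vertical; exact Hs. }
  (* Along a vertical segment the derivative of [F] is [Ci * f]; multiplying by [- Ci] recovers the
     integral of [f]. *)
  assert (H2 : is_CInt (fun y => - Ci * (Ci * f (x, y)))%C a b (- Ci * (F (x, b) - F (x, a)))%C)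
    by now apply is_CInt_Cmult.
  unfold vint; rewrite (is_RInt_unique (V := CRmod) (fun y => f (x, y)) a b
    (- Ci * (F (x, b) - F (x, a)))%C); [ring [Ci_sq] |].
  revert H2; apply (is_RInt_ext (V := C_R_NormedModule)); intros y _.
  change (- Ci * (Ci * f (x, y)) = f (x, y))%C; ring [Ci_sq]. }
unfold rectint; rewrite !Hh.
replace (Ci * (vint f x1 y0 y1 - vint f x0 y0 y1))%C
  with (Ci * vint f x1 y0 y1 - Ci * vint f x0 y0 y1)%C by ring.
rewrite !Hv; ring.
Qed.

Lemma cderiv_affine (a b z : C) : cderiv (fun w => a + b * w)%C z (0 + (b * 1 + z * 0)).
Proof.
apply cderiv_plus; [apply cderiv_const | apply cderiv_mult; [apply cderiv_const | apply cderiv_id]].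
Qed.

Lemma rectint_affine (a b : C) (x0 x1 y0 y1 : R) :
  rectint (fun z => a + b * z)%C x0 x1 y0 y1 = 0.
Proof.
apply (rectint_derive (fun z => a * z + b / 2 * (z * z))%C).
- intros z.
  assert (H := cderiv_plus _ _ _ _ _ (cderiv_mult _ _ z _ _ (cderiv_const a z) (cderiv_id z))
   (cderiv_mult _ _ z _ _ (cderiv_const (b / 2) z) (cderiv_mult _ _ z _ _ (cderiv_id z)
     (cderiv_id z)))).
  simpl in H; match type of H with cderiv _ _ ?l => replace (a + b * z)%C with l by (field;
    apply RtoC_neq_0; lra) end.
  exact H.
- intros z; apply cdiffable_ccont; eexists; apply cderiv_affine.
Qed.

(** * Goursat's theorem *)

Definition in_rect (x0 x1 y0 y1 : R) (z : C) : Prop :=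
  x0 <= Re z <= x1 /\ y0 <= Im z <= y1.

Lemma on_sides_in_rect (P : C -> Prop) (x0 x1 y0 y1 : R) :
  x0 <= x1 -> y0 <= y1 -> (forall z : C, in_rect x0 x1 y0 y1 z -> P z) ->
  on_sides P x0 x1 y0 y1.
Proof.
intros Hx Hy H; split; intros t Ht; split; apply H; unfold in_rect, Re, Im; simpl; lra.
Qed.

Lemma nested_intervals_point (u v : nat -> R) :
  (forall n : nat, u n <= u (S n) /\ u (S n) <= v (S n) /\ v (S n) <= v n) -> u O <= v O ->
  exists m : R, forall n : nat, u n <= m <= v n.
Proof.
intros H H0.
assert (Huv : forall n, u n <= v n) by (intros [| n]; [exact H0 | apply H]).
assert (Hu : forall n k, u n <= u (n + k)%nat).
{ intros n k; induction k as [| k IH]; [rewrite Nat.add_0_r; lra |].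
  rewrite Nat.add_succ_r; apply Rle_trans with (1 := IH); apply H. }
assert (Hv : forall n k, v (n + k)%nat <= v n).
{ intros n k; induction k as [| k IH]; [rewrite Nat.add_0_r; lra |].
  rewrite Nat.add_succ_r; apply Rle_trans with (2 := IH); apply H. }
assert (Hub : forall n k, u k <= v n).
{ intros n k; apply Rle_trans with (1 := Hu k n).
  rewrite Nat.add_comm; apply Rle_trans with (2 := Hv n k), Huv. }
destruct (completeness (fun x => exists n, x = u n)) as [m [Hm1 Hm2]].
- exists (v O); intros x [n ->]; apply Hub.
- exists (u O), O; reflexivity.
- exists m; intros n; split; [apply Hm1; now exists n |].
  apply Hm2; intros x [k ->]; apply Hub.
Qed.

Lemma rectint_quarter (g : C -> C) (x y a b : R) :
  0 <= a -> 0 <= b -> (forall z : C, in_rect x (x + a) y (y + b) z -> ccont g z) ->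
  exists x' y' : R, (x' = x \/ x' = x + a / 2) /\ (y' = y \/ y' = y + b / 2) /\
    Cmod (rectint g x (x + a) y (y + b)) <=
      4 * Cmod (rectint g x' (x' + a / 2) y' (y' + b / 2)).
Proof.
intros Ha Hb Hg.
assert (Ex : forall u0 u1 v0 v1, x <= u0 -> u0 <= u1 -> u1 <= x + a ->
  y <= v0 -> v0 <= v1 -> v1 <= y + b -> ex_sides g u0 u1 v0 v1).
{ intros u0 u1 v0 v1 U0 U1 U2 V0 V1 V2; apply ex_sides_ccont; try assumption;
  apply on_sides_in_rect; try assumption.
  intros z [Z1 Z2]; apply Hg; split; lra. }
assert (E : rectint g x (x + a) y (y + b) =
  (rectint g x (x + a / 2) y (y + b / 2)
   + rectint g x (x + a / 2) (y + b / 2) (y + b / 2 + b / 2)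
   + (rectint g (x + a / 2) (x + a / 2 + a / 2) y (y + b / 2)
   + rectint g (x + a / 2) (x + a / 2 + a / 2) (y + b / 2) (y + b / 2 + b / 2)))%C).
{ replace (x + a / 2 + a / 2) with (x + a) by lra; replace (y + b / 2 + b / 2) with (y + b) by lra.
  rewrite (rectint_split_x g x (x + a / 2) (x + a)) by (apply Ex; lra).
  rewrite !(rectint_split_y g _ _ y (y + b / 2) (y + b)) by (apply Ex; lra).
  reflexivity. }
rewrite E; clear E Ex.
set (q1 := rectint g x (x + a / 2) y (y + b / 2)).
set (q2 := rectint g x (x + a / 2) (y + b / 2) (y + b / 2 + b / 2)).
set (q3 := rectint g (x + a / 2) (x + a / 2 + a / 2) y (y + b / 2)).
set (q4 := rectint g (x + a / 2) (x + a / 2 + a / 2) (y + b / 2) (y + b / 2 + b / 2)).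
assert (T : Cmod (q1 + q2 + (q3 + q4)) <= Cmod q1 + Cmod q2 + (Cmod q3 + Cmod q4)).
{ apply Rle_trans with (1 := Cmod_triangle _ _), Rplus_le_compat; apply Cmod_triangle. }
destruct (Rle_dec (Cmod (q1 + q2 + (q3 + q4))) (4 * Cmod q1)) as [L1 | L1].
{ exists x, y; repeat split; auto. }
destruct (Rle_dec (Cmod (q1 + q2 + (q3 + q4))) (4 * Cmod q2)) as [L2 | L2].
{ exists x, (y + b / 2); repeat split; auto. }
destruct (Rle_dec (Cmod (q1 + q2 + (q3 + q4))) (4 * Cmod q3)) as [L3 | L3].
{ exists (x + a / 2), y; repeat split; auto. }
exists (x + a / 2), (y + b / 2); repeat split; auto; fold q4; lra.
Qed.

(** Bisection: a quarter carrying at least a fourth of the integral is chosen again and again. At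
    the common point [z0] the function is affine up to [e * |z - z0|], the affine part integrates to
    0, and the rest is at most a multiple of [e / 4 ^ n], which beats the factor [4 ^ n]. *)
Lemma goursat (g : C -> C) (x0 x1 y0 y1 : R) :
  x0 <= x1 -> y0 <= y1 ->
  (forall z : C, in_rect x0 x1 y0 y1 z -> cdiffable g z) ->
  rectint g x0 x1 y0 y1 = 0.
Proof.
intros Hx Hy Hg.
set (A := x1 - x0); set (B := y1 - y0).
assert (HA : 0 <= A) by (unfold A; lra); assert (HB : 0 <= B) by (unfold B; lra).
set (a := fun n : nat => A / 2 ^ n); set (b := fun n : nat => B / 2 ^ n).
assert (H2 : forall n, 0 < 2 ^ n) by (intros n; apply pow_lt; lra).
assert (Ha : forall n, 0 <= a n) by (intros n; apply Rle_mult_inv_pos; auto).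
assert (Hb : forall n, 0 <= b n) by (intros n; apply Rle_mult_inv_pos; auto).
assert (HaS : forall n, a n / 2 = a (S n))
  by (intros n; unfold a; simpl; field; apply Rgt_not_eq, H2).
assert (HbS : forall n, b n / 2 = b (S n))
  by (intros n; unfold b; simpl; field; apply Rgt_not_eq, H2).
set (I := fun n (p : R * R) => Cmod (rectint g (fst p) (fst p + a n) (snd p) (snd p + b n))).
set (inside := fun n (p : R * R) =>
  x0 <= fst p /\ fst p + a n <= x1 /\ y0 <= snd p /\ snd p + b n <= y1).
set (next := fun n (p q : R * R) =>
  fst p <= fst q /\ fst q + a (S n) <= fst p + a n /\
  snd p <= snd q /\ snd q + b (S n) <= snd p + b n /\ I n p <= 4 * I (S n) q).
assert (step : forall n p, inside n p -> exists q, inside (S n) q /\ next n p q).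
{ intros n [x y] [P1 [P2 [P3 P4]]]; simpl in P1, P2, P3, P4.
  destruct (rectint_quarter g x y (a n) (b n)) as [x' [y' [Ex [Ey HI]]]]; auto.
  { intros z [Z1 Z2]; apply cdiffable_ccont, Hg; split; lra. }
  exists (x', y'); rewrite HaS, HbS in *.
  assert (T1 := HaS n); assert (T2 := HbS n); assert (T3 := Ha n); assert (T4 := Hb n).
  unfold inside, next, I; simpl; repeat split; try exact HI; destruct Ex, Ey; lra. }
assert (seqn : exists p : nat -> R * R, p O = (x0, y0) /\ forall n, inside n (p n) /\ next n (p n)
  (p (S n))).
{ assert (i0 : inside O (x0, y0))
    by (unfold inside, a, b, A, B; simpl; repeat split; lra).
  (* The invariant is a premise of the chosen relation, so the choice function is total and the
     sequence can be defined by plain recursion. *)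
  destruct (functional_choice (fun (np : nat * (R * R)) q =>
    inside (fst np) (snd np) -> inside (S (fst np)) q /\ next (fst np) (snd np) q)) as [f Hf].
  { intros [n p]; destruct (classic (inside n p)) as [i | i].
    - destruct (step n p i) as [q Hq]; exists q; intros _; exact Hq.
    - exists p; intros i'; contradiction. }
  set (p := fix p n := match n with O => (x0, y0) | S m => f (m, p m) end).
  assert (ip : forall n, inside n (p n)).
  { induction n as [| n IH]; [exact i0 | apply (Hf (n, p n) IH)]. }
  exists p; split; [reflexivity | intros n; split; [apply ip | apply (Hf (n, p n) (ip n))]]. }
destruct seqn as [p [p0 Hp]].
destruct (nested_intervals_point (fun n => fst (p n)) (fun n => fst (p n) + a n)) as [xs Hxs].
{ intros n; destruct (Hp n) as [_ [N1 [N2 _]]]; assert (T := Ha (S n)); repeat split; lra. }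
{ assert (T := Ha O); lra. }
destruct (nested_intervals_point (fun n => snd (p n)) (fun n => snd (p n) + b n)) as [ys Hys].
{ intros n; destruct (Hp n) as [_ [_ [_ [N1 [N2 _]]]]]; assert (T := Hb (S n)); repeat split; lra. }
{ assert (T := Hb O); lra. }
set (z0 := (xs, ys) : C).
assert (HI : forall n, I O (p O) <= 4 ^ n * I n (p n)).
{ induction n as [| n IH]; [simpl; lra |].
  apply Rle_trans with (1 := IH); simpl.
  destruct (Hp n) as [_ [_ [_ [_ [_ N]]]]].
  replace (4 * 4 ^ n * I (S n) (p (S n))) with (4 ^ n * (4 * I (S n) (p (S n)))) by ring.
  apply Rmult_le_compat_l; [apply pow_le; lra | exact N]. }
assert (Hz0 : in_rect x0 x1 y0 y1 z0).
{ destruct (Hp O) as [[P1 [P2 [P3 P4]]] _].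
  assert (X := Hxs O); assert (Y := Hys O); unfold in_rect, z0, Re, Im; simpl; lra. }
destruct (Hg z0 Hz0) as [l Hl].
assert (I0 : I O (p O) = Cmod (rectint g x0 x1 y0 y1)).
{ unfold I; rewrite p0; simpl; unfold a, b, A, B; simpl; do 2 f_equal; field. }
apply Cmod_eq_0; rewrite <- I0; apply Rle_antisym; [| apply Cmod_ge_0].
apply le_epsilon; intros eps Heps; rewrite Rplus_0_l.
(* On the rectangle of half-perimeter [h = (A + B) / 2 ^ n] the error integral is at most
   [2 * (e * h) * h]; times [4 ^ n] this is [e * (2 * (A + B) ^ 2)]. The [+ 1] covers a rectangle
   reduced to a point. *)
set (e := eps / (2 * (A + B) ^ 2 + 1)).
assert (HD : 0 < 2 * (A + B) ^ 2 + 1) by nra.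
assert (He : 0 < e) by (apply Rdiv_lt_0_compat; lra).
destruct (cderiv_error _ _ _ Hl e He) as [d [Hd Hd1]].
assert (HN : exists n, (A + B) / 2 ^ n < d).
{ destruct (pow_lt_1_zero (/ 2)) with (y := d / (A + B + 1)) as [N HN].
  - rewrite Rabs_pos_eq; lra.
  - apply Rdiv_lt_0_compat; lra.
  - exists N; specialize (HN N (Nat.le_refl _)).
    rewrite Rabs_pos_eq in HN by (apply pow_le; lra); rewrite pow_inv in HN.
    apply Rlt_div_r in HN; [| lra].
    assert (T := H2 N); assert (T' := Rinv_0_lt_compat _ T); unfold Rdiv; nra. }
destruct HN as [n Hn].
destruct (Hp n) as [[P1 [P2 [P3 P4]]] _].
apply Rle_trans with (1 := HI n).
destruct (p n) as [x y] eqn:Epn.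
assert (X := Hxs n); assert (Y := Hys n); rewrite Epn in X, Y; simpl in P1, P2, P3, P4, X, Y.
unfold I; simpl fst; simpl snd.
set (h := (A + B) / 2 ^ n) in *.
assert (Eh : h = a n + b n) by (unfold h, a, b; field; apply Rgt_not_eq, H2).
assert (Tan := Ha n); assert (Tbn := Hb n).
assert (near : forall z, in_rect x (x + a n) y (y + b n) z -> Cmod (z - z0) <= h).
{ intros [u v] [Z1 Z2]; unfold Re, Im in Z1, Z2; simpl in Z1, Z2.
  apply Rle_trans with (1 := Cmod_le_re_im _); unfold z0, Re, Im; simpl.
  assert (Rabs (u + - xs) <= a n) by (apply Rabs_le; lra).
  assert (Rabs (v + - ys) <= b n) by (apply Rabs_le; lra). lra. }
set (lin := fun z => ((g z0 - l * z0) + l * z)%C).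
assert (Clin : forall z, ccont lin z).
{ intros z; apply cdiffable_ccont; eexists; apply cderiv_affine. }
assert (Cg : forall z, in_rect x (x + a n) y (y + b n) z -> ccont g z).
{ intros z [Z1 Z2]; apply cdiffable_ccont, Hg; split; lra. }
assert (Eg : ex_sides g x (x + a n) y (y + b n))
  by (apply ex_sides_ccont; try lra; apply on_sides_in_rect; try lra; exact Cg).
assert (El : ex_sides lin x (x + a n) y (y + b n))
  by (apply ex_sides_ccont; try lra; apply on_sides_in_rect; try lra; intros z _; apply Clin).
assert (Eq : rectint g x (x + a n) y (y + b n) =
             rectint (fun z => g z - lin z)%C x (x + a n) y (y + b n)).
{ rewrite rectint_minus by assumption.
  assert (L0 := rectint_affine (g z0 - l * z0) l x (x + a n) y (y + b n)); fold lin in L0;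
    rewrite L0; ring. }
assert (Bd : Cmod (rectint g x (x + a n) y (y + b n)) <= 2 * (e * h) * (x + a n - x + (y + b n - y))).
{ rewrite Eq; apply rectint_bound; try lra.
  - apply ex_sides_ccont; try lra; apply on_sides_in_rect; try lra; intros z Hz.
    destruct Hz as [Z1 Z2]; destruct (Hg z) as [m Hm]; [split; lra |].
    apply cdiffable_ccont; eexists; apply cderiv_minus; [exact Hm | apply cderiv_affine].
  - apply on_sides_in_rect; try lra; intros z Hz; specialize (near z Hz).
    replace (g z - lin z)%C with (g z - g z0 - l * (z - z0))%C by (unfold lin; ring).
    apply Rle_trans with (e * Cmod (z - z0)); [apply Hd1; lra | apply Rmult_le_compat_l; lra]. }
apply Rle_trans with (4 ^ n * (2 * (e * h) * h)).
{ apply Rmult_le_compat_l; [apply pow_le; lra |].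
  replace (2 * (e * h) * h) with (2 * (e * h) * (x + a n - x + (y + b n - y))) by (rewrite Eh; ring).
  exact Bd. }
replace (4 ^ n * (2 * (e * h) * h)) with (e * (2 * (A + B) ^ 2)).
- apply Rle_trans with (e * (2 * (A + B) ^ 2 + 1)); [apply Rmult_le_compat_l; lra |].
  unfold e; right; field; lra.
- unfold h; replace 4 with (2 * 2) by ring; rewrite Rpow_mult_distr; field; apply Rgt_not_eq, H2.
Qed.

(** * Bounded singularities *)

Definition sides_avoid (S : list C) (x0 x1 y0 y1 : R) : Prop :=
  forall p : C, In p S -> Re p <> x0 /\ Re p <> x1 /\ Im p <> y0 /\ Im p <> y1.

Lemma sides_avoid_not_In (S : list C) (x0 x1 y0 y1 : R) :
  sides_avoid S x0 x1 y0 y1 -> on_sides (fun z => ~ In z S) x0 x1 y0 y1.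
Proof.
intros H; split; intros t _; split; intros Hin; destruct (H _ Hin) as [H1 [H2 [H3 H4]]];
  unfold Re, Im in *; simpl in *; lra.
Qed.

Lemma small_avoids (l : list R) :
  exists d0 : R, 0 < d0 /\ forall d : R, 0 < d < d0 -> ~ In d l.
Proof.
induction l as [| x l [d0 [Hd0 IH]]]; [exists 1; split; [lra | now intros d _] |].
destruct (Rlt_dec 0 x) as [Hx | Hx].
- exists (Rmin d0 x); split; [now apply Rmin_pos |].
  intros d [H1 H2] [E | Hin].
  + assert (T := Rmin_r d0 x); lra.
  + apply (IH d); [assert (T := Rmin_l d0 x); lra | exact Hin].
- exists d0; split; [exact Hd0 |]; intros d Hd [E | Hin]; [lra | now apply (IH d)].
Qed.

(* Each singularity is boxed into a square too small to contribute; the size of the square is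
   chosen so that no cut passes through another singularity. *)
Lemma goursat_punctured (g : C -> C) (M : R) (S : list C) :
  forall x0 x1 y0 y1 : R, x0 <= x1 -> y0 <= y1 -> sides_avoid S x0 x1 y0 y1 ->
  (forall z : C, in_rect x0 x1 y0 y1 z -> ~ In z S -> cdiffable g z) ->
  (forall z : C, in_rect x0 x1 y0 y1 z -> ~ In z S -> Cmod (g z) <= M) ->
  rectint g x0 x1 y0 y1 = 0.
Proof.
induction S as [| p S IH]; intros x0 x1 y0 y1 Hx Hy Hav Hg HM.
{ apply goursat; try assumption; intros z Hz; apply Hg; [exact Hz | intros []]. }
destruct (classic (in_rect x0 x1 y0 y1 p)) as [Hp | Hp].
2: { assert (Hnp : forall z, in_rect x0 x1 y0 y1 z -> ~ In z S -> ~ In z (p :: S)).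
     { intros z Hz Hn [E | E]; [subst z; contradiction | contradiction]. }
     apply IH; auto; intros q Hq; apply Hav; now right. }
destruct (Hav p (or_introl eq_refl)) as [A1 [A2 [A3 A4]]]; destruct Hp as [Hp1 Hp2].
set (px := Re p) in *; set (py := Im p) in *.
destruct (small_avoids (map (fun q => Rabs (Re q - px)) S ++ map (fun q => Rabs (Im q - py)) S))
  as [d0 [Hd0 Hd]].
assert (HM0 : 0 <= Rabs M) by apply Rabs_pos.
set (r := Rmin d0 (Rmin (Rmin (px - x0) (x1 - px)) (Rmin (py - y0) (y1 - py)))).
assert (Hr : 0 < r) by (unfold r; repeat apply Rmin_pos; lra).
assert (Hr1 : r <= d0) by apply Rmin_l.
assert (Hr2 : r <= px - x0 /\ r <= x1 - px /\ r <= py - y0 /\ r <= y1 - py).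
{ unfold r; repeat split; Rmin_le. }
apply Cmod_eq_0, Rle_antisym; [| apply Cmod_ge_0].
apply le_epsilon; intros eps Heps; rewrite Rplus_0_l.
(* A square of half-width [d] contributes at most [2 * M * (2 * d + 2 * d)], that is [8 * M * d];
   the bound [r / 2] keeps the square inside the rectangle and [d] below [d0]. *)
set (d := Rmin (r / 2) (eps / (8 * Rabs M + 1))).
assert (Hdpos : 0 < d) by (apply Rmin_pos; [lra | apply Rdiv_lt_0_compat; lra]).
assert (Hdr : d <= r / 2) by apply Rmin_l.
assert (Hde : 8 * Rabs M * d <= eps).
{ assert (T : d <= eps / (8 * Rabs M + 1)) by apply Rmin_r.
  apply Rle_div_r in T; lra. }
assert (Hgen : forall q,
  In q S -> Re q <> px - d /\ Re q <> px + d /\ Im q <> py - d /\ Im q <> py + d).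
{ intros q Hq.
  assert (N1 : Rabs (Re q - px) <> d).
  { intros E; apply (Hd d); [lra |]; apply in_or_app; left; apply in_map_iff; now exists q. }
  assert (N2 : Rabs (Im q - py) <> d).
  { intros E; apply (Hd d); [lra |]; apply in_or_app; right; apply in_map_iff; now exists q. }
  repeat split; intros E; [apply N1 | apply N1 | apply N2 | apply N2]; rewrite E.
  - rewrite Rabs_left; lra.
  - rewrite Rabs_pos_eq; lra.
  - rewrite Rabs_left; lra.
  - rewrite Rabs_pos_eq; lra. }
assert (HavS : forall q, In q S -> Re q <> x0 /\ Re q <> x1 /\ Im q <> y0 /\ Im q <> y1)
  by (intros q Hq; apply Hav; now right).
assert (xs : forall u, u = x0 \/ u = x1 \/ u = px - d \/ u = px + d ->
  x0 <= u <= x1 /\ forall q, In q (p :: S) -> Re q <> u).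
{ intros u Hu; split; [lra |]; intros q [E | Hq].
  - subst q; fold px; lra.
  - destruct (Hgen q Hq) as [G1 [G2 _]]; destruct (HavS q Hq) as [G3 [G4 _]].
    destruct Hu as [-> | [-> | [-> | ->]]]; assumption. }
assert (ys : forall u, u = y0 \/ u = y1 \/ u = py - d \/ u = py + d ->
  y0 <= u <= y1 /\ forall q, In q (p :: S) -> Im q <> u).
{ intros u Hu; split; [lra |]; intros q [E | Hq].
  - subst q; fold py; lra.
  - destruct (Hgen q Hq) as [_ [_ [G1 G2]]]; destruct (HavS q Hq) as [_ [_ [G3 G4]]].
    destruct Hu as [-> | [-> | [-> | ->]]]; assumption. }
(* All rectangles bounded by the sides and the cuts are treated at once; those that leave out [p]
   fall under the induction hypothesis. *)
assert (Ex : forall u0 u1 v0 v1, u0 <= u1 -> v0 <= v1 ->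
  u0 = x0 \/ u0 = x1 \/ u0 = px - d \/ u0 = px + d ->
  u1 = x0 \/ u1 = x1 \/ u1 = px - d \/ u1 = px + d ->
  v0 = y0 \/ v0 = y1 \/ v0 = py - d \/ v0 = py + d ->
  v1 = y0 \/ v1 = y1 \/ v1 = py - d \/ v1 = py + d ->
  ex_sides g u0 u1 v0 v1 /\ on_sides (fun z => Cmod (g z) <= M) u0 u1 v0 v1 /\
  ((u1 = px - d \/ u0 = px + d \/ v1 = py - d \/ v0 = py + d) -> rectint g u0 u1 v0 v1 = 0)).
{ intros u0 u1 v0 v1 Hu Hv U0 U1 V0 V1.
  destruct (xs u0 U0) as [U0a U0b]; destruct (xs u1 U1) as [U1a U1b].
  destruct (ys v0 V0) as [V0a V0b]; destruct (ys v1 V1) as [V1a V1b].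
  assert (Hs : on_sides (fun z => ~ In z (p :: S) /\ in_rect x0 x1 y0 y1 z) u0 u1 v0 v1).
  { assert (Hs1 : sides_avoid (p :: S) u0 u1 v0 v1) by (intros q Hq; repeat split; auto).
    apply sides_avoid_not_In in Hs1; destruct Hs1 as [S1 S2].
    split; intros t Ht; [destruct (S1 t Ht) as [T1 T2] | destruct (S2 t Ht) as [T1 T2]];
      (split; (split; [assumption |])); unfold in_rect, Re, Im; simpl; lra. }
  destruct Hs as [S1 S2]; split; [| split].
  - apply ex_sides_ccont; try assumption.
    split; intros t Ht; [destruct (S1 t Ht) as [[T1 T2] [T3 T4]] | destruct (S2 t Ht) as [[T1 T2] [T3 T4]]];
      split; apply cdiffable_ccont, Hg; assumption.
  - split; intros t Ht;
    [destruct (S1 t Ht) as [[T1 T2] [T3 T4]] | destruct (S2 t Ht) as [[T1 T2] [T3 T4]]];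
      split; apply HM; assumption.
  - intros Hout; apply IH; try assumption.
    + intros q Hq; repeat split; [apply U0b | apply U1b | apply V0b | apply V1b]; now right.
    + intros z [Z1 Z2] Hz; apply Hg; [split; lra |].
      intros [E | E]; [subst z; fold px in Z1; fold py in Z2; lra | contradiction].
    + intros z [Z1 Z2] Hz; apply HM; [split; lra |].
      intros [E | E]; [subst z; fold px in Z1; fold py in Z2; lra | contradiction]. }
rewrite (rectint_split_x g x0 (px - d) x1) by (apply Ex; lra).
rewrite (rectint_split_x g (px - d) (px + d) x1) by (apply Ex; lra).
rewrite (rectint_split_y g (px - d) (px + d) y0 (py - d) y1) by (apply Ex; lra).
rewrite (rectint_split_y g (px - d) (px + d) (py - d) (py + d) y1) by (apply Ex; lra).
assert (Zero : forall u0 u1 v0 v1, u0 <= u1 -> v0 <= v1 ->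
  u0 = x0 \/ u0 = x1 \/ u0 = px - d \/ u0 = px + d ->
  u1 = x0 \/ u1 = x1 \/ u1 = px - d \/ u1 = px + d ->
  v0 = y0 \/ v0 = y1 \/ v0 = py - d \/ v0 = py + d ->
  v1 = y0 \/ v1 = y1 \/ v1 = py - d \/ v1 = py + d ->
  (u1 = px - d \/ u0 = px + d \/ v1 = py - d \/ v0 = py + d) -> rectint g u0 u1 v0 v1 = 0)
  by (intros; now apply Ex).
rewrite (Zero x0 (px - d) y0 y1), (Zero (px + d) x1 y0 y1) by lra.
rewrite (Zero (px - d) (px + d) y0 (py - d)), (Zero (px - d) (px + d) (py + d) y1) by lra.
destruct (Ex (px - d) (px + d) (py - d) (py + d)) as [C1 [C2 _]]; try lra.
match goal with |- Cmod ?t <= _ =>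
  replace t with (rectint g (px - d) (px + d) (py - d) (py + d)) by ring end.
assert (B := rectint_bound g (px - d) (px + d) (py - d) (py + d) M ltac:(lra) ltac:(lra) C1 C2).
assert (T := Rle_abs M); nra.
Qed.

Lemma Im_CInt_ge (g : R -> C) (a b m : R) :
  a <= b -> ex_CInt g a b -> (forall t : R, a <= t <= b -> m <= Im (g t)) ->
  m * (b - a) <= Im (CInt g a b).
Proof.
intros Hab [l Hl] Hm.
rewrite (is_RInt_unique (V := CRmod) g a b l Hl).
assert (H2 := is_RInt_fct_extend_snd (U := R_NormedModule) (V := R_NormedModule) g a b l Hl).
apply (is_RInt_le (fun _ => m) (fun t => Im (g t)) a b); [exact Hab | | exact H2 |].
- replace (m * (b - a)) with (scal (b - a) m) by (unfold scal; simpl; unfold mult; simpl; ring).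
  apply (is_RInt_const (V := R_NormedModule)).
- intros t Ht; apply Hm; lra.
Qed.

(** A substitute for the winding number. On every side the integrand, with its orientation, has
    imaginary part at least [B / (A ^ 2 + B ^ 2)] or [A / (A ^ 2 + B ^ 2)], so each side contributes
    at least [2 * A * B / (A ^ 2 + B ^ 2)]. The bound does not change when [A] and [B] are scaled
    together. *)
Lemma rectint_inv_ge (w : C) (A B : R) :
  0 < A -> 0 < B ->
  ex_sides (fun z => / (z - w))%C (Re w - A) (Re w + A) (Im w - B) (Im w + B) /\
  8 * (A * B) / (A ^ 2 + B ^ 2) <=
    Cmod (rectint (fun z => / (z - w))%C (Re w - A) (Re w + A) (Im w - B) (Im w + B)).
Proof.
intros HA HB.
set (g := fun z : C => (/ (z - w))%C).
destruct w as [u v]; unfold Re, Im in *; simpl in *.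
assert (HD : 0 < A ^ 2 + B ^ 2) by nra.
assert (Hnz : forall x y : R, x <> u \/ y <> v -> ((x, y) - (u, v))%C <> 0).
{ intros x y H E; injection E; intros; lra. }
assert (Hc : forall x y : R, x <> u \/ y <> v -> ccont g (x, y)).
{ intros x y H; apply cdiffable_ccont; unfold g.
  destruct (cderiv_div (fun _ => RtoC 1) (fun z => z - (u, v))%C (x, y) 0 (1 - 0) (Hnz x y H)
    (cderiv_const _ _) (cderiv_minus _ _ _ _ _ (cderiv_id _) (cderiv_const _ _))) as [m Hm].
  exists m; revert Hm; apply (frechet_ext_loc _ _ _ _ _ 1 Rlt_0_1).
  intros z _; unfold Cdiv; ring. }
assert (E : ex_sides g (u - A) (u + A) (v - B) (v + B)).
{ apply ex_sides_ccont; try lra; split; intros t Ht; split; apply Hc; lra. }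
split; [exact E |].
destruct E as [[E1 E2] [E3 E4]].
assert (Hg : forall x y : R, x <> u \/ y <> v ->
  g (x, y) = ((x - u) / ((x - u) ^ 2 + (y - v) ^ 2), - (y - v) / ((x - u) ^ 2 + (y - v) ^ 2))).
{ intros x y H; unfold g, Cinv, Cminus, Cplus, Copp; simpl.
  assert (N : (x - u) * (x - u) + (y - v) * (y - v) <> 0).
  { intros N; destruct (Rplus_sqr_eq_0 (x - u) (y - v) N); lra. }
  f_equal; field; intros N'; apply N; rewrite <- N'; ring. }
assert (Ex : forall (c : C) (h : R -> C) a b, ex_CInt h a b -> ex_CInt (fun t => c * h t)%C a b /\
  CInt (fun t => c * h t)%C a b = (c * CInt h a b)%C).
{ intros c h a b [l Hl]; assert (Hcl := is_CInt_Cmult c h a b l Hl).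
  split; [eexists; exact Hcl |].
  rewrite (is_RInt_unique (V := CRmod) _ _ _ _ Hcl).
  now rewrite (is_RInt_unique (V := CRmod) _ _ _ _ Hl). }
assert (Hfrac : forall N s p, 0 < N -> 0 < s -> s <= p -> N / p <= N / s).
{ intros N s p HN Hs Hp; apply Rmult_le_compat_l; [lra | apply Rinv_le_contravar; lra]. }
set (mA := A / (A ^ 2 + B ^ 2)); set (mB := B / (A ^ 2 + B ^ 2)).
assert (HAB : 0 < A ^ 2 /\ 0 < B ^ 2) by (split; apply pow_lt; assumption).
assert (Hn : forall p q, 0 < q ^ 2 -> p ^ 2 + q ^ 2 <> 0)
  by (intros p q Hq; assert (T := pow2_ge_0 p); lra).
assert (Hsq : forall c p r, - r <= p - c <= r -> (p - c) ^ 2 <= r ^ 2)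
  by (intros c p r Hp; apply pow_maj_Rabs, Rabs_le; exact Hp).
assert (I1 : mB * (u + A - (u - A)) <= Im (hint g (v - B) (u - A) (u + A))).
{ apply Im_CInt_ge; [lra | exact E1 |]; intros t Ht; rewrite Hg by lra; cbv [Im fst snd].
  replace (v - B - v) with (- B) by ring.
  replace ((- B) ^ 2) with (B ^ 2) by ring.
  match goal with |- _ <= ?x => replace x with (B / ((t - u) ^ 2 + B ^ 2)) by (field; apply Hn;
    lra) end.
  assert (T := Hsq u t A ltac:(lra)); assert (T' := pow2_ge_0 (t - u)); apply Hfrac; lra. }
destruct (Ex (- (1))%C _ _ _ E2) as [E2' Eq2].
assert (I2 : mB * (u + A - (u - A)) <= Im (- (1) * hint g (v + B) (u - A) (u + A))).
{ unfold hint; rewrite <- Eq2; apply Im_CInt_ge; [lra | exact E2' |].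
  intros t Ht; rewrite Hg by lra; cbv [Im Cmult Copp RtoC Ci fst snd].
  replace (v + B - v) with B by ring.
  match goal with |- _ <= ?x => replace x with (B / ((t - u) ^ 2 + B ^ 2)) by (field; apply Hn;
    lra) end.
  assert (T := Hsq u t A ltac:(lra)); assert (T' := pow2_ge_0 (t - u)); apply Hfrac; lra. }
destruct (Ex Ci _ _ _ E4) as [E4' Eq4].
assert (I4 : mA * (v + B - (v - B)) <= Im (Ci * vint g (u + A) (v - B) (v + B))).
{ unfold vint; rewrite <- Eq4; apply Im_CInt_ge; [lra | exact E4' |].
  intros t Ht; rewrite Hg by lra; cbv [Im Cmult Copp RtoC Ci fst snd].
  replace (u + A - u) with A by ring; rewrite (Rplus_comm (A ^ 2)).
  match goal with |- _ <= ?x => replace x with (A / ((t - v) ^ 2 + A ^ 2)) by (field; apply Hn;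
    lra) end.
  assert (T := Hsq v t B ltac:(lra)); assert (T' := pow2_ge_0 (t - v)); apply Hfrac; lra. }
destruct (Ex (- Ci)%C _ _ _ E3) as [E3' Eq3].
assert (I3 : mA * (v + B - (v - B)) <= Im (- Ci * vint g (u - A) (v - B) (v + B))).
{ unfold vint; rewrite <- Eq3; apply Im_CInt_ge; [lra | exact E3' |].
  intros t Ht; rewrite Hg by lra; cbv [Im Cmult Copp RtoC Ci fst snd].
  replace (u - A - u) with (- A) by ring; replace ((- A) ^ 2) with (A ^ 2) by ring.
  rewrite (Rplus_comm (A ^ 2)).
  match goal with |- _ <= ?x => replace x with (A / ((t - v) ^ 2 + A ^ 2)) by (field; apply Hn;
    lra) end.
  assert (T := Hsq v t B ltac:(lra)); assert (T' := pow2_ge_0 (t - v)); apply Hfrac; lra. }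
apply Rle_trans with (2 := Cmod_im_le _).
apply Rle_trans with (2 := Rle_abs _).
apply Rle_trans with (mB * (u + A - (u - A)) + mB * (u + A - (u - A)) +
  (mA * (v + B - (v - B)) + mA * (v + B - (v - B)))).
{ unfold mA, mB; right; field; lra. }
replace (rectint g (u - A) (u + A) (v - B) (v + B)) with
  (hint g (v - B) (u - A) (u + A) + - (1) * hint g (v + B) (u - A) (u + A)
   + (Ci * vint g (u + A) (v - B) (v + B) + - Ci * vint g (u - A) (v - B) (v + B)))%C
  by (unfold rectint; ring).
assert (Iadd : forall p q : C, Im (p + q)%C = Im p + Im q) by reflexivity.
rewrite !Iadd; lra.
Qed.

(** * Liouville's theorem *)

Definition rect_lattice (a b : R) (z : C) : Prop :=
  exists m n : Z, z = (IZR m * a, IZR n * b).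

(** Close to [w] differentiability gives a Lipschitz bound, and farther away [2 * M / d] works.
    Hence [w] is one more bounded singularity for [goursat_punctured]. *)
Lemma difference_quotient_bounded (G : C -> C) (P : C -> Prop) (M : R) (w : C) :
  cdiffable G w -> (forall z : C, P z -> Cmod (G z) <= M) -> P w ->
  exists B : R, forall z : C, P z -> z <> w -> Cmod ((G z - G w) / (z - w)) <= B.
Proof.
intros [l Hl] HM Hw.
destruct (frechet_lipschitz _ _ _ _ Hl) as [d [Hd H]].
set (K := Cmod l + Cmod (Ci * l) + 1) in *.
assert (M0 : 0 <= M) by (apply Rle_trans with (2 := HM w Hw), Cmod_ge_0).
exists (Rmax K (2 * M / d)); intros z Hz Hzw.
assert (Hnz : (z - w)%C <> 0) by (intros E; apply Hzw, Ceq_minus, E).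
assert (Hpos := proj1 (Cmod_gt_0 _) Hnz).
rewrite Cmod_div by exact Hnz.
apply Rle_div_l; [exact Hpos |].
destruct (Rlt_dec (Cmod (z - w)) d) as [L | L].
- apply Rle_trans with (1 := H z L), Rmult_le_compat_r; [lra | apply Rmax_l].
- apply Rle_trans with (1 := Cmod_triangle_minus _ _).
  apply Rle_trans with (2 * M / d * d).
  + assert (T1 := HM z Hz); assert (T2 := HM w Hw).
    replace (2 * M / d * d) with (2 * M) by (field; lra); lra.
  + apply Rmult_le_compat; try lra; [| apply Rmax_r].
    apply Rle_mult_inv_pos; lra.
Qed.

Lemma cdiffable_difference_quotient (G : C -> C) (c z w : C) :
  cdiffable G z -> z <> w -> cdiffable (fun z => (G z - c) / (z - w))%C z.
Proof.
intros [l Hl] Hzw.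
apply (cderiv_div (fun z => G z - c)%C (fun z => z - w)%C z (l - 0) (1 - 0)).
- intros E; apply Hzw, Ceq_minus, E.
- apply cderiv_minus; [exact Hl | apply cderiv_const].
- apply cderiv_minus; [apply cderiv_id | apply cderiv_const].
Qed.

Lemma half_not_integer (m : Z) : IZR m <> / 2.
Proof.
intros E; assert (E2 : IZR (2 * m) = IZR 1) by (rewrite mult_IZR, E; lra).
apply eq_IZR in E2; lia.
Qed.

Section Liouville.

Variables (a b M : R) (G : C -> C).
Hypotheses (Ha : 0 < a) (Hb : 0 < b).
Hypothesis HG : forall z : C, ~ rect_lattice a b z -> cdiffable G z.
Hypothesis HM : forall z : C, ~ rect_lattice a b z -> Cmod (G z) <= M.

(** The centre of a period cell: a rectangle around it with half-sides [N * a] and [N * b] has its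
    sides midway between lattice lines. *)
Let w : C := (a / 2, b / 2).

Let Hw : ~ rect_lattice a b w.
Proof.
intros [m [n E]]; injection E as E1 _; apply (half_not_integer m).
apply Rmult_eq_reg_r with a; lra.
Qed.

(** Makes the singularities inside a rectangle a finite list, as [goursat_punctured] requires. The
    index range is one too large on the left and below, which is harmless since every lattice point
    avoids the lines of the sides. *)
Lemma lattice_in_rect_list (A B : R) (N : nat) (z : C) :
  rect_lattice a b z -> A = INR N * a -> B = INR N * b ->
  in_rect (Re w - A) (Re w + A) (Im w - B) (Im w + B) z ->
  In z (map (fun mn : nat * nat =>
    ((INR (fst mn) - INR N) * a, (INR (snd mn) - INR N) * b) : C)
    (list_prod (seq 0 (2 * N + 1)) (seq 0 (2 * N + 1)))).
Proof.
intros [m [n ->]] -> -> [[H1 H2] [H3 H4]]; unfold w, Re, Im in *; simpl in *.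
assert (bnd : forall (c : R) (i : Z), 0 < c -> c / 2 - INR N * c <= IZR i * c ->
  IZR i * c <= c / 2 + INR N * c -> (- Z.of_nat N <= i <= Z.of_nat N)%Z).
{ intros c i Hc L1 L2.
  assert (J1 : (/ 2 - INR N) <= IZR i) by (apply Rmult_le_reg_r with c; [exact Hc | lra]).
  assert (J2 : IZR i <= / 2 + INR N) by (apply Rmult_le_reg_r with c; [exact Hc | lra]).
  rewrite INR_IZR_INZ in J1, J2; split.
  - apply Znot_gt_le; intros L; assert (L' : (i + 1 <= - Z.of_nat N)%Z) by lia.
    apply IZR_le in L'; rewrite plus_IZR, opp_IZR in L'; lra.
  - apply Znot_gt_le; intros L; assert (L' : (Z.of_nat N + 1 <= i)%Z) by lia.
    apply IZR_le in L'; rewrite plus_IZR in L'; lra. }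
assert (Hm := bnd a m Ha H1 H2); assert (Hn := bnd b n Hb H3 H4).
apply in_map_iff; exists (Z.to_nat (m + Z.of_nat N), Z.to_nat (n + Z.of_nat N)); split.
- simpl; rewrite !INR_IZR_INZ, !Z2Nat.id by lia; rewrite !plus_IZR; f_equal; ring.
- apply in_prod; apply in_seq; lia.
Qed.

(* The difference of the difference quotients of [G] at [w] and [w'] integrates to 0 over growing
   rectangles around [w].  Up to O(1/N) that integral is [G w' - G w] times the integral of
   1 / (z - w), which stays away from 0. *)
Lemma liouville_mod_lattice (w' : C) : ~ rect_lattice a b w' -> G w' = G w.
Proof.
intros Hw'.
destruct (classic (w' = w)) as [-> | Hne]; [reflexivity |].
assert (Hdw : 0 < Cmod (w - w')) by (apply Cmod_gt_0; intros E; apply Hne; symmetry;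
  apply Ceq_minus, E).
set (D := Cmod (w - w')) in *.
assert (HM0 : 0 <= M) by (apply Rle_trans with (2 := HM w Hw), Cmod_ge_0).
destruct (difference_quotient_bounded G (fun z => ~ rect_lattice a b z) M w (HG w Hw) HM Hw) as [B1 HB1].
destruct (difference_quotient_bounded G (fun z => ~ rect_lattice a b z) M w' (HG w' Hw') HM Hw') as [B2 HB2].
set (Q := fun z => ((G z - G w) / (z - w) - (G z - G w') / (z - w'))%C).
assert (HQd : forall z, ~ rect_lattice a b z -> z <> w -> z <> w' -> cdiffable Q z).
{ intros z Hz N1 N2.
  destruct (cdiffable_difference_quotient G (G w) z w (HG z Hz) N1) as [m1 Hm1].
  destruct (cdiffable_difference_quotient G (G w') z w' (HG z Hz) N2) as [m2 Hm2].
  eexists; apply cderiv_minus; [exact Hm1 | exact Hm2]. }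
set (c := Rmin a b); assert (Hc : 0 < c) by now apply Rmin_pos.
assert (Hca : c <= a) by apply Rmin_l; assert (Hcb : c <= b) by apply Rmin_r.
set (c0 := 8 * (a * b) / (a ^ 2 + b ^ 2)).
assert (Hab2 : 0 < a ^ 2 + b ^ 2) by nra.
assert (Hc0 : 0 < c0).
{ apply Rdiv_lt_0_compat; [| exact Hab2]; assert (T := Rmult_lt_0_compat _ _ Ha Hb); lra. }
(* On the sides the function [E] below is at most [4 * M * D / (n * c) ^ 2], and the perimeter is
   [4 * n * (a + b)]; the product is [K / n]. *)
set (K := 16 * M * D * (a + b) / c ^ 2).
assert (HK0 : 0 <= K).
{ unfold K; apply Rle_mult_inv_pos; [| apply pow_lt, Hc].
  repeat apply Rmult_le_pos; lra. }
(* The condition [2 * D < N * c] puts [w'] less than half as far from [w] as the sides are, so the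
   sides keep a distance of at least [N * c / 2] from [w']. *)
assert (main : forall N : nat, 2 * D < INR N * c -> (1 <= N)%nat ->
  Cmod (G w - G w') * c0 <= K / INR N).
{ intros N HN N1; assert (HN1 : 1 <= INR N) by (apply (le_INR 1 N), N1).
  set (n := INR N) in *; set (A := n * a); set (B := n * b).
  assert (HA : n * c <= A) by (apply Rmult_le_compat_l; lra).
  assert (HB : n * c <= B) by (apply Rmult_le_compat_l; lra).
  set (x0 := Re w - A); set (x1 := Re w + A); set (y0 := Im w - B); set (y1 := Im w + B).
  assert (Hx : x0 <= x1) by (unfold x0, x1; lra); assert (Hy : y0 <= y1) by (unfold y0, y1; lra).
  assert (far : on_sides (fun z => n * c <= Cmod (z - w)) x0 x1 y0 y1).
  { split; intros t Ht; split;
      [apply Rle_trans with (2 := Cmod_im_le _) | apply Rle_trans with (2 := Cmod_im_le _)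
      | apply Rle_trans with (2 := re_le_Cmod _) | apply Rle_trans with (2 := re_le_Cmod _)];
    unfold x0, x1, y0, y1, Re, Im; simpl.
    - rewrite Rabs_left1; lra.
    - rewrite Rabs_pos_eq; lra.
    - rewrite Rabs_left1; lra.
    - rewrite Rabs_pos_eq; lra. }
  assert (off : on_sides (fun z => ~ rect_lattice a b z) x0 x1 y0 y1).
  { assert (H1 : forall (d : R) (i : Z),
    0 < d -> IZR i * d <> d / 2 - n * d /\ IZR i * d <> d / 2 + n * d).
    { intros d i Hd; unfold n; rewrite INR_IZR_INZ; split; intros E.
      - apply (half_not_integer (i + Z.of_nat N)); rewrite plus_IZR.
        apply Rmult_eq_reg_r with d; lra.
      - apply (half_not_integer (i - Z.of_nat N)); rewrite minus_IZR.
        apply Rmult_eq_reg_r with d; lra. }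
    split; intros t Ht; split; intros [i [j E]]; injection E as E1 E2;
      unfold x0, x1, y0, y1, w, Re, Im in *; simpl in *;
      destruct (H1 a i Ha); destruct (H1 b j Hb); unfold A, B in *; lra. }
  set (L := w :: w' :: map (fun mn : nat * nat =>
    ((INR (fst mn) - INR N) * a, (INR (snd mn) - INR N) * b) : C)
    (list_prod (seq 0 (2 * N + 1)) (seq 0 (2 * N + 1)))).
  assert (HL : forall z, in_rect x0 x1 y0 y1 z -> ~ In z L ->
    ~ rect_lattice a b z /\ z <> w /\ z <> w').
  { intros z Hz Hn; split; [| split]; intros E; apply Hn.
    - do 2 right; now apply (lattice_in_rect_list A B N).
    - left; now symmetry.
    - right; left; now symmetry. }
  assert (Q0 : rectint Q x0 x1 y0 y1 = 0).
  { apply (goursat_punctured Q (B1 + B2) L); try assumption.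
    - intros p [Hp | [Hp | Hp]].
      + subst p; unfold x0, x1, y0, y1; lra.
      + subst p; assert (T1 := re_le_Cmod (w - w')); assert (T2 := Cmod_im_le (w - w'));
        fold D in T1, T2.
        assert (R1 : Re (w - w') = Re w - Re w') by (destruct w, w'; reflexivity).
        assert (R2 : Im (w - w') = Im w - Im w') by (destruct w, w'; reflexivity).
        rewrite R1 in T1; rewrite R2 in T2.
        apply Rabs_le_between in T1; apply Rabs_le_between in T2; unfold x0, x1, y0, y1; lra.
      + apply in_map_iff in Hp; destruct Hp as [[i j] [<- _]].
        unfold x0, x1, y0, y1, A, B, n, w, Re, Im; simpl.
        assert (H1 : forall (d : R) (i : nat), 0 < d ->
          (INR i - INR N) * d <> d / 2 - INR N * d /\ (INR i - INR N) * d <> d / 2 + INR N * d).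
        { intros d k Hd; rewrite !INR_IZR_INZ; split; intros E.
          - apply (half_not_integer (Z.of_nat k)); apply Rmult_eq_reg_r with d; lra.
          - apply (half_not_integer (Z.of_nat k - Z.of_nat N - Z.of_nat N)); rewrite !minus_IZR.
            apply Rmult_eq_reg_r with d; lra. }
        destruct (H1 a i Ha); destruct (H1 b j Hb); repeat split; assumption.
    - intros z Hz Hn; destruct (HL z Hz Hn) as [Z1 [Z2 Z3]]; now apply HQd.
    - intros z Hz Hn; destruct (HL z Hz Hn) as [Z1 [Z2 Z3]].
      apply Rle_trans with (1 := Cmod_triangle_minus _ _), Rplus_le_compat;
        [now apply HB1 | now apply HB2]. }
  destruct (rectint_inv_ge w A B) as [Einv Hinv]; [unfold A; nra | unfold B; nra |].
  fold x0 x1 y0 y1 in Einv, Hinv.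
  replace (8 * (A * B) / (A ^ 2 + B ^ 2)) with c0 in Hinv.
  2: { replace (A ^ 2 + B ^ 2) with (n ^ 2 * (a ^ 2 + b ^ 2)) by (unfold A, B; ring).
       unfold c0, A, B; field; lra. }
  (* This is [(G z - G w') * (1 / (z - w) - 1 / (z - w'))], so [Q] is [E] minus [c1 / (z - w)]; as
     [Q] integrates to 0, the integrals of these two agree. *)
  set (E := fun z => ((G z - G w') * ((w - w') / ((z - w) * (z - w'))))%C).
  set (c1 := (G w - G w')%C).
  assert (far' : on_sides (fun z => z <> w /\ z <> w' /\ Cmod (E z) <= 4 * M * D / (n * c) ^ 2) x0 x1 y0 y1).
  { assert (pt : forall z, n * c <= Cmod (z - w) -> ~ rect_lattice a b z ->
      z <> w /\ z <> w' /\ Cmod (E z) <= 4 * M * D / (n * c) ^ 2).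
    { intros z Hz1 Hz2.
      assert (F : n * c / 2 <= Cmod (z - w')).
      { assert (T := Cmod_triangle_inv (z - w) (w' - w)).
        replace (z - w - (w' - w))%C with (z - w')%C in T by ring.
        rewrite (Cmod_minus_sym w' w) in T; fold D in T; lra. }
      assert (Z1 : (z - w)%C <> 0) by (apply Cmod_neq_0; lra).
      assert (Z2 : (z - w')%C <> 0) by (apply Cmod_neq_0; lra).
      split; [intros e; apply Z1; rewrite e; ring |].
      split; [intros e; apply Z2; rewrite e; ring |].
      unfold E; rewrite Cmod_mult, Cmod_div, Cmod_mult by now apply Cmult_neq_0.
      fold D.
      replace (4 * M * D / (n * c) ^ 2) with ((2 * M) * (D / ((n * c) * (n * c / 2)))) by (field; lra).
      apply Rmult_le_compat; try apply Cmod_ge_0.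
      - apply Rle_mult_inv_pos; [lra |]; apply Rmult_lt_0_compat; lra.
      - apply Rle_trans with (1 := Cmod_triangle_minus _ _).
        assert (T1 := HM z Hz2); assert (T2 := HM w' Hw'); lra.
      - apply Rmult_le_compat_l; [lra | apply Rinv_le_contravar; [nra |]].
        apply Rmult_le_compat; nra. }
    split; intros t Ht; split; apply pt; (apply far || apply off); exact Ht. }
  assert (Exq : forall f, (forall z, ~ rect_lattice a b z -> z <> w -> z <> w' -> cdiffable f z) ->
    ex_sides f x0 x1 y0 y1).
  { intros f Hf; apply ex_sides_ccont; try assumption.
    destruct far' as [f1 f2]; destruct off as [o1 o2].
    split; intros t Ht; split; apply cdiffable_ccont, Hf;
     (now apply f1) || (now apply f2) || (now apply o1) || (now apply o2). }
  assert (EQ : ex_sides Q x0 x1 y0 y1) by (apply Exq; exact HQd).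
  assert (Ecinv : ex_sides (fun z => c1 * / (z - w))%C x0 x1 y0 y1).
  { apply Exq; intros z _ Hz _.
    destruct (cderiv_div (fun _ => c1) (fun z => z - w)%C z 0 (1 - 0)) as [m Hm];
      [intros e; apply Hz, Ceq_minus, e | apply cderiv_const
      | apply cderiv_minus; [apply cderiv_id | apply cderiv_const] | now exists m]. }
  assert (EE : ex_sides E x0 x1 y0 y1).
  { apply Exq; intros z Hz Hz1 Hz2; destruct (HG z Hz) as [l Hl].
    destruct (cderiv_div (fun _ => (w - w')%C) (fun z => (z - w) * (z - w'))%C z 0
      ((z - w) * (1 - 0) + (z - w') * (1 - 0))) as [m Hm];
      [apply Cmult_neq_0; intros e; [apply Hz1 | apply Hz2]; apply Ceq_minus,
        e | apply cderiv_const | |].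
    - apply (cderiv_mult (fun z => z - w)%C (fun z => z - w')%C);
        (apply cderiv_minus; [apply cderiv_id | apply cderiv_const]).
    - eexists; apply cderiv_mult; [apply cderiv_minus; [exact Hl | apply cderiv_const] | exact Hm]. }
  assert (Eeq : rectint E x0 x1 y0 y1 = (c1 * rectint (fun z => / (z - w))%C x0 x1 y0 y1)%C).
  { rewrite <- rectint_Cmult by exact Einv.
    apply Ceq_minus; rewrite <- rectint_minus by assumption.
    rewrite <- Q0; apply rectint_ext; try assumption.
    assert (pt : forall z, z <> w /\ z <> w' /\ Cmod (E z) <= 4 * M * D / (n * c) ^ 2 ->
       (E z - c1 * / (z - w))%C = Q z).
    { intros z [Z1 [Z2 _]]; unfold E, Q, c1; field.
      split; intros e; [apply Z2 | apply Z1]; apply Ceq_minus, e. }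
    destruct far' as [f1 f2]; split; intros t Ht; split; apply pt; (apply f1 || apply f2); exact Ht. }
  apply Rle_trans with (Cmod (rectint E x0 x1 y0 y1)).
  { rewrite Eeq, Cmod_mult; apply Rmult_le_compat_l; [apply Cmod_ge_0 | exact Hinv]. }
  apply Rle_trans with (2 * (4 * M * D / (n * c) ^ 2) * ((x1 - x0) + (y1 - y0))).
  { apply rectint_bound; try assumption.
    destruct far' as [f1 f2]; split; intros t Ht; split; (apply f1 || apply f2); exact Ht. }
  unfold x0, x1, y0, y1, A, B, K; right; field; lra. }
symmetry; apply Ceq_minus, Cmod_eq_0, Rle_antisym; [| apply Cmod_ge_0].
apply Rmult_le_reg_r with c0; [exact Hc0 | rewrite Rmult_0_l].
apply le_epsilon; intros eps Heps; rewrite Rplus_0_l.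
destruct (nfloor_ex (Rmax (2 * D / c) (K / eps) + 1)) as [N [_ HN]].
{ assert (T := Rmax_l (2 * D / c) (K / eps)); assert (0 < 2 * D / c) by (apply Rdiv_lt_0_compat;
  lra); lra. }
assert (T1 := Rmax_l (2 * D / c) (K / eps)); assert (T2 := Rmax_r (2 * D / c) (K / eps)).
assert (HD0 : 0 < 2 * D / c) by (apply Rdiv_lt_0_compat; lra).
assert (L1 : 2 * D / c < INR N) by lra; assert (L2 : K / eps < INR N) by lra.
apply Rle_trans with (K / INR N).
- apply main.
  + apply Rlt_div_l in L1; lra.
  + destruct N; [simpl in L1; lra | lia].
- apply Rlt_div_l in L2; [| exact Heps]; apply Rle_div_l; lra.
Qed.

End Liouville.

(** * Real Jacobi elliptic functions *)

Definition ellDelta (k psi : R) : R := sqrt (1 - k ^ 2 * sin psi ^ 2).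
Definition ellF (k phi : R) : R := RInt (fun psi => / ellDelta k psi) 0 phi.

(** The inverse of the increasing bijection [ellF k] of the real line, picked by [epsilon];
    [ellF_am] and [am_ellF] are the two inverse laws for [0 < k < 1]. *)
Definition am (k x : R) : R := epsilon (inhabits 0) (fun phi => ellF k phi = x).
Definition sn (k x : R) : R := sin (am k x).
Definition cn (k x : R) : R := cos (am k x).
Definition dn (k x : R) : R := ellDelta k (am k x).

Lemma derive_0_const (f : R -> R) :
  (forall x : R, is_derive f x 0) -> forall x y : R, f x = f y.
Proof.
intros H x y.
destruct (MVT_gen f x y (fun _ => 0)) as [c [_ Hc]]; [intros t _; apply H | | lra].
intros t _; apply continuity_pt_filterlim, (ex_derive_continuous (V := R_NormedModule)).
exists 0; apply H.
Qed.

Lemma derive_abs_le (f f' : R -> R) (M x : R) :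
  (forall t : R, is_derive f t (f' t)) ->
  (forall t : R, Rabs t <= Rabs x -> Rabs (f' t) <= M) ->
  Rabs (f x - f 0) <= M * Rabs x.
Proof.
intros H HM.
destruct (MVT_abs f f' 0 x) as [c [Ec Hc]]; [intros t _; apply is_derive_Reals, H |].
rewrite Ec, Rminus_0_r; apply Rmult_le_compat_r; [apply Rabs_pos | apply HM].
unfold Rabs; destruct (Rcase_abs c), (Rcase_abs x);
  destruct (Rle_dec 0 x) as [T | T];
  (rewrite Rmin_left, Rmax_right in Hc by lra) || (rewrite Rmin_right, Rmax_left in Hc by lra); lra.
Qed.

Lemma is_derive_eq (f : R -> R) (x l l' : R) : is_derive f x l -> l = l' -> is_derive f x l'.
Proof. now intros H <-. Qed.

Section Jacobi.

Variable k : R.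
Hypothesis Hk : 0 < k < 1.

Lemma ellDelta_arg_pos (psi : R) : 0 < 1 - k ^ 2 * sin psi ^ 2.
Proof.
assert (H := SIN_bound psi).
assert (sin psi ^ 2 <= 1) by nra; assert (0 <= sin psi ^ 2) by apply pow2_ge_0.
assert (k ^ 2 < 1) by nra; nra.
Qed.

Lemma ellDelta_pos (psi : R) : 0 < ellDelta k psi.
Proof. apply sqrt_lt_R0, ellDelta_arg_pos. Qed.

Lemma ellDelta_le_1 (psi : R) : ellDelta k psi <= 1.
Proof.
unfold ellDelta; rewrite <- sqrt_1 at 2; apply sqrt_le_1_alt.
assert (0 <= k ^ 2 * sin psi ^ 2) by (rewrite <- Rpow_mult_distr; apply pow2_ge_0); lra.
Qed.

Lemma ellDelta_sq (psi : R) : ellDelta k psi ^ 2 = 1 - k ^ 2 * sin psi ^ 2.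
Proof. apply pow2_sqrt, Rlt_le, ellDelta_arg_pos. Qed.

Lemma is_derive_ellDelta (psi : R) :
  is_derive (ellDelta k) psi (- (k ^ 2 * sin psi * cos psi) / ellDelta k psi).
Proof.
assert (P := ellDelta_arg_pos psi); assert (P' := ellDelta_pos psi).
unfold ellDelta in *; auto_derive; [simpl in *; lra |].
replace (1 + - (k * (k * 1) * (sin psi * (sin psi * 1)))) with (1 - k ^ 2 * sin psi ^ 2) by ring.
field; lra.
Qed.

Lemma continuous_inv_ellDelta (psi : R) : continuous (fun t => / ellDelta k t) psi.
Proof.
apply (ex_derive_continuous (V := R_NormedModule)); eexists.
apply is_derive_inv; [apply is_derive_ellDelta | apply Rgt_not_eq, ellDelta_pos].
Qed.

Lemma is_derive_ellF (phi : R) : is_derive (ellF k) phi (/ ellDelta k phi).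
Proof.
apply (is_derive_RInt (fun t => / ellDelta k t) (ellF k) 0).
- exists (mkposreal 1 Rlt_0_1); intros x _.
  apply (RInt_correct (V := R_CompleteNormedModule)),
    (ex_RInt_continuous (V := R_CompleteNormedModule)).
  intros z _; apply continuous_inv_ellDelta.
- apply continuous_inv_ellDelta.
Qed.

Lemma ellF_0 : ellF k 0 = 0.
Proof. apply (RInt_point (V := R_CompleteNormedModule)). Qed.

Lemma continuity_ellF : continuity (ellF k).
Proof.
intros x; apply continuity_pt_filterlim, (ex_derive_continuous (V := R_NormedModule)).
eexists; apply is_derive_ellF.
Qed.

(** The integrand is at least 1. This one inequality yields injectivity and surjectivity of [ellF]
    and the Lipschitz constant 1 of [am]. *)
Lemma ellF_growth (x y : R) : x <= y -> y - x <= ellF k y - ellF k x.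
Proof.
intros H; destruct (MVT_gen (ellF k) x y (fun t => / ellDelta k t)) as [c [_ ->]].
- intros t _; apply is_derive_ellF.
- intros t _; apply continuity_ellF.
- rewrite <- (Rmult_1_l (y - x)) at 1; apply Rmult_le_compat_r; [lra |].
  rewrite <- Rinv_1; apply Rinv_le_contravar; [apply ellDelta_pos | apply ellDelta_le_1].
Qed.

Lemma ellF_surj (x : R) : exists phi : R, ellF k phi = x.
Proof.
set (B := Rabs x + 1).
assert (HB : 0 < B) by (assert (T := Rabs_pos x); unfold B; lra).
destruct (IVT (fun t => ellF k t - x) (- B) B) as [phi [_ H]].
- intros t; apply continuity_pt_minus; [apply continuity_ellF | apply continuity_pt_const;
  now intros u v].
- lra.
- assert (T := ellF_growth (- B) 0); rewrite ellF_0 in T.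
  assert (T' := Rle_abs (- x)); rewrite Rabs_Ropp in T'; unfold B in *; lra.
- assert (T := ellF_growth 0 B); rewrite ellF_0 in T.
  assert (T' := Rle_abs x); unfold B in *; lra.
- exists phi; lra.
Qed.

Lemma ellF_am (x : R) : ellF k (am k x) = x.
Proof. exact (epsilon_spec (inhabits 0) (fun phi => ellF k phi = x) (ellF_surj x)). Qed.

Lemma ellF_inj (x y : R) : ellF k x = ellF k y -> x = y.
Proof.
intros H; destruct (Rle_dec x y) as [L | L].
- assert (T := ellF_growth x y L); lra.
- assert (T := ellF_growth y x ltac:(lra)); lra.
Qed.

Lemma am_ellF (phi : R) : am k (ellF k phi) = phi.
Proof. apply ellF_inj, ellF_am. Qed.

Lemma am_lipschitz (x y : R) : Rabs (am k y - am k x) <= Rabs (y - x).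
Proof.
rewrite <- (ellF_am x) at 2; rewrite <- (ellF_am y) at 2.
destruct (Rle_dec (am k x) (am k y)) as [L | L].
- assert (T := ellF_growth _ _ L); rewrite !Rabs_pos_eq; lra.
- assert (T := ellF_growth (am k y) (am k x) ltac:(lra)).
  rewrite !Rabs_left1; lra.
Qed.

Lemma is_derive_am (x : R) : is_derive (am k) x (dn k x).
Proof.
apply is_derive_Reals; intros eps Heps.
assert (HF := proj1 (is_derive_Reals _ _ _) (is_derive_ellF (am k x))).
set (D := dn k x); assert (HD : 0 < D) by apply ellDelta_pos.
assert (HD1 : D <= 1) by apply ellDelta_le_1.
destruct (HF eps Heps) as [d Hd].
exists d; intros h Hh Hhd.
set (e := am k (x + h) - am k x).
assert (He : e <> 0).
{ intros E; assert (E' : am k (x + h) = am k x) by (unfold e in E; lra).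
  assert (T := ellF_am (x + h)); rewrite E', ellF_am in T; lra. }
assert (Hel : Rabs e <= Rabs h).
{ replace h with (x + h - x) by ring; apply am_lipschitz. }
assert (Heh : ellF k (am k x + e) - ellF k (am k x) = h).
{ unfold e; replace (am k x + (am k (x + h) - am k x)) with (am k (x + h)) by ring.
  rewrite !ellF_am; ring. }
specialize (Hd e He (Rle_lt_trans _ _ _ Hel Hhd)); rewrite Heh in Hd.
fold (dn k x) in Hd; fold D in Hd.
(* With [e] the increment of [am], the known limit concerns [h / e]. The identity transfers it to
   [e / h], and the factors [e / h] and [D] are at most 1 in absolute value. *)
replace (e / h - D) with (- (h / e - / D) * (e / h) * D) by (field; repeat split; lra).
rewrite !Rabs_mult, Rabs_Ropp, (Rabs_pos_eq D), Rabs_div by lra.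
assert (Hq : Rabs e / Rabs h <= 1).
{ apply Rle_div_l; [now apply Rabs_pos_lt | lra]. }
assert (Hq0 : 0 <= Rabs e / Rabs h).
{ apply Rle_mult_inv_pos; [apply Rabs_pos | now apply Rabs_pos_lt]. }
apply Rle_lt_trans with (Rabs (h / e - / D)); [| exact Hd].
set (u := Rabs (h / e - / D)); assert (Hu : 0 <= u) by apply Rabs_pos.
set (q := Rabs e / Rabs h) in *; assert (u * q <= u) by nra; nra.
Qed.

Lemma sn_sq_cn_sq (x : R) : sn k x ^ 2 + cn k x ^ 2 = 1.
Proof. unfold sn, cn; rewrite <- (sin2_cos2 (am k x)); unfold Rsqr; ring. Qed.

Lemma dn_sq (x : R) : dn k x ^ 2 = 1 - k ^ 2 * sn k x ^ 2.
Proof. apply ellDelta_sq. Qed.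

Lemma dn_pos (x : R) : 0 < dn k x.
Proof. apply ellDelta_pos. Qed.

Lemma is_derive_sn (x : R) : is_derive (sn k) x (cn k x * dn k x).
Proof.
unfold sn; rewrite Rmult_comm.
apply (is_derive_comp sin (am k)); [apply is_derive_sin | apply is_derive_am].
Qed.

Lemma is_derive_cn (x : R) : is_derive (cn k) x (- sn k x * dn k x).
Proof.
unfold cn; rewrite Rmult_comm.
apply (is_derive_comp cos (am k)); [apply is_derive_cos | apply is_derive_am].
Qed.

Lemma is_derive_dn (x : R) : is_derive (dn k) x (- (k ^ 2 * sn k x * cn k x)).
Proof.
assert (H := is_derive_comp (ellDelta k) (am k) x _ _ (is_derive_ellDelta (am k x)) (is_derive_am x)).
unfold dn; replace (- (k ^ 2 * sn k x * cn k x))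
  with (scal (dn k x) (- (k ^ 2 * sin (am k x) * cos (am k x)) / ellDelta k (am k x))); [exact H |].
unfold scal; simpl; unfold mult; simpl; unfold sn, cn, dn; field; apply Rgt_not_eq, ellDelta_pos.
Qed.

Lemma is_derive_ellF_comp (a b x : R) :
  is_derive (fun t => ellF k (a * t + b)) x (a * / ellDelta k (a * x + b)).
Proof.
apply (is_derive_comp (ellF k) (fun t => a * t + b)); [apply is_derive_ellF |].
auto_derive; [exact I | ring].
Qed.

Lemma ellDelta_sin_sq (x y : R) : sin x ^ 2 = sin y ^ 2 -> ellDelta k x = ellDelta k y.
Proof. intros H; unfold ellDelta; now rewrite H. Qed.

Lemma ellF_PI2 : ellF k (PI / 2) = ellK k.
Proof. reflexivity. Qed.

(** The integrand is even about [PI / 2] and has period [PI]. So [ellF (PI - x) + ellF x] is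
    constant, which compared at [PI / 2] and 0 gives [ellF PI = 2 * ellK], and
    [ellF (x + PI) - ellF x] is constant too. *)
Lemma ellF_shift (phi : R) : ellF k (phi + PI) = ellF k phi + 2 * ellK k.
Proof.
assert (H1 : forall x : R, is_derive (fun t => ellF k (-1 * t + PI) + ellF k (1 * t + 0)) x 0).
{ intros x; refine (is_derive_eq _ x _ 0 (is_derive_plus (V := R_NormedModule) _ _ x _ _
      (is_derive_ellF_comp (-1) PI x) (is_derive_ellF_comp 1 0 x)) _); unfold minus, plus, opp; simpl.
    rewrite (ellDelta_sin_sq (-1 * x + PI) (1 * x + 0)); [ring |].
    replace (-1 * x + PI) with (PI - x) by ring; rewrite sin_PI_x; f_equal; f_equal; ring. }
assert (E1 := derive_0_const _ H1 (PI / 2) 0); simpl in E1.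
replace (-1 * (PI / 2) + PI) with (PI / 2) in E1 by lra.
replace (1 * (PI / 2) + 0) with (PI / 2) in E1 by ring.
replace (-1 * 0 + PI) with PI in E1 by ring; replace (1 * 0 + 0) with 0 in E1 by ring.
rewrite ellF_0, ellF_PI2 in E1.
assert (H2 : forall x : R, is_derive (fun t => ellF k (1 * t + PI) - ellF k (1 * t + 0)) x 0).
{ intros x; refine (is_derive_eq _ x _ 0 (is_derive_minus (V := R_NormedModule) _ _ x _ _
      (is_derive_ellF_comp 1 PI x) (is_derive_ellF_comp 1 0 x)) _); unfold minus, plus, opp; simpl.
    rewrite (ellDelta_sin_sq (1 * x + PI) (1 * x + 0)); [ring |].
    rewrite neg_sin; replace (1 * x + 0) with (1 * x) by ring; ring. }
assert (E2 := derive_0_const _ H2 phi 0); simpl in E2.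
replace (1 * phi + PI) with (phi + PI) in E2 by ring; replace (1 * phi + 0) with phi in E2 by ring.
replace (1 * 0 + PI) with PI in E2 by ring; replace (1 * 0 + 0) with 0 in E2 by ring.
rewrite ellF_0 in E2; lra.
Qed.

Lemma am_shift (x : R) : am k (x + 2 * ellK k) = am k x + PI.
Proof. apply ellF_inj; rewrite ellF_am, ellF_shift, ellF_am; ring. Qed.

Lemma am_0 : am k 0 = 0.
Proof. rewrite <- ellF_0 at 1; apply am_ellF. Qed.

Lemma am_ellK : am k (ellK k) = PI / 2.
Proof. rewrite <- ellF_PI2; apply am_ellF. Qed.

Lemma am_shift_Z (x : R) (n : Z) : am k (x + IZR n * (2 * ellK k)) = am k x + IZR n * PI.
Proof.
induction n as [| n IH | n IH] using Z.peano_ind.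
- rewrite !Rmult_0_l, !Rplus_0_r; reflexivity.
- rewrite <- Z.add_1_r, plus_IZR.
  replace (x + (IZR n + 1) * (2 * ellK k)) with (x + IZR n * (2 * ellK k) + 2 * ellK k) by ring.
  rewrite am_shift, IH; ring.
- rewrite <- Z.sub_1_r, minus_IZR.
  assert (E := am_shift (x + (IZR n - 1) * (2 * ellK k))).
  replace (x + (IZR n - 1) * (2 * ellK k) + 2 * ellK k) with (x + IZR n * (2 * ellK k)) in E by ring.
  rewrite IH in E; lra.
Qed.

Lemma sn_eq_0 (x : R) : sn k x = 0 -> exists n : Z, x = IZR n * (2 * ellK k).
Proof.
intros H; destruct (sin_eq_0_0 _ H) as [n Hn]; exists n.
assert (E := am_shift_Z 0 n); rewrite am_0, !Rplus_0_l, <- Hn in E.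
rewrite <- (ellF_am x), <- (ellF_am (IZR n * _)); now rewrite E.
Qed.

Lemma ellK_pos : 0 < ellK k.
Proof.
assert (T := ellF_growth 0 (PI / 2)); rewrite ellF_0, ellF_PI2 in T.
assert (P := PI_RGT_0); lra.
Qed.

Lemma sn_shift (x : R) : sn k (x + 2 * ellK k) = - sn k x.
Proof. unfold sn; rewrite am_shift; apply neg_sin. Qed.

Lemma cn_shift (x : R) : cn k (x + 2 * ellK k) = - cn k x.
Proof. unfold cn; rewrite am_shift; apply neg_cos. Qed.

Lemma dn_shift (x : R) : dn k (x + 2 * ellK k) = dn k x.
Proof. unfold dn; rewrite am_shift; apply ellDelta_sin_sq; rewrite neg_sin; ring. Qed.

Lemma sn_0 : sn k 0 = 0.
Proof. unfold sn; rewrite am_0; apply sin_0. Qed.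

Lemma cn_0 : cn k 0 = 1.
Proof. unfold cn; rewrite am_0; apply cos_0. Qed.

Lemma dn_0 : dn k 0 = 1.
Proof.
unfold dn, ellDelta; rewrite am_0, sin_0; replace (1 - k ^ 2 * 0 ^ 2) with 1 by ring; apply sqrt_1.
Qed.

Lemma sn_ellK : sn k (ellK k) = 1.
Proof. unfold sn; rewrite am_ellK; apply sin_PI2. Qed.

Lemma cn_ellK : cn k (ellK k) = 0.
Proof. unfold cn; rewrite am_ellK; apply cos_PI2. Qed.

Lemma dn_ellK : dn k (ellK k) = kc k.
Proof.
unfold dn, ellDelta, kc; rewrite am_ellK, sin_PI2; f_equal; ring.
Qed.

Lemma cn_bound (x : R) : Rabs (cn k x) <= 1.
Proof. assert (H := COS_bound (am k x)); apply Rabs_le; exact H. Qed.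

Lemma dn_bound (x : R) : Rabs (dn k x) <= 1.
Proof. rewrite Rabs_pos_eq; [apply ellDelta_le_1 | apply Rlt_le, dn_pos]. Qed.

(** The first of four Taylor bounds at 0, which feed the pole estimate [nsC_near_pole]. Each is the
    mean value inequality [derive_abs_le] applied to a derivative that is already under control. *)
Lemma sn_abs_le (x : R) : Rabs (sn k x) <= Rabs x.
Proof.
replace (sn k x) with (sn k x - sn k 0) by (rewrite sn_0; ring).
rewrite <- (Rmult_1_l (Rabs x)); apply (derive_abs_le (sn k) _ 1 x is_derive_sn).
intros t _; rewrite Rabs_mult, <- (Rmult_1_l 1).
apply Rmult_le_compat; try apply Rabs_pos; [apply cn_bound | apply dn_bound].
Qed.

Lemma cn_near_1 (x : R) : Rabs (cn k x - 1) <= x ^ 2.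
Proof.
rewrite <- cn_0; replace (x ^ 2) with (Rabs x * Rabs x) by (rewrite <- Rabs_mult, Rabs_pos_eq;
  [ring | nra]).
apply (derive_abs_le (cn k) _ (Rabs x) x is_derive_cn).
intros t Ht; rewrite Rabs_mult, Rabs_Ropp, <- (Rmult_1_r (Rabs x)).
apply Rmult_le_compat; try apply Rabs_pos; [| apply dn_bound].
apply Rle_trans with (1 := sn_abs_le t) (2 := Ht).
Qed.

Lemma dn_near_1 (x : R) : Rabs (dn k x - 1) <= x ^ 2.
Proof.
rewrite <- dn_0; replace (x ^ 2) with (Rabs x * Rabs x) by (rewrite <- Rabs_mult, Rabs_pos_eq;
  [ring | nra]).
apply (derive_abs_le (dn k) _ (Rabs x) x is_derive_dn).
intros t Ht; rewrite Rabs_Ropp, !Rabs_mult.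
assert (T1 := Rle_trans _ _ _ (sn_abs_le t) Ht); assert (T2 := cn_bound t).
assert (T3 := Rabs_pos (sn k t)); assert (T4 := Rabs_pos (cn k t)); assert (T5 := Rabs_pos x).
rewrite (Rabs_pos_eq (k ^ 2)) by nra.
assert (0 <= k ^ 2 <= 1) by nra.
assert (0 <= Rabs (sn k t) * Rabs (cn k t) <= Rabs x) by nra. nra.
Qed.

Lemma sn_near_id (x : R) : Rabs (sn k x - x) <= 2 * Rabs x ^ 3.
Proof.
replace (sn k x - x) with ((sn k x - x) - (sn k 0 - 0)) by (rewrite sn_0; ring).
replace (2 * Rabs x ^ 3) with (2 * x ^ 2 * Rabs x) by (rewrite <- (pow2_abs x); ring).
apply (derive_abs_le (fun t => sn k t - t) (fun t => cn k t * dn k t - 1)).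
- intros t; apply (is_derive_minus (V := R_NormedModule));
  [apply is_derive_sn | apply (is_derive_id (K := R_AbsRing))].
- intros t Ht.
  assert (Ht2 : t ^ 2 <= x ^ 2) by (rewrite <- (pow2_abs t), <- (pow2_abs x); apply pow_incr; split;
    [apply Rabs_pos | exact Ht]).
  replace (cn k t * dn k t - 1) with ((cn k t - 1) * dn k t + (dn k t - 1)) by ring.
  apply Rle_trans with (1 := Rabs_triang _ _); rewrite Rabs_mult.
  assert (T1 := cn_near_1 t); assert (T2 := dn_near_1 t); assert (T3 := dn_bound t).
  assert (T4 := Rabs_pos (cn k t - 1)); assert (T5 := Rabs_pos (dn k t)); nra.
Qed.

End Jacobi.

Lemma kc_sq (k : R) : 0 < k < 1 -> kc k ^ 2 = 1 - k ^ 2.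
Proof. intros H; apply pow2_sqrt; nra. Qed.

Lemma kc_bounds (k : R) : 0 < k < 1 -> 0 < kc k < 1.
Proof.
intros H; assert (T := kc_sq k H).
assert (T' : 0 < kc k) by (apply sqrt_lt_R0; nra); split; [exact T' | nra].
Qed.

Lemma kc_kc (k : R) : 0 < k < 1 -> kc (kc k) = k.
Proof.
intros H; unfold kc at 1; rewrite kc_sq by exact H.
replace (1 - (1 - k ^ 2)) with (k ^ 2) by ring; apply sqrt_pow2; lra.
Qed.

(** * The complex function ns *)

(* ns (x + i y), from the addition theorem and the imaginary transformation; in this form the
   denominator vanishes only at the lattice points. *)
Definition nsC (k : R) (z : C) : C :=
  let s := RtoC (sn k (Re z)) in let c := RtoC (cn k (Re z)) in let d := RtoC (dn k (Re z)) in
  let s1 := RtoC (sn (kc k) (Im z)) in let c1 := RtoC (cn (kc k) (Im z)) in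
  let d1 := RtoC (dn (kc k) (Im z)) in
  ((s * d1 - Ci * (c * d * (s1 * c1))) / (s * s * (c1 * c1) + s1 * s1))%C.

Section ComplexNs.

Variable k : R.
Hypothesis Hk : 0 < k < 1.

Let Hk' : 0 < kc k < 1 := kc_bounds k Hk.

Let Lam : C -> Prop := rect_lattice (2 * ellK k) (2 * ellK (kc k)).

(** If [s1 = 0] then [c1 ^ 2 = 1], so the sum can vanish only where both [s] and [s1] do, that is,
    at lattice points. *)
Lemma ns_denominator_pos (z : C) :
  ~ Lam z -> 0 < sn k (Re z) ^ 2 * cn (kc k) (Im z) ^ 2 + sn (kc k) (Im z) ^ 2.
Proof.
intros Hz.
set (s := sn k (Re z)); set (s1 := sn (kc k) (Im z)); set (c1 := cn (kc k) (Im z)).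
assert (H1 : s1 ^ 2 + c1 ^ 2 = 1) by apply sn_sq_cn_sq.
destruct (Req_dec s1 0) as [E1 | E1].
- assert (Hs : s <> 0).
  { intros E; apply Hz.
    destruct (sn_eq_0 k Hk _ E) as [m Hm]; destruct (sn_eq_0 (kc k) Hk' _ E1) as [n Hn].
    exists m, n; rewrite <- Hm, <- Hn; now destruct z. }
  rewrite E1 in *; assert (0 < s ^ 2) by (apply pow2_gt_0; exact Hs); nra.
- assert (0 < s1 ^ 2) by (apply pow2_gt_0; exact E1).
  assert (0 <= s ^ 2 * c1 ^ 2) by (rewrite <- Rpow_mult_distr; apply pow2_ge_0); lra.
Qed.

Lemma cdiffable_nsC (z : C) : ~ Lam z -> cdiffable (nsC k) z.
Proof.
intros Hz; assert (HE := ns_denominator_pos z Hz).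
assert (Fs := frechet_re (sn k) z _ (is_derive_sn k Hk (Re z))).
assert (Fc := frechet_re (cn k) z _ (is_derive_cn k Hk (Re z))).
assert (Fd := frechet_re (dn k) z _ (is_derive_dn k Hk (Re z))).
assert (Fs1 := frechet_im (sn (kc k)) z _ (is_derive_sn (kc k) Hk' (Im z))).
assert (Fc1 := frechet_im (cn (kc k)) z _ (is_derive_cn (kc k) Hk' (Im z))).
assert (Fd1 := frechet_im (dn (kc k)) z _ (is_derive_dn (kc k) Hk' (Im z))).
assert (R1 := sn_sq_cn_sq k (Re z)); assert (R2 := sn_sq_cn_sq (kc k) (Im z)).
assert (R3 := dn_sq k Hk (Re z)); assert (R4 := dn_sq (kc k) Hk' (Im z)).
rewrite kc_sq in R4 by exact Hk; rewrite kc_sq in Fd1 by exact Hk.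
assert (FE := frechet_plus _ _ _ _ _ _ _
  (frechet_mult _ _ _ _ _ _ _ (frechet_mult _ _ _ _ _ _ _ Fs Fs) (frechet_mult _ _ _ _ _ _ _ Fc1 Fc1))
  (frechet_mult _ _ _ _ _ _ _ Fs1 Fs1)).
assert (FN := frechet_plus _ _ _ _ _ _ _ (frechet_mult _ _ _ _ _ _ _ Fs Fd1)
  (frechet_mult _ _ _ _ _ _ _ (frechet_const (- Ci)%C z)
    (frechet_mult _ _ _ _ _ _ _ (frechet_mult _ _ _ _ _ _ _ Fc Fd)
      (frechet_mult _ _ _ _ _ _ _ Fs1 Fc1)))).
apply frechet_inv in FE.
2: { intros E; injection E as E _; revert HE; simpl in *; lra. }
assert (F := frechet_mult _ _ _ _ _ _ _ FN FE); clear FE FN Fs Fc Fd Fs1 Fc1 Fd1.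
cbv beta in F.
rewrite !RtoC_opp, !RtoC_mult, !RtoC_minus, !RtoC_opp, !RtoC_pow in F.
assert (HEC : (RtoC (sn k (Re z)) * RtoC (sn k (Re z)) * (RtoC (cn (kc k) (Im z)) * RtoC (cn (kc k)
  (Im z))) +
  RtoC (sn (kc k) (Im z)) * RtoC (sn (kc k) (Im z)))%C <> 0).
{ intros E; injection E as E _; revert HE; simpl in *; lra. }
assert (C1 : (RtoC (cn k (Re z)) * RtoC (cn k (Re z)) = 1 - RtoC (sn k (Re z)) * RtoC (sn k (Re z)))%C).
{ rewrite <- !RtoC_mult, <- RtoC_minus; f_equal; lra. }
assert (C2 : (RtoC (cn (kc k) (Im z)) * RtoC (cn (kc k) (Im z)) =
  1 - RtoC (sn (kc k) (Im z)) * RtoC (sn (kc k) (Im z)))%C).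
{ rewrite <- !RtoC_mult, <- RtoC_minus; f_equal; lra. }
assert (C3 : (RtoC (dn k (Re z)) * RtoC (dn k (Re z)) =
  1 - RtoC k * RtoC k * RtoC (sn k (Re z)) * RtoC (sn k (Re z)))%C).
{ rewrite <- !RtoC_mult, <- RtoC_minus; f_equal; lra. }
assert (C4 : (RtoC (dn (kc k) (Im z)) * RtoC (dn (kc k) (Im z)) =
  1 - (1 - RtoC k * RtoC k) * RtoC (sn (kc k) (Im z)) * RtoC (sn (kc k) (Im z)))%C).
{ rewrite <- !RtoC_mult, <- RtoC_minus, <- !RtoC_mult, <- RtoC_minus; f_equal; lra. }
eexists; unfold cderiv.
(* [F] carries the partials [L] and [M] assembled by the product and quotient rules; what is left is
   the Cauchy-Riemann equation [M = Ci * L]. *)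
match type of F with frechet ?f _ ?L ?M =>
  assert (FF : frechet f z L (Ci * L)); [replace (Ci * L)%C with M; [exact F |] |
   revert FF; apply (frechet_ext_loc _ _ _ _ _ 1 Rlt_0_1);
   intros w _; unfold nsC, Cdiv, Cminus; ring] end.
clear F R1 R2 R3 R4 HE.
revert HEC C1 C2 C3 C4.
(* With the Jacobi values as free variables the equation is a polynomial consequence of the four
   quadratic relations and [Ci * Ci = - 1]. *)
generalize (RtoC (sn k (Re z))) (RtoC (cn k (Re z))) (RtoC (dn k (Re z)))
  (RtoC (sn (kc k) (Im z))) (RtoC (cn (kc k) (Im z))) (RtoC (dn (kc k) (Im z))) (RtoC k).
intros s c d s1 c1 d1 kk HEC C1 C2 C3 C4.
field_simplify_eq; [| exact HEC].
cbv beta; ring [C1 C2 C3 C4 Ci_sq].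
Qed.
Lemma nsC_shift_re (x y : R) : nsC k (x + 2 * ellK k, y) = (- nsC k (x, y))%C.
Proof.
unfold nsC, Re, Im; simpl fst; simpl snd.
rewrite sn_shift, cn_shift, dn_shift by exact Hk; rewrite !RtoC_opp; unfold Cdiv.
match goal with |- (_ * / ?a = - (_ * / ?b))%C => replace a with b by ring end; ring.
Qed.

Lemma nsC_shift_im (x y : R) : nsC k (x, y + 2 * ellK (kc k)) = nsC k (x, y).
Proof.
unfold nsC, Re, Im; simpl fst; simpl snd.
rewrite sn_shift, cn_shift, dn_shift by exact Hk'; rewrite !RtoC_opp; unfold Cdiv.
match goal with |- (_ * / ?a = _ * / ?b)%C => replace a with b by ring end; ring.
Qed.

(** Here the denominator is [cn ^ 2 + sn ^ 2 = 1]. Like [nsC_im_ellK], this serves twice: at half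
    periods it evaluates the constants [e_j], and along the whole line it gives the squares of the
    roots. *)
Lemma nsC_re_ellK (y : R) : nsC k (ellK k, y) = RtoC (dn (kc k) y).
Proof.
unfold nsC, Re, Im; simpl fst; simpl snd; rewrite sn_ellK, cn_ellK by exact Hk.
assert (H := sn_sq_cn_sq (kc k) y).
match goal with |- (_ / ?a)%C = _ => replace a with (RtoC 1) end.
- field; apply RtoC_neq_0, R1_neq_R0.
- rewrite <- !RtoC_mult, <- RtoC_plus; f_equal; lra.
Qed.

Lemma nsC_im_ellK (x : R) : nsC k (x, ellK (kc k)) = RtoC (k * sn k x).
Proof.
unfold nsC, Re, Im; simpl fst; simpl snd; rewrite sn_ellK, cn_ellK, dn_ellK by exact Hk'.
rewrite kc_kc, RtoC_mult by exact Hk.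
field; repeat split; intros E; injection E; lra.
Qed.

(** The two numerators are within [3 r ^ 3] and [5 r ^ 3] of [x] and [y], the denominator within
    [10 r ^ 4] of [r ^ 2]. A numerator error [m r ^ 3] becomes [2 (m + 10) r] in the quotient, and
    26 + 30 = 56. The order [r], with no constant term, is what keeps the square of [nsC] at a
    bounded distance from [1 / z ^ 2]. *)
Lemma nsC_near_pole (x y : R) (r := Cmod (x, y)) :
  0 < r -> r <= / 5 -> Cmod (nsC k (x, y) - / (x, y)) <= 56 * r.
Proof.
intros Hr0 Hr1.
assert (Hx : Rabs x <= r) by apply (re_le_Cmod (x, y)).
assert (Hy : Rabs y <= r) by apply (Cmod_im_le (x, y)).
assert (Hr2 : r ^ 2 = x ^ 2 + y ^ 2) by apply (Cmod2_alt (x, y)).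
assert (Hx2 : x ^ 2 <= r ^ 2) by (rewrite Hr2; nra).
assert (Hy2 : y ^ 2 <= r ^ 2) by (rewrite Hr2; nra).
assert (Hx3 : Rabs x ^ 3 <= r ^ 3) by (apply pow_incr; split; [apply Rabs_pos | exact Hx]).
assert (Hy3 : Rabs y ^ 3 <= r ^ 3) by (apply pow_incr; split; [apply Rabs_pos | exact Hy]).
assert (Hrr : r ^ 2 <= / 25) by nra.
assert (prod3 : forall a b A B, Rabs a <= A -> Rabs b <= B -> Rabs (a * b) <= A * B).
{ intros a b A B HA HB; rewrite Rabs_mult; apply Rmult_le_compat; auto using Rabs_pos. }
assert (tri : forall a b A B, Rabs a <= A -> Rabs b <= B -> Rabs (a + b) <= A + B).
{ intros a b A B HA HB; apply Rle_trans with (1 := Rabs_triang _ _); lra. }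
set (s := sn k x); set (c := cn k x); set (d := dn k x).
set (s1 := sn (kc k) y); set (c1 := cn (kc k) y); set (d1 := dn (kc k) y).
assert (bs : Rabs s <= r) by (apply Rle_trans with (1 := sn_abs_le k Hk x) (2 := Hx)).
assert (bs1 : Rabs s1 <= r) by (apply Rle_trans with (1 := sn_abs_le (kc k) Hk' y) (2 := Hy)).
assert (es : Rabs (s - x) <= 2 * r ^ 3) by (apply Rle_trans with (1 := sn_near_id k Hk x); lra).
assert (es1 : Rabs (s1 - y) <= 2 * r ^ 3) by (apply Rle_trans with (1 := sn_near_id (kc k) Hk' y); lra).
assert (ec : Rabs (c - 1) <= r ^ 2) by (apply Rle_trans with (1 := cn_near_1 k Hk x) (2 := Hx2)).
assert (ed : Rabs (d - 1) <= r ^ 2) by (apply Rle_trans with (1 := dn_near_1 k Hk x) (2 := Hx2)).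
assert (ec1 : Rabs (c1 - 1) <= r ^ 2) by (apply Rle_trans with (1 := cn_near_1 (kc k) Hk' y)
  (2 := Hy2)).
assert (ed1 : Rabs (d1 - 1) <= r ^ 2) by (apply Rle_trans with (1 := dn_near_1 (kc k) Hk' y)
  (2 := Hy2)).
assert (bc : Rabs c <= 1) by apply cn_bound; assert (bd : Rabs d <= 1) by apply (dn_bound k Hk).
assert (bc1 : Rabs c1 <= 1) by apply cn_bound;
  assert (bd1 : Rabs d1 <= 1) by apply (dn_bound (kc k) Hk').
assert (eP : Rabs (s * d1 - x) <= 3 * r ^ 3).
{ replace (s * d1 - x) with ((s - x) * d1 + x * (d1 - 1)) by ring.
  replace (3 * r ^ 3) with (2 * r ^ 3 * 1 + r * r ^ 2) by ring; apply tri; apply prod3; assumption. }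
assert (ecd : Rabs (c * d - 1) <= 2 * r ^ 2).
{ replace (c * d - 1) with ((c - 1) * d + (d - 1)) by ring.
  replace (2 * r ^ 2) with (r ^ 2 * 1 + r ^ 2) by ring; apply tri; [apply prod3 |]; assumption. }
assert (ecdc : Rabs (c * d * c1 - 1) <= 3 * r ^ 2).
{ replace (c * d * c1 - 1) with ((c * d - 1) * c1 + (c1 - 1)) by ring.
  replace (3 * r ^ 2) with (2 * r ^ 2 * 1 + r ^ 2) by ring; apply tri; [apply prod3 |]; assumption. }
assert (eQ : Rabs (c * d * (s1 * c1) - y) <= 5 * r ^ 3).
{ replace (c * d * (s1 * c1) - y) with ((s1 - y) * (c * d * c1) + y * (c * d * c1 - 1)) by ring.
  replace (5 * r ^ 3) with (2 * r ^ 3 * (1 * 1 * 1) + r * (3 * r ^ 2)) by ring.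
  apply tri; apply prod3; try assumption; repeat apply prod3; assumption. }
assert (esc : Rabs (s * c1 - x) <= 3 * r ^ 3).
{ replace (s * c1 - x) with ((s - x) * c1 + x * (c1 - 1)) by ring.
  replace (3 * r ^ 3) with (2 * r ^ 3 * 1 + r * r ^ 2) by ring; apply tri; apply prod3; assumption. }
set (E := s * s * (c1 * c1) + s1 * s1).
assert (eE : Rabs (E - (x ^ 2 + y ^ 2)) <= 10 * r ^ 4).
{ replace (E - (x ^ 2 + y ^ 2)) with ((s * c1 - x) * (s * c1 + x) + (s1 - y) * (s1 + y))
    by (unfold E; ring).
  replace (10 * r ^ 4) with (3 * r ^ 3 * (r * 1 + r) + 2 * r ^ 3 * (r + r)) by ring.
  apply tri; apply prod3; try assumption; apply tri; try assumption; apply prod3; assumption. }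
assert (r2p : 0 < r ^ 2) by (apply pow_lt, Hr0).
(* The threshold [r <= / 5] makes [10 r ^ 4] at most two fifths of [r ^ 2]. *)
assert (HE : r ^ 2 / 2 <= E).
{ apply Rabs_le_between in eE; replace (r ^ 4) with (r ^ 2 * r ^ 2) in eE by ring; nra. }
assert (HN : forall p P m, 0 <= m -> Rabs p <= r -> Rabs (P - p) <= m * r ^ 3 ->
  Rabs (P / E - p / r ^ 2) <= 2 * (m + 10) * r).
{ intros p P m Hm bp HP.
  replace (P / E - p / r ^ 2) with (((P - p) * r ^ 2 - p * (E - r ^ 2)) / (E * r ^ 2)) by (field; lra).
  rewrite Rabs_div by nra; rewrite (Rabs_pos_eq (E * r ^ 2)) by nra.
  apply Rle_div_l; [nra |].
  assert (T : Rabs ((P - p) * r ^ 2 - p * (E - r ^ 2)) <= m * r ^ 3 * r ^ 2 + r * (10 * r ^ 4)).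
  { unfold Rminus at 1; apply tri; [apply prod3; [exact HP | rewrite Rabs_pos_eq; lra] |].
    rewrite Rabs_Ropp; apply prod3; [exact bp | rewrite Hr2; exact eE]. }
  apply Rle_trans with (1 := T).
  replace (m * r ^ 3 * r ^ 2 + r * (10 * r ^ 4)) with (2 * (m + 10) * r * (r ^ 2 / 2 * r ^ 2)) by field.
  apply Rmult_le_compat_l; [apply Rmult_le_pos; lra | apply Rmult_le_compat_r; lra]. }
assert (B1 := HN x (s * d1) 3 ltac:(lra) Hx eP).
assert (B2 := HN y (c * d * (s1 * c1)) 5 ltac:(lra) Hy eQ).
replace (nsC k (x, y) - / (x, y))%C with
  (s * d1 / E - x / r ^ 2, - (c * d * (s1 * c1) / E - y / r ^ 2)).
- apply Rle_trans with (1 := Cmod_le_re_im _); cbv [Re Im fst snd].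
  rewrite Rabs_Ropp; lra.
- unfold nsC; cbv [Re Im fst snd]; fold s c d s1 c1 d1.
  rewrite <- !RtoC_mult, <- RtoC_plus; fold E; rewrite Hr2.
  cbv [Cdiv Cinv Cminus Cplus Copp Cmult Ci RtoC fst snd].
  rewrite Hr2 in r2p; f_equal; field; (split; [| lra]); lra.
Qed.

(** With [e = nsC k z - 1 / z] the difference is [e ^ 2 + 2 e / z], at most [(56 / 5) ^ 2 + 112],
    which is below 600. *)
Lemma nsC_sq_near_pole (z : C) :
  0 < Cmod z -> Cmod z <= / 5 -> Cmod (nsC k z * nsC k z - / (z * z)) <= 600.
Proof.
intros H0 H1; assert (H := nsC_near_pole (Re z) (Im z)).
replace (Re z, Im z) with z in H by now destruct z.
specialize (H H0 H1); assert (Hz := Cmod_neq_0 _ H0).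
replace (nsC k z * nsC k z - / (z * z))%C
  with ((nsC k z - / z) * (nsC k z - / z) + 2 * (nsC k z - / z) * / z)%C by (field; exact Hz).
set (e := (nsC k z - / z)%C) in *; assert (He := Cmod_ge_0 e).
apply Rle_trans with (1 := Cmod_triangle _ _).
rewrite !Cmod_mult, Cmod_inv, Cmod_R, (Rabs_pos_eq 2) by (exact Hz || lra).
set (r := Cmod z) in *.
assert (T : 2 * Cmod e * / r <= 112).
{ replace 112 with (2 * (56 * r) * / r) by (field; lra).
  apply Rmult_le_compat_r; [apply Rlt_le, Rinv_0_lt_compat |]; lra. }
nra.
Qed.

End ComplexNs.

(** * Symmetric double sums *)

Notation csum := (@sum_n C_AbelianMonoid).

Lemma csum_S (f : nat -> C) (n : nat) : csum f (S n) = (csum f n + f (S n))%C.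
Proof. exact (sum_Sn f n). Qed.

Lemma csum_rev (f : nat -> C) (n : nat) : csum (fun i => f (n - i)%nat) n = csum f n.
Proof.
induction n as [| n IH]; [now rewrite !sum_O |].
rewrite (csum_S f n), <- IH; unfold sum_n at 1.
rewrite (sum_Sn_m (G := C_AbelianMonoid)) by lia; rewrite <- (sum_n_m_S (G := C_AbelianMonoid)).
change (f (S n - 0)%nat + csum (fun i => f (S n - S i)%nat) n = csum (fun i => f (n - i)%nat) n + f (S n))%C.
rewrite (sum_n_ext (fun i => f (S n - S i)%nat) (fun i => f (n - i)%nat)) by reflexivity.
rewrite Nat.sub_0_r; apply Cplus_comm.
Qed.

Definition zsum (f : Z -> C) (N : nat) : C :=
  csum (fun i => f (Z.of_nat i - Z.of_nat N)%Z) (2 * N).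

Lemma csum_loc_ind (P : nat -> C -> Prop) (f : nat -> C) (n : nat) :
  P O (f O) -> (forall i s, (i < n)%nat -> P i s -> P (S i) (s + f (S i))%C) -> P n (csum f n).
Proof.
intros H0; induction n as [| n IH]; intros HS; [now rewrite sum_O |].
rewrite csum_S; apply HS; [lia | apply IH; intros i s Hi; apply HS; lia].
Qed.

Lemma zsum_ext (f g : Z -> C) (N : nat) : (forall m, f m = g m) -> zsum f N = zsum g N.
Proof. intros H; apply sum_n_ext; intros i; apply H. Qed.

Lemma zsum_minus (f g : Z -> C) (N : nat) :
  zsum (fun m => f m - g m)%C N = (zsum f N - zsum g N)%C.
Proof.
unfold zsum; generalize (2 * N)%nat; intros n; induction n as [| n IH]; [now rewrite !sum_O |].
rewrite !csum_S, IH; ring.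
Qed.

Lemma zsum_opp_index (f : Z -> C) (N : nat) : zsum (fun m => f (- m)%Z) N = zsum f N.
Proof.
unfold zsum; rewrite <- (csum_rev (fun i => f (Z.of_nat i - Z.of_nat N)%Z)).
apply (sum_n_ext_loc (G := C_AbelianMonoid)); intros i Hi; f_equal; lia.
Qed.

(** The form in which a translation by a period acts: the term of index [m] at [z + w1] is the term
    of index [m - 1] at [z], so only the indices [- N - 1] and [N] survive. *)
Lemma zsum_telescope (f g : Z -> C) (N : nat) :
  (forall m, f m = g (m - 1)%Z - g m)%C ->
  zsum f N = (g (- Z.of_nat N - 1)%Z - g (Z.of_nat N))%C.
Proof.
intros H; unfold zsum.
replace (g (Z.of_nat N)) with (g (Z.of_nat (2 * N) - Z.of_nat N)%Z) by (f_equal; lia).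
apply (csum_loc_ind (fun n s => s = g (- Z.of_nat N - 1)%Z - g (Z.of_nat n - Z.of_nat N)%Z)%C).
- rewrite H; do 2 f_equal; lia.
- intros i s _ ->; rewrite H.
  replace (Z.of_nat (S i) - Z.of_nat N - 1)%Z with (Z.of_nat i - Z.of_nat N)%Z by lia; ring.
Qed.

Lemma zsum_delta (v : C) (N : nat) : zsum (fun m => if Z.eqb m 0 then v else 0) N = v.
Proof.
unfold zsum.
assert (H : forall n, csum (fun i => if Z.eqb (Z.of_nat i - Z.of_nat N) 0 then v else RtoC 0) n =
  if Nat.leb N n then v else RtoC 0).
{ induction n as [| n IH].
  - rewrite sum_O; cbv beta; destruct (Z.eqb_spec (Z.of_nat 0 - Z.of_nat N) 0), (Nat.leb_spec N 0);
    reflexivity || lia.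
  - rewrite csum_S, IH; cbv beta.
    destruct (Z.eqb_spec (Z.of_nat (S n) - Z.of_nat N) 0), (Nat.leb_spec N n), (Nat.leb_spec N (S n));
      (exact (Cplus_0_l _) || exact (Cplus_0_r _) || lia). }
rewrite H; destruct (Nat.leb_spec N (2 * N)); [reflexivity | lia].
Qed.

Lemma zsum_le_telescope (f : Z -> C) (B : Z -> R) (N : nat) :
  (forall m, Cmod (f m) <= B (m + 1)%Z - B m) ->
  Cmod (zsum f N) <= B (Z.of_nat N + 1)%Z - B (- Z.of_nat N)%Z.
Proof.
intros H; unfold zsum.
replace (Z.of_nat N + 1)%Z with (Z.of_nat (2 * N) - Z.of_nat N + 1)%Z by lia.
apply (csum_loc_ind (fun n s =>
  Cmod s <= B (Z.of_nat n - Z.of_nat N + 1)%Z - B (- Z.of_nat N)%Z)).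
- apply H.
- intros i s _ Hs; apply Rle_trans with (1 := Cmod_triangle _ _).
  assert (T := H (Z.of_nat (S i) - Z.of_nat N)%Z).
  replace (Z.of_nat (S i) - Z.of_nat N)%Z with (Z.of_nat i - Z.of_nat N + 1)%Z in * by lia; lra.
Qed.

Lemma zsum_le_const (f : Z -> C) (M : R) (N : nat) :
  (forall m, Cmod (f m) <= M) -> Cmod (zsum f N) <= (2 * INR N + 1) * M.
Proof.
intros H; replace ((2 * INR N + 1) * M) with
  (IZR (Z.of_nat N + 1) * M - IZR (- Z.of_nat N) * M).
- apply (zsum_le_telescope f (fun m => IZR m * M)); intros m.
  rewrite plus_IZR; assert (T := H m); lra.
- rewrite plus_IZR, opp_IZR, <- INR_IZR_INZ; ring.
Qed.

(** A two-sided integral test with [phi] in the place of the tail integral; each half of the sum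
    costs at most [phi 0]. *)
Lemma zsum_le_decreasing (f : Z -> C) (A phi : R -> R) (N : nat) :
  (forall x, 0 <= x -> A x <= phi x - phi (x + 1) /\ A (x + 1) <= A x /\ 0 <= phi x) ->
  (forall m, Cmod (f m) <= A (IZR (Z.abs m))) -> Cmod (zsum f N) <= 2 * phi 0.
Proof.
intros H Hf.
(* For [m < 0] the increment of [B] is [phi x - phi (x + 1)] with [x = - m - 1]; monotonicity of [A]
   bridges the gap between [x + 1 = |m|] and [x]. *)
set (B := fun m => if Z.leb 0 m then phi 0 - phi (IZR m) else phi (IZR (- m)) - phi 0).
assert (HB : forall m, Cmod (f m) <= B (m + 1)%Z - B m).
{ intros m; apply Rle_trans with (1 := Hf m); unfold B.
  destruct (Z.leb_spec 0 m) as [L1 | L1], (Z.leb_spec 0 (m + 1)) as [L2 | L2]; try lia.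
  - rewrite Z.abs_eq, plus_IZR by lia; destruct (H (IZR m)); [now apply IZR_le | lra].
  - replace m with (-1)%Z by lia; simpl.
    destruct (H 0) as [U1 [U2 _]]; [lra |]; replace (0 + 1) with 1 in * by ring; lra.
  - rewrite Z.abs_neq by lia.
    assert (E : IZR (- m) = IZR (- (m + 1)) + 1) by (rewrite !opp_IZR, plus_IZR; ring).
    destruct (H (IZR (- (m + 1)))) as [U1 [U2 _]]; [apply IZR_le; lia |].
    rewrite <- E in *; lra. }
apply Rle_trans with (1 := zsum_le_telescope f B N HB); unfold B.
destruct (Z.leb_spec 0 (Z.of_nat N + 1)); [| lia].
destruct (H (IZR (Z.of_nat N + 1))) as [_ [_ P1]]; [apply IZR_le; lia |].
destruct (Z.leb_spec 0 (- Z.of_nat N)).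
- replace (- Z.of_nat N)%Z with 0%Z by lia; destruct (H 0) as [_ [_ P2]]; lra.
- destruct (H (IZR (- - Z.of_nat N))) as [_ [_ P2]]; [apply IZR_le; lia | lra].
Qed.

Lemma inv_cube_telescope (X : R) : 1 <= X ->
  / X ^ 3 <= 2 / X ^ 2 - 2 / (X + 1) ^ 2 /\ / (X + 1) ^ 3 <= / X ^ 3 /\ 0 <= 2 / X ^ 2.
Proof.
intros HX; assert (0 < X ^ 3) by (apply pow_lt; lra); assert (0 < X ^ 2) by (apply pow_lt; lra).
split; [| split].
- apply Rminus_le.
  replace (/ X ^ 3 - (2 / X ^ 2 - 2 / (X + 1) ^ 2)) with ((1 - 3 * X ^ 2) / (X ^ 3 * (X + 1) ^ 2))
    by (field; lra).
  apply Rmult_le_reg_r with (X ^ 3 * (X + 1) ^ 2).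
  { apply Rmult_lt_0_compat; [assumption | apply pow_lt; lra]. }
  rewrite Rmult_0_l; unfold Rdiv; rewrite Rmult_assoc, Rinv_l, Rmult_1_r.
  + nra.
  + apply Rgt_not_eq, Rmult_lt_0_compat; [assumption | apply pow_lt; lra].
- apply Rinv_le_contravar; [assumption | apply pow_incr; lra].
- apply Rle_mult_inv_pos; [lra | assumption].
Qed.

Lemma inv_square_telescope (X : R) : 1 <= X ->
  / X ^ 2 <= 2 / X - 2 / (X + 1) /\ / (X + 1) ^ 2 <= / X ^ 2 /\ 0 <= 2 / X.
Proof.
intros HX; assert (0 < X ^ 2) by (apply pow_lt; lra).
split; [| split].
- replace (2 / X - 2 / (X + 1)) with (/ (X * (X + 1) / 2)) by (field; lra).
  apply Rinv_le_contravar; nra.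
- apply Rinv_le_contravar; [assumption | apply pow_incr; lra].
- apply Rle_mult_inv_pos; lra.
Qed.

(** Summing over [n] first leaves [4 K / (1 + |m|) ^ 2]; summing this over [m] gives at most
    [2 * 4 K * 2]. *)
Lemma zsum_zsum_bound (f : Z -> Z -> C) (K : R) (N : nat) :
  0 <= K ->
  (forall m n, Cmod (f m n) <= K * / (1 + IZR (Z.abs m) + IZR (Z.abs n)) ^ 3) ->
  Cmod (zsum (fun m => zsum (f m) N) N) <= 16 * K.
Proof.
intros HK H.
assert (pos : forall m, 0 <= IZR (Z.abs m)) by (intros m; apply IZR_le, Z.abs_nonneg).
replace (16 * K) with (2 * (4 * K * (2 / (1 + 0)))) by field.
apply (zsum_le_decreasing _ (fun x => 4 * K * / (1 + x) ^ 2) (fun x => 4 * K * (2 / (1 + x)))).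
- intros x Hx; destruct (inv_square_telescope (1 + x)) as [T1 [T2 T3]]; [lra |].
  replace (1 + (x + 1)) with (1 + x + 1) by ring.
  split; [| split]; [nra | nra |]; apply Rmult_le_pos; lra.
- intros m; set (p := IZR (Z.abs m)); assert (Hp : 0 <= p) by apply pos.
  replace (4 * K * / (1 + p) ^ 2) with (2 * (K * (2 / (1 + p + 0) ^ 2)))
    by (field; lra).
  apply (zsum_le_decreasing _ (fun x => K * / (1 + p + x) ^ 3)
      (fun x => K * (2 / (1 + p + x) ^ 2))).
  + intros x Hx; destruct (inv_cube_telescope (1 + p + x)) as [T1 [T2 T3]]; [lra |].
    replace (1 + p + (x + 1)) with (1 + p + x + 1) by ring.
    split; [| split]; [nra | nra |]; apply Rmult_le_pos; lra.
  + intros n; apply H.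
Qed.

(** * Comparing the limits of two sequences *)

Lemma LimSup_seq_shift (u v : nat -> R) (M c : R) :
  (forall n, Rabs (u n) <= M) -> is_lim_seq (fun n => v n - u n) c ->
  exists l : R, LimSup_seq u = Finite l /\ LimSup_seq v = Finite (l + c).
Proof.
intros HM Hc.
assert (L1 : Rbar_le (LimSup_seq (fun _ => - M)) (LimSup_seq u))
  by (apply LimSup_le; exists O; intros n _; assert (T := HM n); apply Rabs_le_between in T; lra).
assert (L2 : Rbar_le (LimSup_seq u) (LimSup_seq (fun _ => M)))
  by (apply LimSup_le; exists O; intros n _; assert (T := HM n); apply Rabs_le_between in T; lra).
rewrite LimSup_seq_const in L1, L2.
assert (Hs := proj2_sig (ex_LimSup_seq u)); fold (LimSup_seq u) in Hs.
destruct (LimSup_seq u) as [l | |]; [| contradiction | contradiction].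
exists l; split; [reflexivity |]; apply is_LimSup_seq_unique; intros eps.
destruct (Hs (pos_div_2 eps)) as [A1 [N1 A2]].
destruct (proj2 (is_lim_seq_spec _ _) Hc (pos_div_2 eps)) as [N2 A3]; simpl in *; split.
- intros N; destruct (A1 (max N N2)) as [n [Hn A]]; exists n; split; [lia |].
  assert (T := A3 n ltac:(lia)); apply Rabs_lt_between in T; lra.
- exists (max N1 N2); intros n Hn.
  assert (T := A3 n ltac:(lia)); apply Rabs_lt_between in T; assert (T' := A2 n ltac:(lia)); lra.
Qed.

(** [Lim_seq] is the mean of the upper and the lower limit, so it has a value for any sequence. Both
    limits shift by [c], whether or not the sequences converge; the bound on [u] keeps them finite,
    so that [real] loses nothing. *)
Lemma Lim_seq_shift (u v : nat -> R) (M c : R) :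
  (forall n, Rabs (u n) <= M) -> is_lim_seq (fun n => v n - u n) c ->
  real (Lim_seq v) = real (Lim_seq u) + c.
Proof.
intros HM Hc; destruct (LimSup_seq_shift u v M c HM Hc) as [ls [Su Sv]].
destruct (LimSup_seq_shift (fun n => - u n) (fun n => - v n) M (- c)) as [li [Iu Iv]].
- intros n; now rewrite Rabs_Ropp.
- apply (is_lim_seq_ext (fun n => - (v n - u n))); [intros n; ring |].
  now apply (is_lim_seq_opp _ (Finite c)).
- rewrite LimSup_seq_opp in Iu, Iv; unfold Lim_seq; rewrite Su, Sv.
  destruct (LimInf_seq u) as [iu | |], (LimInf_seq v) as [iv | |]; try discriminate.
  injection Iu as Iu; injection Iv as Iv; simpl; replace iv with (iu + c) by lra; field.
Qed.

(** * Periodicity and evenness of wp *)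

Lemma distance_to_integers (X : R) :
  (forall m : Z, X <> IZR m) -> exists d : R, 0 < d /\ forall m : Z, d <= Rabs (X - IZR m).
Proof.
intros H; destruct (archimed X) as [A1 A2].
assert (N1 := H (up X)); assert (N2 := H (up X - 1)%Z); rewrite minus_IZR in N2.
exists (Rmin (IZR (up X) - X) (X - (IZR (up X) - 1))); split; [apply Rmin_pos; lra |].
intros m; destruct (Z_le_gt_dec (up X) m) as [L | L].
- apply Rle_trans with (1 := Rmin_l _ _); apply IZR_le in L.
  rewrite Rabs_left1; lra.
- apply Rle_trans with (1 := Rmin_r _ _).
  assert (L' : (m <= up X - 1)%Z) by lia; apply IZR_le in L'; rewrite minus_IZR in L'.
  rewrite Rabs_pos_eq; lra.
Qed.

Section RectangularWp.

Variables a b : R.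
Hypotheses (Ha : 0 < a) (Hb : 0 < b).

Let w1 : C := RtoC a.
Let w2 : C := (Ci * RtoC b)%C.

Lemma lattice_pt_coords (m n : Z) : lattice_pt w1 w2 m n = (IZR m * a, IZR n * b).
Proof.
unfold lattice_pt, w1, w2, Cmult, Cplus, Ci, RtoC; simpl; f_equal; ring.
Qed.

Lemma in_lattice_rect (z : C) : in_lattice w1 w2 z <-> rect_lattice a b z.
Proof.
split; intros [m [n E]]; exists m, n; rewrite E, lattice_pt_coords || rewrite E, <- lattice_pt_coords;
  reflexivity.
Qed.

Lemma lattice_distance (z : C) : ~ rect_lattice a b z -> exists d : R, 0 < d /\
  forall m n : Z, d * (1 + IZR (Z.abs m) + IZR (Z.abs n)) <= Cmod (z - lattice_pt w1 w2 m n).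
Proof.
intros Hz; set (X := Re z / a); set (Y := Im z / b).
assert (EX : Re z = X * a) by (unfold X; field; lra).
assert (EY : Im z = Y * b) by (unfold Y; field; lra).
assert (H0 : exists d0, 0 < d0 /\ forall m n, d0 <= Rmax (Rabs (X - IZR m)) (Rabs (Y - IZR n))).
{ destruct (classic (exists m, X = IZR m)) as [[m0 Hm0] | HX].
  - destruct (distance_to_integers Y) as [d0 [Hd0 H]].
    { intros n Hn; apply Hz; exists m0, n; rewrite <- Hm0, <- Hn, <- EX, <- EY; now destruct z. }
    exists d0; split; [exact Hd0 |]; intros m n; apply Rle_trans with (1 := H n), Rmax_r.
  - destruct (distance_to_integers X) as [d0 [Hd0 H]].
    { intros m Hm; apply HX; now exists m. }
    exists d0; split; [exact Hd0 |]; intros m n; apply Rle_trans with (1 := H m), Rmax_l. }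
destruct H0 as [d0 [Hd0 H0]].
set (c := Rmin a b); assert (Hc : 0 < c) by now apply Rmin_pos.
set (S := 1 + Rabs X + Rabs Y).
assert (HS : 1 <= S) by (assert (T1 := Rabs_pos X); assert (T2 := Rabs_pos Y); unfold S; lra).
assert (HSd : 0 < S / d0) by (apply Rdiv_lt_0_compat; lra).
(* With [mx] the larger of the two coordinate distances, [1 + |m| + |n|] is at most [S + 2 * mx],
   and [mx >= d0] bounds [S] by [S / d0 * mx]. Passing from lattice coordinates to lengths costs the
   factor [c]. *)
exists (c / (S / d0 + 2)); split; [apply Rdiv_lt_0_compat; lra |].
intros m n; specialize (H0 m n); set (mx := Rmax (Rabs (X - IZR m)) (Rabs (Y - IZR n))) in *.
assert (M1 : Rabs (X - IZR m) <= mx) by apply Rmax_l.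
assert (M2 : Rabs (Y - IZR n) <= mx) by apply Rmax_r.
apply Rle_trans with (c * mx).
- rewrite !abs_IZR.
  assert (T1 : Rabs (IZR m) <= Rabs X + mx).
  { replace (IZR m) with (X - (X - IZR m)) by ring.
    apply Rle_trans with (1 := Rabs_triang _ _); rewrite Rabs_Ropp; lra. }
  assert (T2 : Rabs (IZR n) <= Rabs Y + mx).
  { replace (IZR n) with (Y - (Y - IZR n)) by ring.
    apply Rle_trans with (1 := Rabs_triang _ _); rewrite Rabs_Ropp; lra. }
  assert (T3 : S <= S / d0 * mx).
  { replace S with (S / d0 * d0) at 1 by (field; lra); apply Rmult_le_compat_l; lra. }
  replace (c * mx) with (c / (S / d0 + 2) * ((S / d0 + 2) * mx)) by (field; split; nra).
  apply Rmult_le_compat_l; [apply Rle_mult_inv_pos; lra | unfold S in *; lra].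
- apply Rle_trans with (2 := Rmax_Cmod _); rewrite lattice_pt_coords; simpl.
  fold (Re z) (Im z); rewrite EX, EY.
  replace (X * a + - (IZR m * a)) with ((X - IZR m) * a) by ring.
  replace (Y * b + - (IZR n * b)) with ((Y - IZR n) * b) by ring.
  rewrite !Rabs_mult, (Rabs_pos_eq a), (Rabs_pos_eq b) by lra.
  assert (C1 : c <= a) by apply Rmin_l; assert (C2 : c <= b) by apply Rmin_r.
  assert (T1 := Rabs_pos (X - IZR m)); assert (T2 := Rabs_pos (Y - IZR n)).
  unfold mx at 1, Rmax at 1; destruct (Rle_dec _ _).
  + apply Rle_trans with (2 := Rmax_r _ _); nra.
  + apply Rle_trans with (2 := Rmax_l _ _); nra.
Qed.

Lemma wp_square_sum_zsum (z : C) (N : nat) :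
  wp_square_sum w1 w2 z N = zsum (fun m => zsum (fun n => wp_term w1 w2 z m n) N) N.
Proof. reflexivity. Qed.

(** For a lattice point [l] other than 0 the term equals [z (2 l - z) / ((z - l) ^ 2 l ^ 2)]. With
    [X = 1 + |m| + |n|] the numerator is of order [X] and each squared factor below of order
    [X ^ 2], which leaves [1 / X ^ 3]. *)
Lemma wp_square_sum_bounded (z : C) :
  ~ rect_lattice a b z -> exists M : R, forall N : nat, Cmod (wp_square_sum w1 w2 z N) <= M.
Proof.
intros Hz; destruct (lattice_distance z Hz) as [d [Hd H]].
set (c := Rmin a b); assert (Hc : 0 < c) by now apply Rmin_pos.
assert (C1 : c <= a) by apply Rmin_l; assert (C2 : c <= b) by apply Rmin_r.
assert (Hz0 := Cmod_ge_0 z).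
set (K := Cmod z * (2 * (a + b) + Cmod z) / (d ^ 2 * (c ^ 2 / 16))).
assert (Hden : 0 < d ^ 2 * (c ^ 2 / 16)).
{ apply Rmult_lt_0_compat; [apply pow_lt, Hd |].
  apply Rdiv_lt_0_compat; [apply pow_lt, Hc | lra]. }
assert (HK : 0 <= K).
{ unfold K; apply Rle_mult_inv_pos; [| exact Hden]; apply Rmult_le_pos; lra. }
exists (16 * K); intros N; rewrite wp_square_sum_zsum; apply zsum_zsum_bound; [exact HK |].
intros m n; set (X := 1 + IZR (Z.abs m) + IZR (Z.abs n)).
assert (Hm0 : 0 <= IZR (Z.abs m)) by (apply IZR_le, Z.abs_nonneg).
assert (Hn0 : 0 <= IZR (Z.abs n)) by (apply IZR_le, Z.abs_nonneg).
assert (HX : 1 <= X) by (unfold X; lra).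
assert (HX3 : 0 < X ^ 3) by (apply pow_lt; lra).
unfold wp_term; destruct (Z.eqb_spec m 0) as [Em | Em], (Z.eqb_spec n 0) as [En | En]; simpl.
1: { rewrite Cmod_0; apply Rmult_le_pos; [exact HK | apply Rlt_le, Rinv_0_lt_compat, HX3]. }
all: set (l := lattice_pt w1 w2 m n).
all: assert (HX2 : 2 <= X) by
  (assert (T : (1 <= Z.abs m + Z.abs n)%Z) by lia; apply IZR_le in T; rewrite plus_IZR in T;
    unfold X; lra).
all: assert (Hl : Cmod l <= (a + b) * X) by
  (unfold l; rewrite lattice_pt_coords; apply Rle_trans with (1 := Cmod_le_re_im _);
   unfold Re, Im; simpl; rewrite !Rabs_mult, (Rabs_pos_eq a), (Rabs_pos_eq b), <- !abs_IZR by lra;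
   unfold X; nra).
(* [|l|] is at least half of [c * (|m| + |n|) = c * (X - 1)], and [X >= 2] away from the origin
   gives [X - 1 >= X / 2]. *)
all: assert (Hl' : c * X / 4 <= Cmod l) by
  (assert (T1 := re_le_Cmod l); assert (T2 := Cmod_im_le l);
   unfold l in T1 at 1, T2 at 1; rewrite lattice_pt_coords in T1, T2; unfold Re, Im in T1, T2;
     simpl in T1, T2;
   rewrite Rabs_mult, (Rabs_pos_eq a), <- abs_IZR in T1 by lra;
   rewrite Rabs_mult, (Rabs_pos_eq b), <- abs_IZR in T2 by lra;
   assert (IZR (Z.abs m) * c <= IZR (Z.abs m) * a) by (apply Rmult_le_compat_l; lra);
   assert (IZR (Z.abs n) * c <= IZR (Z.abs n) * b) by (apply Rmult_le_compat_l; lra);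
   assert (c * X <= 2 * (c * (X - 1))) by nra;
   replace (X - 1) with (IZR (Z.abs m) + IZR (Z.abs n)) in * by (unfold X; ring); lra).
all: assert (Hzl := H m n); fold X l in Hzl.
all: assert (Hcx : 0 < c * X / 4) by (assert (0 < c * X) by (apply Rmult_lt_0_compat; lra); lra).
all: assert (Hdx : 0 < d * X) by (apply Rmult_lt_0_compat; lra).
all: assert (nz1 : (z - l)%C <> 0) by (apply Cmod_neq_0; lra).
all: assert (nz2 : l <> 0) by (apply Cmod_neq_0; lra).
all: replace (/ ((z - l) * ((z - l) * 1)) - / (l * (l * 1)))%C
  with (z * (2 * l - z) / (((z - l) * (z - l)) * (l * l)))%C by (field; split; assumption).
all: rewrite Cmod_div by (repeat apply Cmult_neq_0; assumption); rewrite !Cmod_mult.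
all: apply Rle_trans with (Cmod z * ((2 * (a + b) + Cmod z) * X) /
   (((d * X) * (d * X)) * ((c * X / 4) * (c * X / 4)))).
all: try (unfold K; right; field; lra).
all: apply Rmult_le_compat;
  [apply Rmult_le_pos; apply Cmod_ge_0
  | apply Rlt_le, Rinv_0_lt_compat; repeat apply Rmult_lt_0_compat; lra
  | apply Rmult_le_compat_l; [exact Hz0 |];
    apply Rle_trans with (1 := Cmod_triangle_minus _ _); rewrite Cmod_mult, Cmod_R,
      Rabs_pos_eq by lra; nra
  | apply Rinv_le_contravar; [repeat apply Rmult_lt_0_compat; lra |]].
all: apply Rmult_le_compat; [apply Rmult_le_pos; lra | apply Rmult_le_pos; lra
  | apply Rmult_le_compat; lra | apply Rmult_le_compat; lra].
Qed.

Lemma wp_eq_of_limit (z z' : C) :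
  ~ rect_lattice a b z ->
  (forall eps : R, 0 < eps -> exists N0 : nat, forall N : nat, (N0 <= N)%nat ->
     Cmod (/ z' ^ 2 + wp_square_sum w1 w2 z' N - (/ z ^ 2 + wp_square_sum w1 w2 z N)) < eps) ->
  wp w1 w2 z' = wp w1 w2 z.
Proof.
intros Hz H; destruct (wp_square_sum_bounded z Hz) as [M HM].
assert (HR : real (Lim_seq (fun N => Re (wp_square_sum w1 w2 z' N))) =
  real (Lim_seq (fun N => Re (wp_square_sum w1 w2 z N))) + (Re (/ z ^ 2)%C - Re (/ z' ^ 2)%C)).
{ apply (Lim_seq_shift _ _ M); [intros n; apply Rle_trans with (1 := re_le_Cmod _), HM |].
  apply is_lim_seq_spec; intros eps; destruct (H eps (cond_pos eps)) as [N0 HN0].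
  exists N0; intros N HN; apply Rle_lt_trans with (2 := HN0 N HN).
  apply Rle_trans with (2 := re_le_Cmod _); right; f_equal.
  unfold Re, Cminus, Cplus, Copp; simpl fst; ring. }
assert (HI : real (Lim_seq (fun N => Im (wp_square_sum w1 w2 z' N))) =
  real (Lim_seq (fun N => Im (wp_square_sum w1 w2 z N))) + (Im (/ z ^ 2)%C - Im (/ z' ^ 2)%C)).
{ apply (Lim_seq_shift _ _ M); [intros n; apply Rle_trans with (1 := Cmod_im_le _), HM |].
  apply is_lim_seq_spec; intros eps; destruct (H eps (cond_pos eps)) as [N0 HN0].
  exists N0; intros N HN; apply Rle_lt_trans with (2 := HN0 N HN).
  apply Rle_trans with (2 := Cmod_im_le _); right; f_equal.
  unfold Im, Cminus, Cplus, Copp; simpl snd; ring. }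
unfold wp; rewrite HR, HI; unfold Cplus, Re, Im; simpl fst; simpl snd; f_equal; ring.
Qed.

Definition pole_term (z : C) (m n : Z) : C := (/ (z - lattice_pt w1 w2 m n) ^ 2)%C.

(** In the difference the corrections [1 / l ^ 2] cancel, and [1 / z ^ 2] fills the gap at the
    origin. The remaining terms depend on [z - l] alone, so translating [z] by a period translates
    the index. *)
Lemma wp_square_sum_diff (z z' : C) (N : nat) :
  (/ z' ^ 2 + wp_square_sum w1 w2 z' N - (/ z ^ 2 + wp_square_sum w1 w2 z N))%C =
  zsum (fun m => zsum (fun n => pole_term z' m n - pole_term z m n)%C N) N.
Proof.
set (v := (/ z' ^ 2 - / z ^ 2)%C).
rewrite !wp_square_sum_zsum.
assert (E : (zsum (fun m => zsum (fun n => pole_term z' m n - pole_term z m n) N) N -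
  zsum (fun m => zsum (fun n => wp_term w1 w2 z' m n - wp_term w1 w2 z m n) N) N)%C = v).
{ rewrite <- zsum_minus, <- (zsum_delta v N); apply zsum_ext; intros m.
  rewrite <- zsum_minus.
  destruct (Z.eqb_spec m 0) as [Em | Em].
  - rewrite <- (zsum_delta v N); apply zsum_ext; intros n.
    unfold wp_term, pole_term; destruct (Z.eqb_spec n 0) as [En | En]; subst m.
    + subst n; rewrite lattice_pt_coords, !Rmult_0_l; simpl Z.eqb; simpl andb; cbv iota.
      unfold v; replace ((0, 0) : C) with (RtoC 0) by reflexivity.
      replace (z' - 0)%C with z' by ring; replace (z - 0)%C with z by ring; ring.
    + simpl Z.eqb; simpl andb; cbv iota; ring.
  - rewrite <- (zsum_delta 0 N); apply zsum_ext; intros n.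
    unfold wp_term, pole_term; destruct (Z.eqb_spec m 0) as [|_]; [contradiction |].
    simpl andb; cbv iota; destruct (Z.eqb n 0); ring. }
assert (E2 : zsum (fun m => zsum (fun n => wp_term w1 w2 z' m n - wp_term w1 w2 z m n)%C N) N =
  (zsum (fun m => zsum (fun n => wp_term w1 w2 z' m n) N) N -
   zsum (fun m => zsum (fun n => wp_term w1 w2 z m n) N) N)%C).
{ rewrite <- zsum_minus; apply zsum_ext; intros m; apply zsum_minus. }
rewrite E2 in E.
match type of E with (?A - (?B - ?D))%C = _ => replace A with (v + (B - D))%C by (rewrite <- E;
  ring) end.
unfold v; ring.
Qed.

(** The square of indices is symmetric under [(m, n) -> (- m, - n)], so the partial sums at [z] and
    [- z] coincide. *)
Lemma wp_opp (z : C) : ~ rect_lattice a b z -> wp w1 w2 (- z) = wp w1 w2 z.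
Proof.
intros Hz; apply wp_eq_of_limit; [exact Hz |].
intros eps Heps; exists O; intros N _.
assert (E : wp_square_sum w1 w2 (- z) N = wp_square_sum w1 w2 z N).
{ rewrite !wp_square_sum_zsum.
  rewrite <- (zsum_opp_index (fun m => zsum (fun n => wp_term w1 w2 z m n) N)); apply zsum_ext;
    intros m.
  rewrite <- (zsum_opp_index (fun n => wp_term w1 w2 z (- m) n)); apply zsum_ext; intros n.
  unfold wp_term.
  replace (Z.eqb (- m) 0) with (Z.eqb m 0) by (destruct (Z.eqb_spec m 0), (Z.eqb_spec (- m) 0);
    lia || reflexivity).
  replace (Z.eqb (- n) 0) with (Z.eqb n 0) by (destruct (Z.eqb_spec n 0), (Z.eqb_spec (- n) 0);
    lia || reflexivity).
  destruct (Z.eqb m 0 && Z.eqb n 0)%bool; [reflexivity |].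
  replace (lattice_pt w1 w2 (- m) (- n)) with (- lattice_pt w1 w2 m n)%C.
  - set (l := lattice_pt w1 w2 m n).
    replace ((- z - l) ^ 2)%C with ((z - - l) ^ 2)%C by ring.
    replace ((- l) ^ 2)%C with (l ^ 2)%C by ring; reflexivity.
  - unfold lattice_pt; rewrite !opp_IZR, !RtoC_opp; ring. }
rewrite E.
replace (/ (- z) ^ 2 + wp_square_sum w1 w2 z N - (/ z ^ 2 + wp_square_sum w1 w2 z N))%C
  with (RtoC 0) by (replace ((- z) ^ 2)%C with (z ^ 2)%C by ring; ring).
now rewrite Cmod_0.
Qed.

(** An edge of the square has [2 N + 1] terms of order [1 / N ^ 2]; the factor 2 stands for the two
    edges left over by a shift. *)
Lemma boundary_small (d eps : R) : 0 < d -> 0 < eps -> exists N0 : nat, forall N : nat, (N0 <= N)%nat ->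
  2 * ((2 * INR N + 1) * / (d * (1 + INR N)) ^ 2) < eps.
Proof.
intros Hd Heps.
destruct (nfloor_ex (4 / (d ^ 2 * eps) + 1)) as [N0 [_ HN0]].
{ assert (0 < 4 / (d ^ 2 * eps)) by (apply Rdiv_lt_0_compat; [lra | apply Rmult_lt_0_compat;
  [apply pow_lt |]; lra]); lra. }
exists N0; intros N HN; apply le_INR in HN.
assert (Hd2 : 0 < d ^ 2) by (apply pow_lt, Hd).
assert (HD : 0 < d ^ 2 * eps) by (apply Rmult_lt_0_compat; lra).
assert (T : 4 / (d ^ 2 * eps) < INR N) by lra.
apply Rlt_div_l in T; [| exact HD].
assert (P := pos_INR N).
apply Rle_lt_trans with (4 * (1 + INR N) * / (d * (1 + INR N)) ^ 2).
- rewrite <- Rmult_assoc; apply Rmult_le_compat_r; [| lra].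
  apply Rlt_le, Rinv_0_lt_compat, pow_lt, Rmult_lt_0_compat; lra.
- replace (4 * (1 + INR N) * / (d * (1 + INR N)) ^ 2) with (4 / (d ^ 2 * (1 + INR N))) by (field; lra).
  apply Rlt_div_l; [apply Rlt_gt, Rmult_lt_0_compat; lra | nra].
Qed.

Lemma pole_term_bound (z : C) (d : R) (m n : Z) (X : R) :
  0 < d -> 0 < X -> X <= 1 + IZR (Z.abs m) + IZR (Z.abs n) ->
  (forall m n : Z, d * (1 + IZR (Z.abs m) + IZR (Z.abs n)) <= Cmod (z - lattice_pt w1 w2 m n)) ->
  Cmod (pole_term z m n) <= / (d * X) ^ 2.
Proof.
intros Hd HX HX1 H; specialize (H m n).
assert (H0 : 0 < d * X) by (apply Rmult_lt_0_compat; lra).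
assert (H1 : d * X <= Cmod (z - lattice_pt w1 w2 m n)).
{ apply Rle_trans with (2 := H), Rmult_le_compat_l; lra. }
unfold pole_term; rewrite Cmod_inv by (apply Cpow_nz, Cmod_neq_0; lra).
rewrite Cmod_pow; apply Rinv_le_contravar; [apply pow_lt, H0 | apply pow_incr; lra].
Qed.

(* Shifting the square by one period changes the sum only along two of its edges. *)
Lemma wp_periodic_1 (z : C) : ~ rect_lattice a b z -> wp w1 w2 (z + w1) = wp w1 w2 z.
Proof.
intros Hz; apply wp_eq_of_limit; [exact Hz |].
destruct (lattice_distance z Hz) as [d [Hd H]].
intros eps Heps; destruct (boundary_small d eps Hd Heps) as [N0 HN0].
exists N0; intros N HN; apply Rle_lt_trans with (2 := HN0 N HN).
rewrite wp_square_sum_diff.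
rewrite (zsum_telescope _ (fun m => zsum (fun n => pole_term z m n) N)).
- apply Rle_trans with (1 := Cmod_triangle_minus _ _).
  assert (P := pos_INR N).
  match goal with |- _ <= 2 * ?B => assert (T : forall m, (m = - Z.of_nat N - 1 \/ m = Z.of_nat N)%Z ->
    Cmod (zsum (fun n => pole_term z m n) N) <= B) end.
  { intros m Hm; apply zsum_le_const; intros n.
    apply pole_term_bound; try assumption; [lra |].
    assert (0 <= IZR (Z.abs n)) by (apply IZR_le, Z.abs_nonneg).
    assert (INR N <= IZR (Z.abs m)) by (rewrite INR_IZR_INZ; apply IZR_le; lia); lra. }
  assert (T1 := T (- Z.of_nat N - 1)%Z ltac:(now left));
    assert (T2 := T (Z.of_nat N) ltac:(now right)); lra.
- intros m; rewrite <- zsum_minus; apply zsum_ext; intros n; unfold pole_term; do 3 f_equal.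
  unfold lattice_pt; rewrite minus_IZR, RtoC_minus; ring.
Qed.

Lemma wp_periodic_2 (z : C) : ~ rect_lattice a b z -> wp w1 w2 (z + w2) = wp w1 w2 z.
Proof.
intros Hz; apply wp_eq_of_limit; [exact Hz |].
destruct (lattice_distance z Hz) as [d [Hd H]].
intros eps Heps; destruct (boundary_small d eps Hd Heps) as [N0 HN0].
exists N0; intros N HN; apply Rle_lt_trans with (2 := HN0 N HN).
rewrite wp_square_sum_diff.
rewrite (zsum_ext _ (fun m => pole_term z m (- Z.of_nat N - 1) - pole_term z m (Z.of_nat N))%C).
- rewrite zsum_minus; apply Rle_trans with (1 := Cmod_triangle_minus _ _).
  assert (P := pos_INR N).
  match goal with |- _ <= 2 * ?B => assert (T : forall n, (n = - Z.of_nat N - 1 \/ n = Z.of_nat N)%Z ->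
    Cmod (zsum (fun m => pole_term z m n) N) <= B) end.
  { intros n Hn; apply zsum_le_const; intros m.
    apply pole_term_bound; try assumption; [lra |].
    assert (0 <= IZR (Z.abs m)) by (apply IZR_le, Z.abs_nonneg).
    assert (INR N <= IZR (Z.abs n)) by (rewrite INR_IZR_INZ; apply IZR_le; lia); lra. }
  assert (T1 := T (- Z.of_nat N - 1)%Z ltac:(now left));
    assert (T2 := T (Z.of_nat N) ltac:(now right)); lra.
- intros m; apply zsum_telescope; intros n; unfold pole_term; do 3 f_equal.
  unfold lattice_pt; rewrite minus_IZR, RtoC_minus; ring.
Qed.

End RectangularWp.

(** * Identification of wp *)

Lemma locally_bounded_on_rect (G : C -> C) (P : C -> Prop) (x0 x1 y0 y1 : R) :
  (forall z : C, in_rect x0 x1 y0 y1 z -> exists r M : R, 0 < r /\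
     forall w : C, Cmod (w - z) < r -> P w -> Cmod (G w) <= M) ->
  exists M : R, forall w : C, in_rect x0 x1 y0 y1 w -> P w -> Cmod (G w) <= M.
Proof.
intros H.
(* A gauge below 1/M turns the positive lower bound for the gauge given by compactness
   into a bound for M. *)
destruct (functional_choice (fun (z : R * R) (d : posreal) => in_rect x0 x1 y0 y1 z ->
  forall w : C, Rabs (Re w - fst z) < d -> Rabs (Im w - snd z) < d -> P w -> Cmod (G w) <= / d))
  as [delta Hdelta].
{ intros z; destruct (classic (in_rect x0 x1 y0 y1 z)) as [Hz | Hz].
  - destruct (H z Hz) as [r [M [Hr HM]]].
    assert (Hp : 0 < Rmin (r / 2) (/ (Rabs M + 1))).
    { assert (T := Rabs_pos M); apply Rmin_pos; [lra | apply Rinv_0_lt_compat; lra]. }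
    exists (mkposreal _ Hp); simpl; intros _ w W1 W2 Pw.
    assert (T := Rabs_pos M); assert (L1 := Rmin_l (r / 2) (/ (Rabs M + 1))).
    assert (L2 := Rmin_r (r / 2) (/ (Rabs M + 1))).
    apply Rle_trans with M.
    + apply HM; [| exact Pw]; apply Rle_lt_trans with (1 := Cmod_le_re_im _).
      replace (Re (w - z)) with (Re w - fst z) by (destruct w, z; reflexivity).
      replace (Im (w - z)) with (Im w - snd z) by (destruct w, z; reflexivity). lra.
    + apply Rle_trans with (1 := Rle_abs M).
      apply Rinv_le_contravar in L2; [rewrite Rinv_inv in L2; lra | exact Hp].
  - exists (mkposreal 1 Rlt_0_1); intros Hz'; contradiction. }
destruct (compactness_value_2d x0 x1 y0 y1 (fun u v => delta (u, v))) as [d Hd].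
exists (/ d); intros w [W1 W2] Pw.
(* [compactness_value_2d] yields only the double negation of the existence of a suitable gauge
   centre, hence the proof by contradiction. *)
apply NNPP; intros Hn; apply (Hd (Re w) (Im w) W1 W2).
intros [u [v [U [V [Du [Dv Dd]]]]]]; apply Hn.
apply Rle_trans with (/ delta (u, v)).
- apply (Hdelta (u, v)); try assumption; split; assumption.
- apply Rinv_le_contravar; [apply cond_pos | exact Dd].
Qed.

Lemma cdiffable_scale (f : C -> C) (c z : C) :
  cdiffable f (c * z) -> cdiffable (fun w => f (c * w)%C) z.
Proof.
intros [l Hl]; exists (l * c)%C; intros eps Heps;
assert (Hc := Cmod_ge_0 c); set (K := Cmod c + 1).
assert (HK : 0 < K) by (unfold K; lra).
destruct (cderiv_error f _ l Hl (eps / K)) as [d [Hd H]]; [apply Rdiv_lt_0_compat; lra |].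
exists (d / K); split; [apply Rdiv_lt_0_compat; lra | intros w Hw].
apply Rlt_div_r in Hw; [| exact HK].
assert (Hh := Cmod_ge_0 (w - z)).
assert (Ec : Cmod (c * w - c * z) <= K * Cmod (w - z)).
{ replace (c * w - c * z)%C with (c * (w - z))%C by ring; rewrite Cmod_mult.
  apply Rmult_le_compat_r; unfold K; lra. }
rewrite Cre_im; replace (l * c * (w - z))%C with (l * (c * w - c * z))%C by ring.
apply Rle_trans with (1 := H (c * w)%C ltac:(lra)).
apply Rle_trans with (eps / K * (K * Cmod (w - z))).
- apply Rmult_le_compat_l; [apply Rlt_le, Rdiv_lt_0_compat; lra | exact Ec].
- right; field; lra.
Qed.

Lemma nearest_integer (X : R) : exists m : Z, - / 2 <= X - IZR m <= / 2.
Proof. exists (up (X - / 2)); destruct (archimed (X - / 2)); lra. Qed.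

Lemma periodic_Z (F : C -> C) (P : C -> Prop) (w : C) :
  (forall z, P z -> P (z + w)%C /\ P (z - w)%C /\ F (z + w)%C = F z) ->
  forall (m : Z) (z : C), P z -> P (z + RtoC (IZR m) * w)%C /\ F (z + RtoC (IZR m) * w)%C = F z.
Proof.
intros H m z Hz.
induction m as [| m IH | m IH] using Z.peano_ind.
- replace (z + RtoC 0 * w)%C with z by ring; now split.
- destruct IH as [I1 I2]; destruct (H _ I1) as [J1 [J2 J3]].
  rewrite <- Z.add_1_r, plus_IZR, RtoC_plus.
  replace (z + (RtoC (IZR m) + 1) * w)%C with (z + RtoC (IZR m) * w + w)%C by ring.
  split; [exact J1 | now rewrite J3].
- destruct IH as [I1 I2]; destruct (H _ I1) as [J1 [J2 J3]].
  rewrite <- Z.sub_1_r, minus_IZR, RtoC_minus.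
  replace (z + (RtoC (IZR m) - 1) * w)%C with (z + RtoC (IZR m) * w - w)%C by ring.
  split; [exact J2 |]; destruct (H _ J2) as [_ [_ K3]].
  rewrite <- K3, <- I2; f_equal; ring.
Qed.

Lemma rect_lattice_translate (a b : R) (z : C) (m n : Z) :
  rect_lattice a b (z + (IZR m * a, IZR n * b)%R)%C -> rect_lattice a b z.
Proof.
intros [p [q E]]; exists (p - m)%Z, (q - n)%Z; rewrite !minus_IZR.
destruct z as [x y]; injection E as E1 E2; f_equal; lra.
Qed.

Lemma rect_lattice_0 (a b : R) : rect_lattice a b 0.
Proof. exists 0%Z, 0%Z; unfold RtoC; f_equal; ring. Qed.

Lemma rect_lattice_small (a b : R) (z : C) : 0 < a -> 0 < b -> rect_lattice a b z ->
  Rabs (Re z) < a -> Rabs (Im z) < b -> z = 0.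
Proof.
intros Ha Hb [m [n ->]]; unfold Re, Im; simpl; intros H1 H2.
assert (Z0 : forall (c : R) (i : Z), 0 < c -> Rabs (IZR i * c) < c -> i = 0%Z).
{ intros c i Hc H; apply Rabs_lt_between in H.
  assert (-1 < IZR i) by (apply Rmult_lt_reg_r with c; lra).
  assert (IZR i < 1) by (apply Rmult_lt_reg_r with c; lra).
  assert (-1 < i)%Z by now apply lt_IZR. assert (i < 1)%Z by now apply lt_IZR. lia. }
rewrite (Z0 a m Ha H1), (Z0 b n Hb H2); unfold RtoC; f_equal; ring.
Qed.

Section Identification.

Variable k : R.
Hypothesis Hk : 0 < k < 1.
Variables (f : C -> C) (e : C).

Let sigma : R := sqrt (k * kc k).
Let a : R := 2 * sigma * ellK k.
Let b : R := 2 * sigma * ellK (kc k).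
Let W (z : C) : C := wp (omega1 k) (omega2 k) z.

Hypothesis Hf : forall z, ~ rect_lattice a b z -> holomorphic_at f z /\ (f z ^ 2)%C = (W z - e)%C.
Hypothesis Hpole : simple_pole_with_residue f 0 1.

Lemma sigma_pos : 0 < sigma.
Proof. apply sqrt_lt_R0; destruct (kc_bounds k Hk); apply Rmult_lt_0_compat; lra. Qed.

Lemma period_pos : 0 < a /\ 0 < b.
Proof.
assert (Hs := sigma_pos); assert (H1 := ellK_pos k Hk); assert (H2 := ellK_pos _ (kc_bounds k Hk)).
split; repeat apply Rmult_lt_0_compat; lra.
Qed.

Definition scaled_ns (z : C) : C := (RtoC (/ sigma) * nsC k (RtoC (/ sigma) * z))%C.

Lemma rect_lattice_scale (z : C) :
  rect_lattice (2 * ellK k) (2 * ellK (kc k)) (RtoC (/ sigma) * z)%C -> rect_lattice a b z.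
Proof.
assert (Hs := sigma_pos).
intros [m [n E]]; exists m, n.
replace z with (RtoC sigma * (RtoC (/ sigma) * z))%C.
- rewrite E; unfold a, b, Cmult, RtoC; simpl; f_equal; ring.
- rewrite RtoC_inv by lra; field; apply RtoC_neq_0; lra.
Qed.

Lemma cdiffable_scaled_ns (z : C) : ~ rect_lattice a b z -> cdiffable scaled_ns z.
Proof.
intros Hz; destruct (cdiffable_scale (nsC k) (RtoC (/ sigma)) z) as [l Hl].
- apply cdiffable_nsC; [exact Hk | intros H; now apply Hz, rect_lattice_scale].
- eexists; apply cderiv_mult; [apply cderiv_const | exact Hl].
Qed.

Let G (z : C) : C := (W z - scaled_ns z * scaled_ns z)%C.

Lemma cdiffable_wp_minus_ns (z : C) : ~ rect_lattice a b z -> cdiffable G z.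
Proof.
intros Hz; destruct (cdiffable_scaled_ns z Hz) as [m Hm].
destruct (Hf z Hz) as [Hd _]; destruct (holomorphic_at_cderiv f z Hd) as [l Hl].
(* The identity [W = f ^ 2 + e] has to hold on a whole neighbourhood of [z], which the distance to
   the lattice provides. *)
assert (Hopen : exists r, 0 < r /\ forall w, Cmod (w - z) < r -> ~ rect_lattice a b w).
{ destruct period_pos as [Ha Hb]; destruct (lattice_distance a b Ha Hb z Hz) as [r [Hr H]].
  exists r; split; [exact Hr | intros w Hw [i [j E]]].
  specialize (H i j); rewrite lattice_pt_coords, <- E, Cmod_minus_sym in H.
  assert (0 <= IZR (Z.abs i)) by (apply IZR_le, Z.abs_nonneg).
  assert (0 <= IZR (Z.abs j)) by (apply IZR_le, Z.abs_nonneg). nra. }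
destruct Hopen as [r [Hr Hopen]].
exists (f z * l + f z * l + 0 - (scaled_ns z * m + scaled_ns z * m))%C.
refine (frechet_ext_loc (fun w => f w * f w + e - scaled_ns w * scaled_ns w)%C _ _ _ _ r Hr _ _).
- intros w Hw; unfold G; destruct (Hf w (Hopen w Hw)) as [_ E].
  replace (W w) with (f w ^ 2 + e)%C by (rewrite E; ring); ring.
- apply (cderiv_minus (fun w => f w * f w + e)%C (fun w => scaled_ns w * scaled_ns w)%C).
  + apply (cderiv_plus (fun w => f w * f w)%C (fun _ => e));
    [now apply cderiv_mult | apply cderiv_const].
  + now apply cderiv_mult.
Qed.

(** Along [omega1] the function [scaled_ns] changes sign; its square has both periods, as [wp]
    has. *)
Lemma wp_minus_ns_periodic (m n : Z) (z : C) :
  ~ rect_lattice a b z -> G (z + (IZR m * a, IZR n * b)%R)%C = G z.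
Proof.
intros Hz; destruct period_pos as [Ha Hb]; assert (Hs := sigma_pos).
set (P := fun z => ~ rect_lattice a b z).
assert (step : forall (w0 : C) (i j : Z), w0 = (IZR i * a, IZR j * b) ->
  (forall w, P w -> W (w + w0)%C = W w) ->
  (forall w, (scaled_ns (w + w0) * scaled_ns (w + w0) = scaled_ns w * scaled_ns w)%C) ->
  forall w, P w -> P (w + w0)%C /\ P (w - w0)%C /\ G (w + w0)%C = G w).
{ intros w0 i j -> HW Hns w Hw; split; [| split].
  - intros H; now apply Hw, (rect_lattice_translate a b w i j).
  - intros H; apply Hw, (rect_lattice_translate a b w (- i) (- j)); rewrite !opp_IZR.
    replace (w + (- IZR i * a, - IZR j * b)%R)%C with (w - (IZR i * a, IZR j * b)%R)%C; [exact H |].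
    unfold Cminus, Copp; simpl; do 2 f_equal; ring.
  - unfold G; now rewrite HW, Hns. }
assert (coords : forall w, (Re (RtoC (/ sigma) * w), Im (RtoC (/ sigma) * w)) = (RtoC (/ sigma) * w)%C)
  by (intros w; unfold Re, Im; now destruct (RtoC (/ sigma) * w)%C).
assert (Hm : forall w, P w -> P (w + omega1 k)%C /\ P (w - omega1 k)%C /\ G (w + omega1 k)%C = G w).
{ apply (step _ 1%Z 0%Z).
  - unfold omega1, RtoC; f_equal; unfold a, sigma; ring.
  - exact (wp_periodic_1 a b Ha Hb).
  - intros w; unfold scaled_ns.
    replace (RtoC (/ sigma) * (w + omega1 k))%C with
      ((Re (RtoC (/ sigma) * w) + 2 * ellK k, Im (RtoC (/ sigma) * w)) : C).
    + rewrite nsC_shift_re, coords by exact Hk; ring.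
    + unfold omega1, Cmult, Cplus, RtoC, Re, Im; simpl; fold sigma; f_equal; field; lra. }
assert (Hn : forall w, P w -> P (w + omega2 k)%C /\ P (w - omega2 k)%C /\ G (w + omega2 k)%C = G w).
{ apply (step _ 0%Z 1%Z).
  - unfold omega2, RtoC, Ci, Cmult; simpl; f_equal; unfold b, sigma; ring.
  - exact (wp_periodic_2 a b Ha Hb).
  - intros w; unfold scaled_ns.
    replace (RtoC (/ sigma) * (w + omega2 k))%C with
      ((Re (RtoC (/ sigma) * w), Im (RtoC (/ sigma) * w) + 2 * ellK (kc k)) : C).
    + now rewrite nsC_shift_im, coords by exact Hk.
    + unfold omega2, Ci, Cmult, Cplus, RtoC, Re, Im; simpl; fold sigma; f_equal; field; lra. }
destruct (periodic_Z G P (omega1 k) Hm m z Hz) as [Q1 Q2].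
destruct (periodic_Z G P (omega2 k) Hn n _ Q1) as [_ Q3].
rewrite <- Q2, <- Q3; f_equal.
rewrite <- Cplus_assoc; f_equal.
unfold omega1, omega2, Ci, Cmult, Cplus, RtoC; simpl; fold sigma; f_equal; unfold a, b; ring.
Qed.

Lemma near_0_not_lattice (z : C) : 0 < Cmod z -> Cmod z < Rmin a b -> ~ rect_lattice a b z.
Proof.
intros H0 H1 Hz; destruct period_pos as [Ha Hb].
assert (T1 := re_le_Cmod z); assert (T2 := Cmod_im_le z).
assert (T3 := Rmin_l a b); assert (T4 := Rmin_r a b).
assert (E := rect_lattice_small a b z Ha Hb Hz ltac:(lra) ltac:(lra)).
rewrite E, Cmod_0 in H0; lra.
Qed.

(* Evenness of wp forces the constant term of the root at its pole to vanish; otherwise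
   wp would have a 1/z term. *)
Lemma regular_part_vanishes : exists (r : R) (h : C -> C) (l : C), 0 < r /\ h 0 = 0 /\ cderiv h 0 l /\
  forall z : C, 0 < Cmod z < r -> f z = (/ z + h z)%C.
Proof.
destruct Hpole as [r [h [Hr [Hh Hfh]]]]; destruct period_pos as [Ha Hb].
assert (E0 : forall z : C, (z - 0)%C = z) by (intros z; ring).
destruct (holomorphic_at_cderiv h 0) as [l Hl]; [apply Hh; rewrite E0, Cmod_0; exact Hr |].
assert (Hz : forall z : C, 0 < Cmod z < r -> f z = (/ z + h z)%C).
{ intros z Hz; rewrite Hfh by (rewrite E0; exact Hz); rewrite E0; unfold Cdiv; ring. }
exists r, h, l; repeat split; try assumption.
apply Cmod_eq_0, Rle_antisym; [| apply Cmod_ge_0].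
apply le_epsilon; intros eps Heps; rewrite Rplus_0_l.
set (B := Cmod (h 0) + 1); assert (HB : 1 <= B) by (assert (T := Cmod_ge_0 (h 0)); unfold B; lra).
destruct (frechet_cont h 0 _ _ Hl (Rmin 1 (eps / 2))) as [d [Hd Hd1]]; [apply Rmin_pos; lra |].
(* Small enough for the continuity of [h], for the expansion of [f], for [z] and [- z] to be off the
   lattice, and for [2 * B ^ 2 * t <= eps]. *)
set (t := Rmin (Rmin (d / 2) (r / 2)) (Rmin (Rmin a b / 2) (eps / (2 * B ^ 2)))).
assert (HB2 : 0 < 2 * B ^ 2) by nra.
assert (Hab : 0 < Rmin a b) by now apply Rmin_pos.
assert (Ht : 0 < t) by (repeat apply Rmin_pos; try lra; apply Rdiv_lt_0_compat; lra).
assert (Ht1 : t <= d / 2) by Rmin_le.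
assert (Ht2 : t <= r / 2) by Rmin_le.
assert (Ht3 : t <= Rmin a b / 2) by Rmin_le.
assert (Ht4 : t <= eps / (2 * B ^ 2)) by Rmin_le.
set (z := RtoC t).
assert (Mz : Cmod z = t) by (unfold z; rewrite Cmod_R, Rabs_pos_eq; lra).
assert (Mz' : Cmod (- z) = t) by (rewrite Cmod_opp; exact Mz).
assert (Nz : z <> 0) by (apply Cmod_neq_0; lra).
assert (Nz' : (- z)%C <> 0) by (apply Cmod_neq_0; lra).
assert (L1 : ~ rect_lattice a b z) by (apply near_0_not_lattice; lra).
assert (L2 : ~ rect_lattice a b (- z)%C) by (apply near_0_not_lattice; lra).
destruct (Hf _ L1) as [_ F1]; destruct (Hf _ L2) as [_ F2].
assert (Ew : W (- z)%C = W z) by exact (wp_opp a b Ha Hb z L1).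
rewrite Ew, <- F1, !Hz in F2 by lra.
set (p := h z) in *; set (q := h (- z)%C) in *.
(* Equating the squares of [- 1 / z + q] and [1 / z + p] gives [2 / z * (p + q) = q ^ 2 - p ^ 2]. So
   [p + q], which tends to [2 * h 0], is of order [z]. *)
assert (Epq : (p + q = z / 2 * ((q - p) * (q + p)))%C).
{ assert (E : ((/ - z + q) ^ 2 - (/ z + p) ^ 2 = (q - p) * (q + p) - 2 / z * (p + q))%C)
    by (field; repeat split; assumption).
  rewrite F2 in E; apply Ceq_minus.
  replace (p + q - z / 2 * ((q - p) * (q + p)))%C with (- (z / 2) * ((q - p) * (q + p) - 2 / z * (p + q)))%C
    by (field; exact Nz).
  rewrite <- E; ring. }
assert (Hp : Cmod (p - h 0) < Rmin 1 (eps / 2)) by (apply Hd1; rewrite E0; lra).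
assert (Hq : Cmod (q - h 0) < Rmin 1 (eps / 2)) by (apply Hd1; rewrite E0; lra).
assert (M1 := Rmin_l 1 (eps / 2)); assert (M2 := Rmin_r 1 (eps / 2)).
assert (Bp : Cmod p <= B).
{ replace p with (p - h 0 + h 0)%C by ring; apply Rle_trans with (1 := Cmod_triangle _ _); unfold B;
  lra. }
assert (Bq : Cmod q <= B).
{ replace q with (q - h 0 + h 0)%C by ring; apply Rle_trans with (1 := Cmod_triangle _ _); unfold B;
  lra. }
assert (Bpq : Cmod (p + q) <= eps).
{ rewrite Epq, !Cmod_mult, Cmod_div, Mz, Cmod_R, (Rabs_pos_eq 2) by (lra || apply RtoC_neq_0; lra).
  assert (T1 := Cmod_triangle_minus q p); assert (T2 := Cmod_triangle q p).
  apply Rle_trans with (t / 2 * ((2 * B) * (2 * B))).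
  - apply Rmult_le_compat_l; [lra |]; apply Rmult_le_compat; try apply Cmod_ge_0; lra.
  - apply Rle_div_r in Ht4; [lra | exact HB2]. }
assert (T : Cmod (2 * h 0) <= 2 * eps).
{ replace (2 * h 0)%C with (p + q - (p - h 0) - (q - h 0))%C by ring.
  apply Rle_trans with (1 := Cmod_triangle_minus _ _).
  assert (T := Cmod_triangle_minus (p + q) (p - h 0)); lra. }
rewrite Cmod_mult, Cmod_R, Rabs_pos_eq in T; lra.
Qed.

(** In the expansion of [(1 / w + h w) ^ 2] the cross term [2 h w / w] is bounded because [h]
    vanishes at 0, and [1 / w ^ 2] cancels against the double pole of the square of [scaled_ns]. *)
Lemma wp_minus_ns_bounded_near_0 :
  exists r M : R, 0 < r /\ forall w : C, Cmod w < r -> ~ rect_lattice a b w -> Cmod (G w) <= M.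
Proof.
destruct regular_part_vanishes as [r0 [h [l [Hr0 [Hh0 [Hl Hz]]]]]].
destruct period_pos as [Ha Hb]; assert (Hs := sigma_pos).
destruct (frechet_lipschitz h 0 _ _ Hl) as [d [Hd HK]].
set (K := Cmod l + Cmod (Ci * l) + 1) in *.
assert (HK0 : 0 < K) by (assert (T1 := Cmod_ge_0 l); assert (T2 := Cmod_ge_0 (Ci * l)); unfold K; lra).
set (q := / sigma); assert (Hq : 0 < q) by now apply Rinv_0_lt_compat.
exists (Rmin (Rmin d r0) (Rmin 1 (sigma / 5))), (2 * K + K ^ 2 + Cmod e + q ^ 2 * 600).
split; [repeat apply Rmin_pos; lra |].
intros w Hw Hwl.
assert (W1 : Cmod w < d) by (apply Rlt_le_trans with (1 := Hw); Rmin_le).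
assert (W2 : Cmod w < r0) by (apply Rlt_le_trans with (1 := Hw); Rmin_le).
assert (W3 : Cmod w < 1) by (apply Rlt_le_trans with (1 := Hw); Rmin_le).
assert (W4 : Cmod w < sigma / 5) by (apply Rlt_le_trans with (1 := Hw); Rmin_le).
assert (Nw : w <> 0) by (intros E; apply Hwl; rewrite E; apply rect_lattice_0).
assert (Pw : 0 < Cmod w) by now apply Cmod_gt_0.
destruct (Hf w Hwl) as [_ F]; rewrite Hz in F by lra.
assert (Bh : Cmod (h w) <= K * Cmod w).
{ replace (h w) with (h w - h 0)%C by (rewrite Hh0; ring).
  replace (Cmod w) with (Cmod (w - 0)) by (f_equal; ring); apply HK.
  replace (w - 0)%C with w by ring; exact W1. }
set (u := (RtoC q * w)%C).
assert (Mu : Cmod u = q * Cmod w) by (unfold u; rewrite Cmod_mult, Cmod_R, Rabs_pos_eq; lra).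
assert (Hqs : q * sigma = 1) by (unfold q; field; lra).
assert (B2 := nsC_sq_near_pole k Hk u ltac:(rewrite Mu; nra) ltac:(rewrite Mu; nra)).
assert (Nq : RtoC q <> 0) by (apply RtoC_neq_0; lra).
assert (EG : G w = (2 * (h w / w) + h w * h w + e - RtoC q * RtoC q * (nsC k u * nsC k u - / (u * u)))%C).
{ unfold G; replace (W w) with ((/ w + h w) ^ 2 + e)%C by (rewrite F; ring).
  unfold scaled_ns; fold q; fold u.
  replace (/ (u * u))%C with (/ (w * w) / (RtoC q * RtoC q))%C by (unfold u; field; split; assumption).
  field; split; assumption. }
rewrite EG.
apply Rle_trans with (1 := Cmod_triangle_minus _ _).
apply Rplus_le_compat.
- apply Rle_trans with (1 := Cmod_triangle _ _), Rplus_le_compat_r.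
  apply Rle_trans with (1 := Cmod_triangle _ _), Rplus_le_compat.
  + rewrite Cmod_mult, Cmod_R, Rabs_pos_eq, Cmod_div by (lra || exact Nw).
    apply Rmult_le_compat_l; [lra | apply Rle_div_l; [exact Pw | exact Bh]].
  + rewrite Cmod_mult; replace (K ^ 2) with (K * K) by ring.
    apply Rmult_le_compat; try apply Cmod_ge_0; nra.
- rewrite !Cmod_mult, !Cmod_R, !(Rabs_pos_eq q) by lra.
  replace (q ^ 2) with (q * q) by ring; apply Rmult_le_compat_l; [nra | exact B2].
Qed.

Lemma wp_eq_ns_sq :
  exists c : C, forall z : C, ~ rect_lattice a b z -> W z = (c + scaled_ns z * scaled_ns z)%C.
Proof.
destruct period_pos as [Ha Hb].
destruct (locally_bounded_on_rect G (fun z => ~ rect_lattice a b z) (- (a / 2)) (a / 2) (- (b / 2))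
  (b / 2))
  as [M HM].
{ intros z [Z1 Z2]; destruct (classic (rect_lattice a b z)) as [Hz | Hz].
  - assert (E : z = 0) by (apply (rect_lattice_small a b z Ha Hb Hz); apply Rabs_lt_between; lra).
    destruct wp_minus_ns_bounded_near_0 as [r [M [Hr H]]]; exists r, M; split; [exact Hr |].
    intros w Hw; apply H; rewrite E in Hw; now replace (w - 0)%C with w in Hw by ring.
  - destruct (cdiffable_ccont G z (cdiffable_wp_minus_ns z Hz) 1 Rlt_0_1) as [r [Hr H]].
    exists r, (Cmod (G z) + 1); split; [exact Hr |]; intros w Hw _; specialize (H w Hw).
    assert (T := Cmod_triangle_inv (G w) (G z)); lra. }
exists (G (a / 2, b / 2)); intros z Hz.
rewrite <- (liouville_mod_lattice a b M G Ha Hb cdiffable_wp_minus_ns) with (w' := z); [unfold G;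
  ring | | exact Hz].
intros w Hw.
(* Translation by periods moves [w] into the compact cell centred at 0, where the bound [M] is
   known. *)
destruct (nearest_integer (Re w / a)) as [m Hm]; destruct (nearest_integer (Im w / b)) as [n Hn].
rewrite <- (wp_minus_ns_periodic (- m) (- n) w Hw); apply HM.
- destruct w as [x y]; unfold in_rect, Re, Im in *; simpl in *; rewrite !opp_IZR.
  assert (Ex : x = x / a * a) by (field; lra); assert (Ey : y = y / b * b) by (field; lra).
  set (X := x / a) in *; set (Y := y / b) in *; rewrite Ex, Ey; split; nra.
- intros H; now apply Hw, (rect_lattice_translate a b w (- m) (- n)).
Qed.

End Identification.

(** * Branches of a square root *)

Definition rderiv (F : R -> C) (t : R) (l : C) : Prop :=
  forall eps : R, 0 < eps -> exists d : R, 0 < d /\ forall s : R, Rabs (s - t) < d ->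
    Cmod (F s - F t - RtoC (s - t) * l) <= eps * Rabs (s - t).

Lemma rderiv_line (f : C -> C) (p v : C) (t : R) :
  v <> 0 -> cdiffable f (p + RtoC t * v)%C -> exists l : C, rderiv (fun s => f (p + RtoC s * v)%C) t l.
Proof.
intros Hv [l Hl]; exists (v * l)%C; intros eps Heps.
assert (Pv := proj1 (Cmod_gt_0 v) Hv).
destruct (cderiv_error _ _ _ Hl (eps / Cmod v)) as [d [Hd H]]; [apply Rdiv_lt_0_compat; lra |].
exists (d / Cmod v); split; [apply Rdiv_lt_0_compat; lra | intros s Hs].
apply Rlt_div_r in Hs; [| exact Pv].
assert (E : (p + RtoC s * v - (p + RtoC t * v) = RtoC (s - t) * v)%C) by (rewrite RtoC_minus; ring).
specialize (H (p + RtoC s * v)%C); rewrite E, Cmod_mult, Cmod_R in H.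
replace (RtoC (s - t) * (v * l))%C with (l * (RtoC (s - t) * v))%C by ring.
apply Rle_trans with (1 := H Hs); right; field; lra.
Qed.

Lemma rderiv_plus (F G : R -> C) (t : R) (l m : C) :
  rderiv F t l -> rderiv G t m -> rderiv (fun s => F s + G s)%C t (l + m).
Proof.
intros HF HG eps Heps.
destruct (HF (eps / 2)) as [d1 [Hd1 H1]]; [lra |]; destruct (HG (eps / 2)) as [d2 [Hd2 H2]]; [lra |].
exists (Rmin d1 d2); split; [now apply Rmin_pos | intros s Hs].
specialize (H1 s (Rlt_le_trans _ _ _ Hs (Rmin_l _ _))).
specialize (H2 s (Rlt_le_trans _ _ _ Hs (Rmin_r _ _))).
replace (F s + G s - (F t + G t) - RtoC (s - t) * (l + m))%C
  with ((F s - F t - RtoC (s - t) * l) + (G s - G t - RtoC (s - t) * m))%C by ring.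
apply Rle_trans with (1 := Cmod_triangle _ _); lra.
Qed.

Lemma rderiv_scal (c : C) (psi : R -> R) (t l : R) :
  is_derive psi t l -> rderiv (fun s => c * RtoC (psi s))%C t (c * RtoC l).
Proof.
intros H eps Heps; apply is_derive_Reals in H.
assert (Hc := Cmod_ge_0 c).
destruct (H (eps / (Cmod c + 1))) as [d Hd]; [apply Rdiv_lt_0_compat; lra |].
exists d; split; [apply cond_pos | intros s Hs].
destruct (Req_dec (s - t) 0) as [E | E].
- replace s with t by lra.
  replace (c * RtoC (psi t) - c * RtoC (psi t) - RtoC (t - t) * (c * RtoC l))%C with (RtoC 0)
    by (replace (t - t) with 0 by ring; ring).
  rewrite Cmod_0; apply Rmult_le_pos; [lra | apply Rabs_pos].
- specialize (Hd (s - t) E Hs); replace (t + (s - t)) with s in Hd by ring.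
  replace (c * RtoC (psi s) - c * RtoC (psi t) - RtoC (s - t) * (c * RtoC l))%C
    with (c * RtoC (((psi s - psi t) / (s - t) - l) * (s - t)))%C.
  + rewrite Cmod_mult, Cmod_R, Rabs_mult, <- Rmult_assoc.
    apply Rmult_le_compat_r; [apply Rabs_pos |].
    apply Rle_trans with (Cmod c * (eps / (Cmod c + 1))).
    * apply Rmult_le_compat_l; lra.
    * replace eps with ((Cmod c + 1) * (eps / (Cmod c + 1))) at 2 by (field; lra).
      apply Rmult_le_compat_r; [apply Rlt_le, Rdiv_lt_0_compat |]; lra.
  + replace (((psi s - psi t) / (s - t) - l) * (s - t)) with (psi s - psi t - l * (s - t))
    by (field; exact E).
    rewrite !RtoC_minus, RtoC_mult, RtoC_minus; ring.
Qed.

Lemma nonzero_punctured (F : R -> C) (t : R) (l : C) :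
  rderiv F t l -> F t <> 0 \/ l <> 0 ->
  exists d : R, 0 < d /\ forall s : R, s <> t -> Rabs (s - t) < d -> F s <> 0.
Proof.
intros HF Hor; destruct (classic (F t = 0)) as [E | E].
- destruct Hor as [H | H]; [contradiction |].
  assert (Pl := proj1 (Cmod_gt_0 l) H).
  destruct (HF (Cmod l / 2)) as [d [Hd H1]]; [lra |].
  exists d; split; [exact Hd | intros s Hst Hs E0]; specialize (H1 s Hs).
  rewrite E, E0 in H1.
  replace (0 - 0 - RtoC (s - t) * l)%C with (- (RtoC (s - t) * l))%C in H1 by ring.
  rewrite Cmod_opp, Cmod_mult, Cmod_R in H1.
  assert (0 < Rabs (s - t)) by (apply Rabs_pos_lt; lra); nra.
- assert (PF := proj1 (Cmod_gt_0 _) E); assert (Hl := Cmod_ge_0 l).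
  destruct (HF 1 Rlt_0_1) as [d [Hd H1]].
  set (m := Cmod (F t)) in *.
  exists (Rmin d (m / (Cmod l + 2))); split; [apply Rmin_pos; [lra | apply Rdiv_lt_0_compat; lra] |].
  intros s _ Hs E0; specialize (H1 s (Rlt_le_trans _ _ _ Hs (Rmin_l _ _))).
  assert (Hs2 := Rlt_le_trans _ _ _ Hs (Rmin_r _ _)); apply Rlt_div_r in Hs2; [| lra].
  rewrite E0 in H1.
  replace (0 - F t - RtoC (s - t) * l)%C with (- (F t) - RtoC (s - t) * l)%C in H1 by ring.
  assert (T := Cmod_triangle_inv (- F t) (RtoC (s - t) * l)).
  rewrite Cmod_opp, Cmod_mult, Cmod_R in T; fold m in T.
  assert (T2 := Rabs_pos (s - t)); nra.
Qed.

(** Connectedness of the line: the indicator function of [P] has derivative 0 everywhere. *)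
Lemma locally_constant_prop (P : R -> Prop) :
  (forall t : R, exists d : R, 0 < d /\ forall s : R, Rabs (s - t) < d -> (P s <-> P t)) ->
  forall s t : R, P s -> P t.
Proof.
intros H s t Hs.
set (f := fun t => if excluded_middle_informative (P t) then 1 else 0).
assert (Hf : forall x, is_derive f x 0).
{ intros x; destruct (H x) as [d [Hd Hx]].
  apply (is_derive_ext_loc (fun _ => f x)); [| apply (is_derive_const (V := R_NormedModule))].
  exists (mkposreal d Hd); intros y Hy; specialize (Hx y Hy); unfold f.
  destruct (excluded_middle_informative (P x)), (excluded_middle_informative (P y)); tauto. }
assert (E := derive_0_const f Hf s t); unfold f in E.
destruct (excluded_middle_informative (P s)), (excluded_middle_informative (P t)); tauto || lra.
Qed.

(* At a simple zero of [psi] the difference quotient of [F] keeps the two branches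
   [F = c psi] and [F = - c psi] apart. *)
Lemma square_root_branch (F : R -> C) (c : C) (psi psi' : R -> R) :
  c <> 0 -> (forall t, exists l, rderiv F t l) -> (forall t, is_derive psi t (psi' t)) ->
  (forall t, psi t = 0 -> psi' t <> 0) ->
  (forall t, F t * F t = (c * RtoC (psi t)) * (c * RtoC (psi t)))%C ->
  exists eps : R, eps * eps = 1 /\ forall t, F t = (RtoC eps * (c * RtoC (psi t)))%C.
Proof.
intros Hc HF Hpsi Hsimple Hsq.
set (D := fun t => (F t + - c * RtoC (psi t))%C); set (S := fun t => (F t + c * RtoC (psi t))%C).
assert (DS : forall t, D t = 0 \/ S t = 0).
{ intros t; destruct (classic (D t = 0)) as [E | E]; [now left | right].
  destruct (classic (S t = 0)) as [E' | E']; [exact E' | exfalso].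
  apply (Cmult_neq_0 _ _ E E'); unfold D, S.
  replace ((F t + - c * RtoC (psi t)) * (F t + c * RtoC (psi t)))%C
    with (F t * F t - (c * RtoC (psi t)) * (c * RtoC (psi t)))%C by ring.
  rewrite Hsq; ring. }
assert (N2 : RtoC 2 <> 0) by (apply RtoC_neq_0; lra).
assert (nz : forall t, (RtoC 2 * (c * RtoC (psi t)))%C <> 0 \/ (RtoC 2 * (c * RtoC (psi' t)))%C <> 0).
{ intros t; destruct (Req_dec (psi t) 0) as [E | E]; [right | left];
    repeat apply Cmult_neq_0; auto using RtoC_neq_0. }
set (Z := fun (A : R -> C) t => exists d, 0 < d /\ forall s, Rabs (s - t) < d -> A s = 0).
assert (Zsub : forall A t, Z A t -> exists d, 0 < d /\ forall s, Rabs (s - t) < d -> Z A s).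
{ intros A t [d [Hd H]]; exists (d / 2); split; [lra | intros s Hs].
  exists (d / 2); split; [lra | intros u Hu; apply H].
  replace (u - t) with ((u - s) + (s - t)) by ring; apply Rle_lt_trans with (1 := Rabs_triang _ _);
    lra. }
(* If [D] is non-zero on a punctured neighbourhood of [t], then [S] vanishes there and, by
   continuity, at [t]; the same holds with the roles exchanged. One case occurs, since
   [S - D = 2 c psi] and its derivative never vanish together. *)
assert (cover : forall t, Z D t \/ Z S t).
{ intros t; destruct (HF t) as [l Hl].
  assert (dD := rderiv_plus _ _ t _ _ Hl (rderiv_scal (- c)%C psi t _ (Hpsi t))); fold D in dD.
  assert (dS := rderiv_plus _ _ t _ _ Hl (rderiv_scal c psi t _ (Hpsi t))); fold S in dS.
  assert (key : forall (A B : R -> C) m n, rderiv A t m -> rderiv B t n ->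
    (forall s, A s = 0 \/ B s = 0) -> A t <> 0 \/ m <> 0 -> Z B t).
  { intros A B m n dA dB AB HA.
    destruct (nonzero_punctured A t m dA HA) as [r [Hr H1]].
    exists r; split; [exact Hr | intros s Hs].
    destruct (Req_dec s t) as [-> | Hne].
    - apply NNPP; intros HB; destruct (nonzero_punctured B t n dB (or_introl HB)) as [r' [Hr' H2]].
      set (x := t + Rmin r r' / 2).
      assert (Hm : 0 < Rmin r r') by now apply Rmin_pos.
      assert (L1 := Rmin_l r r'); assert (L2 := Rmin_r r r').
      assert (Hx : Rabs (x - t) < Rmin r r')
        by (unfold x; replace (t + Rmin r r' / 2 - t) with (Rmin r r' / 2) by ring;
          rewrite Rabs_pos_eq; lra).
      assert (Hxt : x <> t) by (unfold x; lra).
      destruct (AB x) as [E | E]; [apply (H1 x) | apply (H2 x)]; lra || assumption.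
    - destruct (AB s) as [E | E]; [now apply (H1 s) in E | exact E]. }
  destruct (classic (D t <> 0 \/ (l + - c * RtoC (psi' t))%C <> 0)) as [HD | HD].
  - right; apply (key D S _ _ dD dS DS HD).
  - left; apply (key S D _ _ dS dD); [intros s; destruct (DS s); tauto |].
    apply not_or_and in HD; destruct HD as [HD1 HD2]; apply NNPP in HD1; apply NNPP in HD2.
    destruct (nz t) as [N | N]; [left | right]; intros E; apply N.
    + replace (2 * (c * RtoC (psi t)))%C with (S t - D t)%C by (unfold S, D; ring).
      rewrite E, HD1; ring.
    + replace (2 * (c * RtoC (psi' t)))%C
        with ((l + c * RtoC (psi' t)) - (l + - c * RtoC (psi' t)))%C by ring.
      rewrite E, HD2; ring. }
assert (excl : forall t, Z D t -> Z S t -> False).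
{ intros t [d1 [Hd1 H1]] [d2 [Hd2 H2]].
  assert (dP := rderiv_scal (2 * c)%C psi t _ (Hpsi t)).
  destruct (nonzero_punctured _ t _ dP) as [d3 [Hd3 H3]].
  { destruct (nz t) as [N | N]; [left | right]; intros E; apply N; rewrite <- E; ring. }
  set (m := Rmin d1 (Rmin d2 d3)).
  assert (Hm : 0 < m) by (repeat apply Rmin_pos; assumption).
  assert (L1 : m <= d1) by apply Rmin_l.
  assert (L2 : m <= d2) by Rmin_le.
  assert (L3 : m <= d3) by Rmin_le.
  assert (Hx : Rabs (t + m / 2 - t) < m)
    by (replace (t + m / 2 - t) with (m / 2) by ring; rewrite Rabs_pos_eq; lra).
  set (x := t + m / 2) in *; apply (H3 x); [unfold x; lra | lra |].
  replace (2 * c * RtoC (psi x))%C with (S x - D x)%C by (unfold S, D; ring).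
  rewrite H1, H2 by lra; ring. }
(* Near each point exactly one of [D] and [S] vanishes identically, so which one it is cannot change
   along the line. *)
assert (const : forall s t, Z S s -> Z S t).
{ apply locally_constant_prop; intros t; destruct (cover t) as [H | H].
  - destruct (Zsub D t H) as [d [Hd H1]]; exists d; split; [exact Hd | intros s Hs].
    split; intros H2; exfalso; [apply (excl s) | apply (excl t)]; auto.
  - destruct (Zsub S t H) as [d [Hd H1]]; exists d; split; [exact Hd | intros s Hs].
    split; intros _; auto. }
assert (Zat : forall A t, Z A t -> A t = 0).
{ intros A t [d [Hd H]]; apply H; replace (t - t) with 0 by ring; now rewrite Rabs_R0. }
destruct (cover 0) as [H0 | H0].
- exists 1; split; [ring | intros t].
  destruct (cover t) as [H | H]; [| exfalso; apply (excl 0 H0), (const t 0 H)].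
  apply Zat in H; unfold D in H; apply Ceq_minus; rewrite <- H; ring.
- exists (Ropp 1); split; [ring | intros t].
  apply (const 0 t), Zat in H0; unfold S in H0; apply Ceq_minus; rewrite <- H0.
  rewrite RtoC_opp; ring.
Qed.

(** * Winding of the point (cd, k' sd) *)

Lemma sphere_south_pole (x1 x2 x3 : R) :
  sphere (x1, x2, x3) -> 1 + x3 = 0 -> (x1, x2, x3) = south_pole.
Proof.
unfold sphere, dot, south_pole; intros H E.
assert (E3 : x3 = -1) by lra; rewrite E3 in *.
destruct (Rplus_sqr_eq_0 x1 x2) as [-> ->]; [unfold Rsqr; lra | reflexivity].
Qed.

(** On the sphere the squared modulus of the projection is [(1 - x3) / (1 + x3)], which determines
    [x3] and then the other two coordinates. *)
Lemma stereo_inj (x y : R3) : sphere x -> sphere y -> x <> south_pole -> y <> south_pole ->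
  stereo x = stereo y -> x = y.
Proof.
destruct x as [[x1 x2] x3]; destruct y as [[y1 y2] y3]; intros Sx Sy Nx Ny E.
assert (Hx : 1 + x3 <> 0) by (intros H; now apply Nx, sphere_south_pole).
assert (Hy : 1 + y3 <> 0) by (intros H; now apply Ny, sphere_south_pole).
injection E as E1 E2; unfold sphere, dot in Sx, Sy.
set (p := x1 / (1 + x3)) in *; set (q := x2 / (1 + x3)) in *.
assert (X1 : x1 = p * (1 + x3)) by (unfold p; field; exact Hx).
assert (X2 : x2 = q * (1 + x3)) by (unfold q; field; exact Hx).
assert (Y1 : y1 = p * (1 + y3)) by (rewrite E1; field; exact Hy).
assert (Y2 : y2 = q * (1 + y3)) by (rewrite E2; field; exact Hy).
assert (Mx : (p * p + q * q) * (1 + x3) = 1 - x3).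
{ apply Rmult_eq_reg_r with (1 + x3); [rewrite X1, X2 in Sx; lra | exact Hx]. }
assert (My : (p * p + q * q) * (1 + y3) = 1 - y3).
{ apply Rmult_eq_reg_r with (1 + y3); [rewrite Y1, Y2 in Sy; lra | exact Hy]. }
assert (E3 : x3 = y3).
{ assert (Hm : 0 <= p * p + q * q) by (assert (T1 := Rle_0_sqr p); assert (T2 := Rle_0_sqr q);
  unfold Rsqr in *; lra).
  apply Rmult_eq_reg_l with (p * p + q * q + 1); lra. }
now rewrite X1, X2, Y1, Y2, E3.
Qed.

Lemma unit_circle_angle (A B : R) : A * A + B * B = 1 -> exists t : R, cos t = A /\ sin t = B.
Proof.
intros H.
assert (HA : -1 <= A <= 1) by (assert (T := Rle_0_sqr B); unfold Rsqr in T; split; nra).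
assert (HS : sin (acos A) = Rabs B).
{ rewrite sin_acos by exact HA; rewrite <- (sqrt_Rsqr_abs B); f_equal; unfold Rsqr; lra. }
destruct (Rle_dec 0 B) as [L | L].
- exists (acos A); rewrite cos_acos by exact HA; rewrite HS, Rabs_pos_eq by exact L; now split.
- exists (- acos A); rewrite cos_neg, sin_neg, cos_acos by exact HA; rewrite HS, Rabs_left by lra.
  split; [reflexivity | ring].
Qed.

(* The continuous angle of the point (cos phi, k' sin phi) of an ellipse, which stays
   within a right angle of phi. *)
Definition ellipse_angle (k phi : R) : R :=
  phi + atan ((kc k - 1) * sin phi * cos phi / (cos phi ^ 2 + kc k * sin phi ^ 2)).

Lemma ellipse_denominator_pos (k phi : R) : 0 < k < 1 -> 0 < cos phi ^ 2 + kc k * sin phi ^ 2.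
Proof.
intros Hk; destruct (kc_bounds k Hk) as [K0 K1]; assert (H := sin2_cos2 phi); unfold Rsqr in H.
assert (T := pow2_ge_0 (sin phi)); assert (T' := pow2_ge_0 (cos phi)).
replace 1 with (sin phi ^ 2 + cos phi ^ 2) in K1 by (rewrite <- H; ring).
assert (0 < kc k * (sin phi ^ 2 + cos phi ^ 2)).
{ apply Rmult_lt_0_compat; [exact K0 |].
  replace (sin phi ^ 2 + cos phi ^ 2) with 1 by (rewrite <- H; ring); lra. }
assert (kc k * cos phi ^ 2 <= 1 * cos phi ^ 2).
{ apply Rmult_le_compat_r; [exact T' | destruct (kc_bounds k Hk); lra]. }
lra.
Qed.

(** The denominator and numerator under [atan] are the dot and the cross product of
    [(cos phi, sin phi)] with [(cos phi, k' sin phi)]. Their squares sum to [ellDelta ^ 2], the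
    squared length of the second vector, so the arctangent is the signed angle between the two. *)
Lemma ellipse_angle_cos_sin (k phi : R) : 0 < k < 1 ->
  cos (ellipse_angle k phi) = cos phi / ellDelta k phi /\
  sin (ellipse_angle k phi) = kc k * sin phi / ellDelta k phi.
Proof.
intros Hk; assert (HD := ellipse_denominator_pos k phi Hk); unfold ellipse_angle.
assert (HE := ellDelta_pos k Hk phi).
assert (E2 := ellDelta_sq k Hk phi); assert (K2 := kc_sq k Hk).
assert (H := sin2_cos2 phi); unfold Rsqr in H.
set (s := sin phi) in *; set (c := cos phi) in *; set (D := c ^ 2 + kc k * s ^ 2) in *.
set (q := (kc k - 1) * s * c / D).
assert (Hq : sqrt (1 + Rsqr q) = ellDelta k phi / D).
{ replace (1 + Rsqr q) with (Rsqr (ellDelta k phi / D)).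
  - rewrite sqrt_Rsqr_abs, Rabs_pos_eq; [reflexivity | apply Rle_mult_inv_pos; lra].
  - assert (C2 : c * c = 1 - s * s) by lra.
    assert (HN : ellDelta k phi ^ 2 = D ^ 2 + ((kc k - 1) * s * c) ^ 2).
    { rewrite E2; replace (k ^ 2) with (1 - kc k ^ 2) by lra; unfold D; ring [C2]. }
    unfold Rsqr, q.
    replace (ellDelta k phi / D * (ellDelta k phi / D)) with (ellDelta k phi ^ 2 / D ^ 2) by (field;
      lra).
    rewrite HN; field; lra. }
rewrite cos_plus, sin_plus, cos_atan, sin_atan, Hq; fold s c; unfold q.
assert (C2 : c * c = 1 - s * s) by lra.
split; field_simplify_eq; try lra; unfold D; ring [C2].
Qed.

Lemma continuous_ellipse_angle (k phi : R) : 0 < k < 1 -> continuous (ellipse_angle k) phi.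
Proof.
intros Hk; apply (ex_derive_continuous (V := R_NormedModule)).
assert (HD := ellipse_denominator_pos k phi Hk).
unfold ellipse_angle; auto_derive; simpl in *; lra.
Qed.

Lemma ellipse_angle_turn (k : R) : ellipse_angle k (2 * PI) - ellipse_angle k 0 = 2 * PI.
Proof.
unfold ellipse_angle; rewrite sin_2PI, sin_0.
replace ((kc k - 1) * 0 * cos (2 * PI) / _) with 0 by (unfold Rdiv; ring).
replace ((kc k - 1) * 0 * cos 0 / _) with 0 by (unfold Rdiv; ring).
ring.
Qed.

(* The point (cd, k' sd) of the unit circle turns once as its argument runs over [0, 4K]. *)
Lemma jacobi_winds_once (k q T : R) (G : R3 -> Prop) (a b : R3) (p : R -> R3) :
  0 < k < 1 -> q * T = 2 * (2 * ellK k) ->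
  dot a a = 1 -> dot b b = 1 -> dot a b = 0 ->
  (forall x : R3, G x <-> exists t : R, x = circle_point a b t) ->
  (forall y t : R, cos t = cn k (q * y) / dn k (q * y) -> sin t = kc k * sn k (q * y) / dn k (q * y) ->
     p y = circle_point a b t) ->
  winds_once_around G p T.
Proof.
intros Hk HT Haa Hbb Hab HG Hp.
exists a, b, (fun y => ellipse_angle k (am k (q * y))).
do 4 (split; [assumption |]); split; [| split].
- intros y _; apply (continuous_comp (fun y => am k (q * y)) (ellipse_angle k));
    [| now apply continuous_ellipse_angle].
  apply (continuous_comp (fun y => q * y) (am k)).
  + apply (ex_derive_continuous (V := R_NormedModule)); auto_derive; exact I.
  + apply (ex_derive_continuous (V := R_NormedModule)); eexists; now apply is_derive_am.
- intros y _; apply Hp; apply ellipse_angle_cos_sin; exact Hk.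
- rewrite HT, Rmult_0_r, am_0 by exact Hk.
  assert (E : am k (2 * (2 * ellK k)) = 2 * PI).
  { replace (2 * (2 * ellK k)) with (0 + IZR 2 * (2 * ellK k)) by ring.
    rewrite am_shift_Z, am_0 by exact Hk; ring. }
  rewrite E, ellipse_angle_turn; apply Rabs_pos_eq; assert (T1 := PI_RGT_0); lra.
Qed.

Lemma continuous_agree (f g : R -> R) (t : R) :
  continuous f t -> continuous g t ->
  (exists d : R, 0 < d /\ forall s : R, s <> t -> Rabs (s - t) < d -> f s = g s) -> f t = g t.
Proof.
intros Cf Cg [d [Hd H]]; apply NNPP; intros Hne.
set (e := Rabs (f t - g t) / 2).
assert (He : 0 < e) by (assert (T := Rabs_pos_lt (f t - g t)); unfold e; lra).
destruct (proj1 (filterlim_locally _ _) Cf (mkposreal e He)) as [d1 H1].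
destruct (proj1 (filterlim_locally _ _) Cg (mkposreal e He)) as [d2 H2].
set (m := Rmin d (Rmin d1 d2)).
assert (Hm : 0 < m) by (repeat apply Rmin_pos; try apply cond_pos; assumption).
assert (L1 : m <= d) by apply Rmin_l.
assert (L2 : m <= d1) by Rmin_le.
assert (L3 : m <= d2) by Rmin_le.
set (x := t + m / 2).
assert (Hx : Rabs (x - t) < m)
  by (unfold x; replace (t + m / 2 - t) with (m / 2) by ring; rewrite Rabs_pos_eq; lra).
specialize (H1 x (Rlt_le_trans _ _ _ Hx L2)); specialize (H2 x (Rlt_le_trans _ _ _ Hx L3)).
change (Rabs (f x - f t) < e) in H1; change (Rabs (g x - g t) < e) in H2.
rewrite (H x) in H1; [| unfold x; lra | lra].
apply Rabs_lt_between in H1; apply Rabs_lt_between in H2; unfold e in *.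
unfold Rabs in *; destruct (Rcase_abs (f t - g t)); lra.
Qed.

(** The zeros of [psi] are simple, hence isolated, and continuity carries the equality across
    them. *)
Lemma R3_continuous_agree (p P : R -> R3) (psi psi' : R -> R) :
  (forall t, continuous p t) ->
  (forall t, continuous (fun s => fst (fst (P s))) t) ->
  (forall t, continuous (fun s => snd (fst (P s))) t) ->
  (forall t, continuous (fun s => snd (P s)) t) ->
  (forall t, is_derive psi t (psi' t)) -> (forall t, psi t = 0 -> psi' t <> 0) ->
  (forall t, psi t <> 0 -> p t = P t) -> forall t, p t = P t.
Proof.
intros Cp C1 C2 C3 Hpsi Hs Heq t.
assert (Hd : exists d, 0 < d /\ forall s, s <> t -> Rabs (s - t) < d -> p s = P s).
{ assert (dP := rderiv_scal 1 psi t _ (Hpsi t)).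
  destruct (nonzero_punctured _ t _ dP) as [d [Hd H]].
  - rewrite !Cmult_1_l; destruct (Req_dec (psi t) 0) as [E | E];
      [right; now apply RtoC_neq_0, Hs | left; now apply RtoC_neq_0].
  - exists d; split; [exact Hd | intros s Hst Hsd; apply Heq].
    intros E; apply (H s Hst Hsd); rewrite E; ring. }
destruct Hd as [d [Hd H]].
assert (Cc : forall (pr : R3 -> R), (forall x, continuous pr x) -> (forall u,
  continuous (fun s => pr (P s)) u) ->
  pr (p t) = pr (P t)).
{ intros pr Cpr CP; apply (continuous_agree (fun s => pr (p s)) (fun s => pr (P s)) t).
  - apply (continuous_comp p pr); [apply Cp | apply Cpr].
  - apply CP.
  - exists d; split; [exact Hd | intros s S1 S2; now rewrite (H s S1 S2)]. }
assert (E1 := Cc (fun x => fst (fst x))); assert (E2 := Cc (fun x => snd (fst x)));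
  assert (E3 := Cc snd).
destruct (p t) as [[p1 p2] p3], (P t) as [[q1 q2] q3]; simpl in E1, E2, E3.
rewrite E1, E2, E3; try assumption; try reflexivity.
- intros [x y]; apply continuous_snd.
- intros [[x y] z]; apply (continuous_comp fst snd); [apply continuous_fst | apply continuous_snd].
- intros [[x y] z]; apply (continuous_comp fst fst); [apply continuous_fst | apply continuous_fst].
Qed.

(** * The Gauss map on the lines *)

Section GaussMap.

Variables (k : R) (f1 f2 f3 : C -> C).
Hypothesis Hk : 0 < k < 1.
Hypothesis Hf1 : is_wp_root k (omega1 k) f1.
Hypothesis Hf2 : is_wp_root k (omega2 k) f2.
Hypothesis Hf3 : is_wp_root k (omega3 k) f3.

Let Hk' : 0 < kc k < 1 := kc_bounds k Hk.
Let sigma : R := sqrt (k * kc k).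
Let q : R := / sigma.
Let a : R := 2 * sigma * ellK k.
Let b : R := 2 * sigma * ellK (kc k).

Let Hsigma : 0 < sigma := sigma_pos k Hk.
Let Hq : 0 < q := Rinv_0_lt_compat _ Hsigma.

Lemma q_times (x y : R) : (RtoC q * (x, y))%C = (q * x, q * y).
Proof. unfold Cmult, RtoC; simpl; f_equal; ring. Qed.

Lemma not_in_lattice_re (x y : R) : (forall m : Z, x <> IZR m * a) ->
  ~ in_lattice (omega1 k) (omega2 k) (x, y).
Proof.
intros H H'; apply (in_lattice_rect a b) in H'; destruct H' as [m [n E]].
injection E as E _; now apply (H m).
Qed.

Lemma not_in_lattice_im (x y : R) : (forall n : Z, y <> IZR n * b) ->
  ~ in_lattice (omega1 k) (omega2 k) (x, y).
Proof.
intros H H'; apply (in_lattice_rect a b) in H'; destruct H' as [m [n E]].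
injection E as _ E; now apply (H n).
Qed.

Lemma half_odd_period (c : R) (i : Z) : 0 < c -> forall m : Z, IZR i * c + c / 2 <> IZR m * c.
Proof.
intros Hc m E; apply (half_not_integer (m - i)); rewrite minus_IZR.
apply Rmult_eq_reg_r with c; lra.
Qed.

(** The square of ns is 1, 0 and [k ^ 2] at [K], [i K'] and [K + i K'], the rescaled half periods;
    subtracting [e_j] removes the unknown constant [c], which is common to the three roots. *)
Lemma roots_squared (z : C) : ~ in_lattice (omega1 k) (omega2 k) z ->
  let s := (nsC k (RtoC q * z) * nsC k (RtoC q * z))%C in let qq := (RtoC q * RtoC q)%C in
  (f1 z * f1 z = qq * (s - 1) /\ f2 z * f2 z = qq * s /\ f3 z * f3 z = qq * (s - RtoC k * RtoC k))%C.
Proof.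
intros Hz s qq.
destruct Hf1 as [_ [F1 P1]]; destruct Hf2 as [_ [F2 _]]; destruct Hf3 as [_ [F3 _]].
destruct (period_pos k Hk) as [Ha Hb]; fold sigma in Ha, Hb; fold a in Ha; fold b in Hb.
assert (EL : forall z, ~ in_lattice (omega1 k) (omega2 k) z <-> ~ rect_lattice a b z).
{ intros w; assert (T := in_lattice_rect a b w); change (RtoC a) with (omega1 k) in T.
  change (Ci * RtoC b)%C with (omega2 k) in T; tauto. }
destruct (wp_eq_ns_sq k Hk f1 (wp (omega1 k) (omega2 k) (omega1 k / 2))) as [c Hc].
{ intros w Hw; apply F1, EL, Hw. }
{ exact P1. }
fold sigma in Hc; fold a b in Hc.
assert (W : forall w, ~ in_lattice (omega1 k) (omega2 k) w ->
  wp (omega1 k) (omega2 k) w = (c + qq * (nsC k (RtoC q * w) * nsC k (RtoC q * w)))%C).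
{ intros w Hw; rewrite Hc by now apply EL.
  unfold scaled_ns; fold sigma; fold q; unfold qq; ring. }
assert (N2 : RtoC 2 <> 0) by (apply RtoC_neq_0; lra).
assert (H1 : (omega1 k / 2)%C = (a / 2, 0)).
{ change (omega1 k) with (RtoC a); rewrite <- RtoC_div by lra; reflexivity. }
assert (H2 : (omega2 k / 2)%C = (0, b / 2)).
{ replace (omega2 k / 2)%C with (Ci * RtoC (b / 2))%C.
  - unfold Ci, Cmult, RtoC; simpl; f_equal; ring.
  - change (omega2 k) with (Ci * RtoC b)%C; rewrite RtoC_div by lra; field; exact N2. }
assert (H3 : (omega3 k / 2)%C = (a / 2, b / 2)).
{ replace (omega3 k / 2)%C with (omega1 k / 2 + omega2 k / 2)%C by (unfold omega3; field; exact N2).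
  rewrite H1, H2; unfold Cplus; simpl; f_equal; ring. }
assert (Qa : q * (a / 2) = ellK k) by (unfold q, a; field; lra).
assert (Qb : q * (b / 2) = ellK (kc k)) by (unfold q, b; field; lra).
assert (Na : forall m, a / 2 <> IZR m * a).
{ intros m; assert (T := half_odd_period a 0 Ha m); lra. }
assert (Nb : forall m, b / 2 <> IZR m * b).
{ intros m; assert (T := half_odd_period b 0 Hb m); lra. }
assert (W1 : wp (omega1 k) (omega2 k) (omega1 k / 2) = (c + qq)%C).
{ rewrite W by (rewrite H1; now apply not_in_lattice_re).
  rewrite H1, q_times, Qa, Rmult_0_r, nsC_re_ellK, dn_0 by assumption; ring. }
assert (W2 : wp (omega1 k) (omega2 k) (omega2 k / 2) = c).
{ rewrite W by (rewrite H2; now apply not_in_lattice_im).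
  rewrite H2, q_times, Qb, Rmult_0_r, nsC_im_ellK, sn_0, Rmult_0_r by assumption; ring. }
assert (W3 : wp (omega1 k) (omega2 k) (omega3 k / 2) = (c + qq * (RtoC k * RtoC k))%C).
{ rewrite W by (rewrite H3; now apply not_in_lattice_re).
  rewrite H3, q_times, Qa, Qb, nsC_im_ellK, sn_ellK, Rmult_1_r by assumption; ring. }
destruct (F1 z Hz) as [_ E1]; destruct (F2 z Hz) as [_ E2]; destruct (F3 z Hz) as [_ E3].
rewrite W1, W in E1 by exact Hz; rewrite W2, W in E2 by exact Hz; rewrite W3, W in E3 by exact Hz.
fold s in E1, E2, E3.
repeat split.
- replace (f1 z * f1 z)%C with (f1 z ^ 2)%C by ring; rewrite E1; ring.
- replace (f2 z * f2 z)%C with (f2 z ^ 2)%C by ring; rewrite E2; ring.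
- replace (f3 z * f3 z)%C with (f3 z ^ 2)%C by ring; rewrite E3; ring.
Qed.

Lemma is_derive_rescale (p : R -> R) (r y l : R) :
  is_derive p (r * y) l -> is_derive (fun t => p (r * t)) y (r * l).
Proof.
intros H; apply (is_derive_comp p (fun t => r * t)); [exact H |].
auto_derive; [exact I | ring].
Qed.

(** The rate of the Jacobi argument in terms of [u]: the roots are taken at [2 * u]. *)
Let r : R := 2 * q.

(** At a zero of [sn] or [cn] the other is non-zero, as their squares sum to 1. The right-hand sides
    are spelled exactly as the derivatives in [is_derive_sn] and its companions. *)
Lemma simple_zeros (kk : R) : 0 < kk < 1 ->
  (forall t, sn kk t = 0 -> cn kk t * dn kk t <> 0) /\
  (forall t, cn kk t = 0 -> - sn kk t * dn kk t <> 0) /\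
  (forall t, dn kk t = 0 -> - (kk ^ 2 * sn kk t * cn kk t) <> 0).
Proof.
intros Hkk; split; [| split]; intros t E; assert (D := dn_pos kk Hkk t); assert (S := sn_sq_cn_sq kk t);
  [| | lra]; rewrite E in S; apply Rmult_integral_contrapositive_currified; try lra; intros E'; nra.
Qed.

Lemma root_branch (w : C) (f : C -> C) (p v c : C) (psi psi' : R -> R) :
  is_wp_root k w f -> v <> 0 -> c <> 0 ->
  (forall t, ~ in_lattice (omega1 k) (omega2 k) (p + RtoC t * v)%C) ->
  (forall t, is_derive psi t (psi' t)) -> (forall t, psi t = 0 -> psi' t <> 0) ->
  (forall t, f (p + RtoC t * v) * f (p + RtoC t * v) = (c * RtoC (psi (r * t)%R)) * (c * RtoC (psi (r * t)%R)))%C ->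
  exists eps : R, eps * eps = 1 /\ forall t,
    f (p + RtoC t * v)%C = (RtoC eps * (c * RtoC (psi (r * t)%R)))%C.
Proof.
intros [_ [Hf _]] Hv Hc NL Hpsi Hs Hsq.
apply (square_root_branch (fun t => f (p + RtoC t * v)%C) c (fun t => psi (r * t))
  (fun t => r * psi' (r * t))).
- exact Hc.
- intros t; apply rderiv_line; [exact Hv | apply holomorphic_at_cderiv, Hf, NL].
- intros t; apply is_derive_rescale, Hpsi.
- intros t E; apply Rmult_integral_contrapositive_currified; [unfold r; lra | now apply Hs].
- exact Hsq.
Qed.

(** The square of ns is here [dn ^ 2] for the modulus [k'], so the three squares are
    [- (q k' sn) ^ 2], [(q dn) ^ 2] and [(q k' cn) ^ 2]. The integer [i] lets one statement serve
    both vertical lines. *)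
Lemma roots_on_vertical_line (i : Z) :
  exists d1 d2 d3 : R, d1 * d1 = 1 /\ d2 * d2 = 1 /\ d3 * d3 = 1 /\
  forall y : R, let z := (IZR i * a + a / 2, 2 * y) : C in
    f1 z = (RtoC d1 * (Ci * RtoC (q * kc k) * RtoC (sn (kc k) (r * y))))%C /\
    f2 z = (RtoC d2 * (RtoC q * RtoC (dn (kc k) (r * y))))%C /\
    f3 z = (RtoC d3 * (RtoC (q * kc k) * RtoC (cn (kc k) (r * y))))%C.
Proof.
destruct (period_pos k Hk) as [Ha Hb]; fold sigma in Ha, Hb; fold a in Ha; fold b in Hb.
set (p := (IZR i * a + a / 2, 0) : C); set (v := (2 * Ci)%C).
assert (Ez : forall y : R, (p + RtoC y * v)%C = (IZR i * a + a / 2, 2 * y)).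
{ intros y; unfold p, v, Ci, Cplus, Cmult, RtoC; simpl; f_equal; ring. }
assert (Nv : v <> 0) by (apply Cmult_neq_0; [apply RtoC_neq_0; lra | apply Ci_nz]).
assert (NL : forall y, ~ in_lattice (omega1 k) (omega2 k) (p + RtoC y * v)%C).
{ intros y; rewrite Ez; apply not_in_lattice_re, half_odd_period, Ha. }
assert (Hs : forall y, (nsC k (RtoC q * (p + RtoC y * v)) * nsC k (RtoC q * (p + RtoC y * v)) =
  RtoC (dn (kc k) (r * y)) * RtoC (dn (kc k) (r * y)))%C).
{ intros y; rewrite Ez, q_times.
  replace (q * (IZR i * a + a / 2)) with (ellK k + IZR i * (2 * ellK k)) by (unfold q, a; field; lra).
  replace (q * (2 * y)) with (r * y) by (unfold r; ring).
  rewrite <- nsC_re_ellK by exact Hk.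
  (* Moving by [i] periods changes [nsC] at most by a sign, hence not its square; this reduces the
     line to the one through [ellK k]. *)
  set (N := fun w : C => (nsC k w * nsC k w)%C).
  assert (HN : forall w, True -> True /\ True /\ N (w + RtoC (2 * ellK k))%C = N w).
  { intros [u w] _; repeat split; unfold N.
    replace ((u, w) + RtoC (2 * ellK k))%C with (u + 2 * ellK k, w)
      by (unfold Cplus, RtoC; simpl; f_equal; ring).
    rewrite nsC_shift_re by exact Hk; ring. }
  assert (T := proj2 (periodic_Z N (fun _ => True) (RtoC (2 * ellK k)) HN i (ellK k, r * y) I)).
  unfold N in T; rewrite <- T.
  replace ((ellK k, r * y)%R + RtoC (IZR i) * RtoC (2 * ellK k)%R)%C
    with (ellK k + IZR i * (2 * ellK k), r * y)
    by (unfold Cplus, Cmult, RtoC; simpl; f_equal; ring).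
  reflexivity. }
destruct (simple_zeros (kc k) Hk') as [Zs [Zc Zd]].
assert (Nq : RtoC q <> 0) by (apply RtoC_neq_0; lra).
assert (Nqk : RtoC (q * kc k) <> 0) by (apply RtoC_neq_0, Rmult_integral_contrapositive_currified; lra).
destruct (root_branch _ f1 p v (Ci * RtoC (q * kc k))%C (sn (kc k)) _ Hf1 Nv ltac:(apply Cmult_neq_0; [apply Ci_nz | exact Nqk]) NL
  (is_derive_sn _ Hk') Zs) as [d1 [D1 E1]].
{ intros y; rewrite (proj1 (roots_squared _ (NL y))), Hs.
  assert (S := dn_sq (kc k) Hk' (r * y)).
  rewrite <- !RtoC_mult, <- RtoC_minus.
  replace (dn (kc k) (r * y) * dn (kc k) (r * y) - 1)
    with (- (kc k * kc k * (sn (kc k) (r * y) * sn (kc k) (r * y)))) by lra.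
  rewrite !RtoC_mult, RtoC_opp, !RtoC_mult; ring [Ci_sq]. }
destruct (root_branch _ f2 p v (RtoC q) (dn (kc k)) _ Hf2 Nv ltac:(exact Nq) NL
  (is_derive_dn _ Hk') Zd) as [d2 [D2 E2]].
{ intros y; rewrite (proj1 (proj2 (roots_squared _ (NL y)))), Hs; ring. }
destruct (root_branch _ f3 p v (RtoC (q * kc k)) (cn (kc k)) _ Hf3 Nv ltac:(exact Nqk) NL
  (is_derive_cn _ Hk') Zc) as [d3 [D3 E3]].
{ intros y; rewrite (proj2 (proj2 (roots_squared _ (NL y)))), Hs.
  assert (S := dn_sq (kc k) Hk' (r * y)); assert (S' := sn_sq_cn_sq (kc k) (r * y)).
  assert (S'' := kc_sq k Hk).
  rewrite <- !RtoC_mult, <- RtoC_minus, <- !RtoC_mult; f_equal.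
  replace (dn (kc k) (r * y) * dn (kc k) (r * y) - k * k)
    with (kc k ^ 2 * cn (kc k) (r * y) ^ 2); [ring |].
  replace (dn (kc k) (r * y) * dn (kc k) (r * y)) with (dn (kc k) (r * y) ^ 2) by ring.
  rewrite S; replace (k * k) with (1 - kc k ^ 2) by lra.
  replace (cn (kc k) (r * y) ^ 2) with (1 - sn (kc k) (r * y) ^ 2) by lra; ring. }
exists d1, d2, d3; repeat split; try assumption; rewrite <- Ez; [apply E1 | apply E2 | apply E3].
Qed.

(** Here ns is [k sn], so the three squares are [- (q dn) ^ 2], [(q k sn) ^ 2] and
    [- (q k cn) ^ 2]. *)
Lemma roots_on_horizontal_line :
  exists d1 d2 d3 : R, d1 * d1 = 1 /\ d2 * d2 = 1 /\ d3 * d3 = 1 /\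
  forall x : R, let z := (2 * x, b / 2) : C in
    f1 z = (RtoC d1 * (Ci * RtoC q * RtoC (dn k (r * x))))%C /\
    f2 z = (RtoC d2 * (RtoC (q * k) * RtoC (sn k (r * x))))%C /\
    f3 z = (RtoC d3 * (Ci * RtoC (q * k) * RtoC (cn k (r * x))))%C.
Proof.
destruct (period_pos k Hk) as [Ha Hb]; fold sigma in Ha, Hb; fold a in Ha; fold b in Hb.
set (p := (0, b / 2) : C); set (v := RtoC 2).
assert (Ez : forall x : R, (p + RtoC x * v)%C = (2 * x, b / 2)).
{ intros x; unfold p, v, Cplus, Cmult, RtoC; simpl; f_equal; ring. }
assert (Nv : v <> 0) by (apply RtoC_neq_0; lra).
assert (NL : forall x, ~ in_lattice (omega1 k) (omega2 k) (p + RtoC x * v)%C).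
{ intros x; rewrite Ez; apply not_in_lattice_im; intros m; assert (T := half_odd_period b 0 Hb m);
  lra. }
assert (Hs : forall x, nsC k (RtoC q * (p + RtoC x * v)) = RtoC (k * sn k (r * x))).
{ intros x; rewrite Ez, q_times.
  replace (q * (b / 2)) with (ellK (kc k)) by (unfold q, b; field; lra).
  replace (q * (2 * x)) with (r * x) by (unfold r; ring); now apply nsC_im_ellK. }
destruct (simple_zeros k Hk) as [Zs [Zc Zd]].
assert (Nq : RtoC q <> 0) by (apply RtoC_neq_0; lra).
assert (Nqk : RtoC (q * k) <> 0) by (apply RtoC_neq_0, Rmult_integral_contrapositive_currified; lra).
destruct (root_branch _ f1 p v (Ci * RtoC q)%C (dn k) _ Hf1 Nv ltac:(apply Cmult_neq_0;
  [apply Ci_nz | exact Nq]) NL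
  (is_derive_dn _ Hk) Zd) as [d1 [D1 E1]].
{ intros x; rewrite (proj1 (roots_squared _ (NL x))), Hs.
  assert (S := dn_sq k Hk (r * x)).
  rewrite <- !RtoC_mult, <- RtoC_minus.
  replace (k * sn k (r * x) * (k * sn k (r * x)) - 1) with (- (dn k (r * x) * dn k (r * x))) by lra.
  rewrite !RtoC_mult, RtoC_opp, !RtoC_mult; ring [Ci_sq]. }
destruct (root_branch _ f2 p v (RtoC (q * k)) (sn k) _ Hf2 Nv ltac:(exact Nqk) NL
  (is_derive_sn _ Hk) Zs) as [d2 [D2 E2]].
{ intros x; rewrite (proj1 (proj2 (roots_squared _ (NL x)))), Hs, !RtoC_mult; ring. }
destruct (root_branch _ f3 p v (Ci * RtoC (q * k))%C (cn k) _ Hf3 Nv ltac:(apply Cmult_neq_0;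
  [apply Ci_nz | exact Nqk]) NL
  (is_derive_cn _ Hk) Zc) as [d3 [D3 E3]].
{ intros x; rewrite (proj2 (proj2 (roots_squared _ (NL x)))), Hs.
  assert (S := sn_sq_cn_sq k (r * x)).
  rewrite <- !RtoC_mult, <- RtoC_minus.
  replace (k * sn k (r * x) * (k * sn k (r * x)) - k * k) with (- (k * k * (cn k (r * x) * cn k (r * x)))) by nra.
  rewrite !RtoC_mult, RtoC_opp, !RtoC_mult; ring [Ci_sq]. }
exists d1, d2, d3; repeat split; try assumption; rewrite <- Ez; [apply E1 | apply E2 | apply E3].
Qed.

Variable gamma : C -> R3.
Hypothesis Hgamma : is_gauss_map k f1 f2 f3 gamma.

Lemma gauss_map_value (u : C) (y1 y2 y3 : R) :
  ~ in_lattice (omega1 k) (omega2 k) (2 * u)%C ->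
  (RtoC k * f1 (2 * u) + Ci * RtoC (kc k) * f2 (2 * u))%C <> 0 ->
  sphere (y1, y2, y3) -> 1 + y3 <> 0 ->
  g_Phi k f1 f2 f3 u = (y1 / (1 + y3), y2 / (1 + y3)) -> gamma u = (y1, y2, y3).
Proof.
intros Hu Hden Sy Hy Hg; destruct Hgamma as [_ [_ [_ [Sg [_ H]]]]].
destruct (H u Hu Hden) as [G1 G2].
apply stereo_inj; [apply Sg | exact Sy | exact G1 | |].
- intros E; apply Hy; injection E as _ _ E; lra.
- rewrite G2; exact Hg.
Qed.

Lemma continuous_jacobi_ratio (kk c y : R) (p : R -> R) : 0 < kk < 1 -> (forall x, ex_derive p x) ->
  continuous (fun y => c * p (r * y) / dn kk (r * y)) y.
Proof.
intros Hkk Hp; apply (ex_derive_continuous (V := R_NormedModule)).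
destruct (Hp (r * y)) as [l Hl]; eexists; apply is_derive_div.
- apply is_derive_scal, is_derive_rescale; exact Hl.
- apply is_derive_rescale, is_derive_dn; exact Hkk.
- apply Rgt_not_eq, dn_pos; exact Hkk.
Qed.

(** This is [cn ^ 2 + k' ^ 2 sn ^ 2 = dn ^ 2] divided by [dn ^ 2]; the signs disappear in the
    squares. *)
Lemma jacobi_circle (kk d d' t : R) : 0 < kk < 1 -> d * d = 1 -> d' * d' = 1 ->
  d * cn kk t / dn kk t * (d * cn kk t / dn kk t) +
  d' * kc kk * sn kk t / dn kk t * (d' * kc kk * sn kk t / dn kk t) = 1.
Proof.
intros Hkk Hd Hd'; assert (D := dn_pos kk Hkk t).
assert (S := dn_sq kk Hkk t); assert (S' := sn_sq_cn_sq kk t); assert (K := kc_sq kk Hkk).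
set (s := sn kk t) in *; set (c := cn kk t) in *; set (D0 := dn kk t) in *.
replace (d * c / D0 * (d * c / D0) + d' * kc kk * s / D0 * (d' * kc kk * s / D0))
  with ((d * d * c ^ 2 + d' * d' * kc kk ^ 2 * s ^ 2) / D0 ^ 2) by (field; lra).
rewrite Hd, Hd', K.
replace (1 * c ^ 2 + 1 * (1 - kk ^ 2) * s ^ 2) with (D0 ^ 2); [field; lra |].
rewrite S; replace (c ^ 2) with (1 - s ^ 2) by lra; ring.
Qed.

Lemma pair_ratio_neq (A B : R) : A <> 0 -> A * A + B * B = 1 -> 1 + B <> 0.
Proof.
intros HA H E; apply HA; replace B with (-1) in H by lra.
assert (E2 : A * A = 0) by lra; apply Rmult_integral in E2; tauto.
Qed.

(* Along both kinds of lines g_Phi is [A / (1 + B)] times the constant [dir], where (A, B) is a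
   point of the unit circle; where [cn] vanishes the formula for g_Phi may break down and
   continuity takes over. *)
Lemma gauss_map_along_line (kk kap e1 e2 e3 : R) (dir : C) (u : R -> C) :
  0 < kk < 1 -> kap <> 0 -> e1 * e1 = 1 -> e2 * e2 = 1 -> e3 * e3 = 1 ->
  Re dir * Re dir + Im dir * Im dir = 1 -> (forall y, continuous u y) ->
  (forall y, ~ in_lattice (omega1 k) (omega2 k) (2 * u y)%C) ->
  (forall y, RtoC k * f1 (2 * u y) + Ci * RtoC (kc k) * f2 (2 * u y) =
    Ci * RtoC kap * RtoC (e1 * kc kk * sn kk (r * y) + e2 * dn kk (r * y)))%C ->
  (forall y, - Ci * f3 (2 * u y) = dir * (Ci * RtoC kap * RtoC (- (e3 * cn kk (r * y)))))%C ->
  forall y, gamma (u y) =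
    (Re dir * - (e3 * e2) * cn kk (r * y) / dn kk (r * y),
     Im dir * - (e3 * e2) * cn kk (r * y) / dn kk (r * y),
     e1 * e2 * kc kk * sn kk (r * y) / dn kk (r * y)).
Proof.
intros Hkk Hkap H1 H2 H3 Hdir Cu NL Hden Hnum.
apply (R3_continuous_agree (fun y => gamma (u y)) _
  (fun y => cn kk (r * y)) (fun y => r * (- sn kk (r * y) * dn kk (r * y)))).
- intros y; apply (continuous_comp u gamma); [apply Cu |].
  destruct Hgamma as [_ [_ [C _]]]; apply C.
- intros y; apply (continuous_jacobi_ratio kk _ y (cn kk) Hkk).
  intros x; eexists; apply is_derive_cn, Hkk.
- intros y; apply (continuous_jacobi_ratio kk _ y (cn kk) Hkk).
  intros x; eexists; apply is_derive_cn, Hkk.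
- intros y; apply (continuous_jacobi_ratio kk _ y (sn kk) Hkk).
  intros x; eexists; apply is_derive_sn, Hkk.
- intros y; apply is_derive_rescale, is_derive_cn, Hkk.
- intros t E; apply Rmult_integral_contrapositive_currified; [unfold r; lra |].
  now apply (simple_zeros kk Hkk).
- intros y Hc; assert (D := dn_pos kk Hkk (r * y)).
  assert (Hcirc := jacobi_circle kk (- (e3 * e2)) (e1 * e2)
    (r * y) Hkk ltac:(ring [H2 H3]) ltac:(ring [H1 H2])).
  specialize (Hden y); specialize (Hnum y).
  set (s := sn kk (r * y)) in *; set (c := cn kk (r * y)) in *; set (d := dn kk (r * y)) in *.
  assert (N2 : e2 <> 0) by (intros E; rewrite E in H2; lra).
  assert (N3 : e3 <> 0) by (intros E; rewrite E in H3; lra).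
  assert (HA : - (e3 * e2) * c / d <> 0).
  { unfold Rdiv; repeat apply Rmult_integral_contrapositive_currified; try lra;
      [apply Ropp_neq_0_compat, Rmult_integral_contrapositive_currified;
        assumption | apply Rinv_neq_0_compat; lra]. }
  (* Since [cn] is non-zero here, so is the horizontal component of the point; hence it is not the
     south pole. *)
  assert (H1B := pair_ratio_neq _ _ HA Hcirc).
  set (M := e1 * kc kk * s + e2 * d) in *.
  (* [M] is the real factor in the denominator of [g_Phi]. This one identity shows that the
     denominator is non-zero and that [g_Phi] is the projection of the claimed point. *)
  assert (EM : 1 + e1 * e2 * kc kk * s / d = e2 * M / d).
  { unfold M; replace (e2 * (e1 * kc kk * s + e2 * d)) with (e1 * e2 * kc kk * s + e2 * e2 * d) by ring.
    rewrite H2; field; lra. }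
  assert (NM : M <> 0) by (intros E; apply H1B; rewrite EM, E; field; lra).
  apply gauss_map_value.
  + apply NL.
  + rewrite Hden; repeat apply Cmult_neq_0; try (now apply RtoC_neq_0); apply Ci_nz.
  + unfold sphere, dot; rewrite <- Hcirc.
    replace (- (e3 * e2) * c / d * (- (e3 * e2) * c / d))
      with ((Re dir * Re dir + Im dir * Im dir) * (- (e3 * e2) * c / d * (- (e3 * e2) * c / d)))
      by (rewrite Hdir; ring).
    unfold Rdiv; ring.
  + exact H1B.
  + unfold g_Phi; rewrite Hden, Hnum, EM.
    replace (dir * (Ci * RtoC kap * RtoC (- (e3 * c))) / (Ci * RtoC kap * RtoC M))%C
      with (dir * RtoC (- (e3 * c) / M))%C
      by (rewrite RtoC_div by exact NM; field; repeat split; try (now apply RtoC_neq_0); apply Ci_nz).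
    destruct dir as [dr di]; unfold Cmult, RtoC, Re, Im; simpl; f_equal; field; repeat split; lra.
Qed.

(** The case [dir = 1]: both terms of [k f1 + i k' f2] contain the factor [i q k']. *)
Lemma gauss_map_vertical (i : Z) :
  exists d d' : R, d * d = 1 /\ d' * d' = 1 /\ forall y : R,
    gamma ((IZR i * a + a / 2) / 2, y) =
      (d * cn (kc k) (r * y) / dn (kc k) (r * y), 0, d' * k * sn (kc k) (r * y) / dn (kc k) (r * y)).
Proof.
destruct (period_pos k Hk) as [Ha Hb]; fold sigma in Ha, Hb; fold a in Ha; fold b in Hb.
destruct (roots_on_vertical_line i) as [d1 [d2 [d3 [D1 [D2 [D3 HF]]]]]].
exists (- (d3 * d2)), (d1 * d2); split; [ring [D2 D3] | split; [ring [D1 D2] |]].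
assert (Eu : forall y, (2 * ((IZR i * a + a / 2) / 2, y)%R)%C = (IZR i * a + a / 2, 2 * y))
  by (intros y; unfold Cmult, RtoC; simpl; f_equal; field).
intros y; rewrite (gauss_map_along_line (kc k) (q * kc k) d1 d2 d3 1
  (fun y => ((IZR i * a + a / 2) / 2, y) : C)); try assumption.
- rewrite kc_kc by exact Hk; unfold Re, Im; simpl; do 2 f_equal; unfold Rdiv; ring.
- apply Rmult_integral_contrapositive_currified; lra.
- unfold Re, Im; simpl; ring.
- intros t P [eps HP]; exists eps; intros s Hs; apply HP; split; [apply ball_center | exact Hs].
- intros t; rewrite Eu; apply not_in_lattice_re, half_odd_period, Ha.
- intros t; destruct (HF t) as [F1 [F2 _]]; rewrite Eu, F1, F2, kc_kc by exact Hk.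
  rewrite !RtoC_plus, !RtoC_mult; ring.
- intros t; destruct (HF t) as [_ [_ F3]]; rewrite Eu, F3, RtoC_opp, !RtoC_mult; ring.
Qed.

(** The case [dir = Ci], with common factor [i q k]. Now [dn] is carried by [f1] instead of [f2], so
    the signs [d1] and [d2] exchange places. *)
Lemma gauss_map_horizontal :
  exists d d' : R, d * d = 1 /\ d' * d' = 1 /\ forall x : R,
    gamma (x, b / 4) = (0, d * cn k (r * x) / dn k (r * x), d' * kc k * sn k (r * x) / dn k (r * x)).
Proof.
destruct (period_pos k Hk) as [Ha Hb]; fold sigma in Ha, Hb; fold a in Ha; fold b in Hb.
destruct roots_on_horizontal_line as [d1 [d2 [d3 [D1 [D2 [D3 HF]]]]]].
exists (- (d3 * d1)), (d2 * d1); split; [ring [D1 D3] | split; [ring [D1 D2] |]].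
assert (Eu : forall x, (2 * (x, b / 4)%R)%C = (2 * x, b / 2))
  by (intros x; unfold Cmult, RtoC; simpl; f_equal; field).
intros x; rewrite (gauss_map_along_line k (q * k) d2 d1 d3 Ci (fun x => (x, b / 4) : C));
  try assumption.
- unfold Re, Im; simpl; do 2 f_equal; unfold Rdiv; ring.
- apply Rmult_integral_contrapositive_currified; lra.
- unfold Re, Im; simpl; ring.
- intros t P [eps HP]; exists eps; intros s Hs; apply HP; split; [exact Hs | apply ball_center].
- intros t; rewrite Eu; apply not_in_lattice_im; intros m; assert (T := half_odd_period b 0 Hb m); lra.
- intros t; destruct (HF t) as [F1 [F2 _]]; rewrite Eu, F1, F2.
  rewrite !RtoC_plus, !RtoC_mult; ring.
- intros t; destruct (HF t) as [_ [_ F3]]; rewrite Eu, F3, RtoC_opp, !RtoC_mult; ring.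
Qed.

Lemma rate_times_period (K : R) : r * (2 * sigma * K) = 2 * (2 * K).
Proof. unfold r, q; field; lra. Qed.

End GaussMap.

(** * The great circles over the two axes, and the conclusion *)

(* One statement for both axes: [e] is the coordinate that vanishes on the circle and [h]
   the remaining horizontal one. *)
Lemma circle_points (d d' e h x3 : R) : d * d = 1 -> d' * d' = 1 ->
  (e * e + h * h + x3 * x3 = 1 /\ (1 + x3 = 0 \/ e / (1 + x3) = 0)) <->
  (exists t : R, e = 0 /\ h = cos t * d /\ x3 = sin t * d').
Proof.
intros Hd Hd'; split.
- intros [S H].
  assert (E0 : e = 0).
  { destruct (Req_dec (1 + x3) 0) as [E | E].
    - replace x3 with (-1) in S by lra; destruct (Rplus_sqr_eq_0 e h); unfold Rsqr; lra.
    - destruct H as [H | H]; [contradiction |].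
      replace e with (e / (1 + x3) * (1 + x3)) by (field; exact E); rewrite H; ring. }
  destruct (unit_circle_angle (d * h) (d' * x3)) as [t [T1 T2]].
  { rewrite E0 in S.
    replace (d * h * (d * h) + d' * x3 * (d' * x3)) with (d * d * (h * h) + d' * d' * (x3 * x3)) by ring.
    rewrite Hd, Hd'; lra. }
  exists t; rewrite T1, T2; repeat split; [exact E0 | ring [Hd Hd'] | ring [Hd Hd']].
- intros [t [-> [-> ->]]]; split; [| right; unfold Rdiv; ring].
  rewrite <- (sin2_cos2 t); unfold Rsqr; ring [Hd Hd'].
Qed.

Lemma circle_over_line (L : C -> Prop) (x1 x2 x3 : R) :
  circle_over L (x1, x2, x3) <->
  x1 * x1 + x2 * x2 + x3 * x3 = 1 /\ (1 + x3 = 0 \/ L (x1 / (1 + x3), x2 / (1 + x3))).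
Proof.
unfold circle_over; split; intros [S [H | H]]; (split; [exact S |]).
- left; injection H as _ _ H; lra.
- now right.
- left; now apply sphere_south_pole.
- now right.
Qed.

(** The unknown signs [d] and [d'], which come from the branches of the roots, are put into the
    orthonormal pair; the Gauss map then matches [circle_point] whichever values they take. *)
Lemma circle_over_e1 (d d' : R) (x : R3) : d * d = 1 -> d' * d' = 1 ->
  (circle_over e1_axis x <-> exists t : R, x = circle_point (d, 0, 0) (0, 0, d') t).
Proof.
intros Hd Hd'; destruct x as [[x1 x2] x3]; rewrite circle_over_line.
rewrite (Rplus_comm (x1 * x1)); unfold e1_axis, Im; simpl snd.
rewrite (circle_points d d' x2 x1 x3 Hd Hd'); unfold circle_point; split; intros [t E]; exists t.
- destruct E as [-> [-> ->]]; f_equal; [f_equal |]; ring.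
- injection E as -> -> ->; repeat split; ring.
Qed.

Lemma circle_over_e2 (d d' : R) (x : R3) : d * d = 1 -> d' * d' = 1 ->
  (circle_over e2_axis x <-> exists t : R, x = circle_point (0, d, 0) (0, 0, d') t).
Proof.
intros Hd Hd'; destruct x as [[x1 x2] x3]; rewrite circle_over_line.
unfold e2_axis, Re; simpl fst.
rewrite (circle_points d d' x1 x2 x3 Hd Hd'); unfold circle_point; split; intros [t E]; exists t.
- destruct E as [-> [-> ->]]; f_equal; [f_equal |]; ring.
- injection E as -> -> ->; repeat split; ring.
Qed.

Theorem theorem8p7:
  forall (k : R) (f1 f2 f3 : C -> C) (gamma : C -> R3),
    0 < k < 1 ->
    is_wp_root k (omega1 k) f1 ->
    is_wp_root k (omega2 k) f2 ->
    is_wp_root k (omega3 k) f3 ->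
    is_gauss_map k f1 f2 f3 gamma ->
    (winds_once_around (circle_over e1_axis)
       (fun y : R => gamma (V_line k (1 / 4) y)) (Cmod (omega2 k)) /\
     winds_once_around (circle_over e1_axis)
       (fun y : R => gamma (V_line k (3 / 4) y)) (Cmod (omega2 k))) /\
    winds_once_around (circle_over e2_axis)
      (fun x : R => gamma (H_line k (1 / 4) x)) (Cmod (omega1 k)).
Proof.
intros k f1 f2 f3 gamma Hk Hf1 Hf2 Hf3 Hgamma.
destruct (period_pos k Hk) as [Ha Hb]; assert (Hs := sigma_pos k Hk).
assert (Hk' := kc_bounds k Hk).
assert (M2 : Cmod (omega2 k) = 2 * sqrt (k * kc k) * ellK (kc k)).
{ unfold omega2; rewrite Cmod_mult, Cmod_Ci, Cmod_R, Rabs_pos_eq; lra. }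
assert (M1 : Cmod (omega1 k) = 2 * sqrt (k * kc k) * ellK k).
{ unfold omega1; rewrite Cmod_R, Rabs_pos_eq; lra. }
(* On the line the real part of [2 u] is [i + 1 / 2] times [omega1], so [i = 0] and [i = 1] are the
   two vertical lines of the statement. *)
assert (V : forall (i : Z) (al : R), al = (IZR i + / 2) / 2 ->
  winds_once_around (circle_over e1_axis) (fun y : R => gamma (V_line k al y)) (Cmod (omega2 k))).
{ intros i al Hal.
  destruct (gauss_map_vertical k f1 f2 f3 Hk Hf1 Hf2 Hf3 gamma Hgamma i) as [d [d' [Hd [Hd' H]]]].
  (* With [s = sqrt (k k')] the Jacobi argument advances at rate [2 / s] over the length [2 s K'],
     which makes [4 K']. *)
  apply (jacobi_winds_once (kc k) (2 * / sqrt (k * kc k)) _ _ (d, 0, 0) (0, 0, d')).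
  - exact Hk'.
  - rewrite M2; now apply rate_times_period.
  - unfold dot; lra.
  - unfold dot; lra.
  - unfold dot; lra.
  - intros x; now apply circle_over_e1.
  - intros y t Ct St; rewrite kc_kc in St by exact Hk.
    replace (V_line k al y) with (((IZR i * (2 * sqrt (k * kc k) * ellK k) + 2 * sqrt (k * kc k) * ellK k / 2) / 2, y) : C).
    + rewrite H; unfold circle_point; rewrite Ct, St; f_equal; [f_equal |]; unfold Rdiv; ring.
    + unfold V_line, omega1, Ci, Cmult, Cplus, RtoC; simpl; rewrite Hal; f_equal; field. }
split; [split |].
- apply (V 0%Z); lra.
- apply (V 1%Z); lra.
- destruct (gauss_map_horizontal k f1 f2 f3 Hk Hf1 Hf2 Hf3 gamma Hgamma) as [d [d' [Hd [Hd' H]]]].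
  apply (jacobi_winds_once k (2 * / sqrt (k * kc k)) _ _ (0, d, 0) (0, 0, d')).
  + exact Hk.
  + rewrite M1; now apply rate_times_period.
  + unfold dot; lra.
  + unfold dot; lra.
  + unfold dot; lra.
  + intros x; now apply circle_over_e2.
  + intros x t Ct St.
    replace (H_line k (1 / 4) x) with ((x, 2 * sqrt (k * kc k) * ellK (kc k) / 4) : C).
    * rewrite H; unfold circle_point; rewrite Ct, St; f_equal; [f_equal |]; unfold Rdiv; ring.
    * unfold H_line, omega2, Ci, Cmult, Cplus, RtoC; simpl; f_equal; field.
Qed.
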